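(* Let $0<r<1$, let $A_r=\{\xi\in\mathbb{C}: r<|\xi|<1\}$, and let $D=A_r\setminus\{-\sqrt{r}\}$. Then for every $z\in(r,\sqrt{r})$, $$S_{D}(z)\neq\tanh\left[c_{A_r}(z,-\sqrt{r})\right].$$
   Context: Let $\mathbb{D}=\{\xi\in\mathbb{C}:|\xi|<1\}$. The Carathéodory pseudodistance on a domain $G\subseteq\mathbb{C}$ is $$c_G(\xi_1,\xi_2)=\sup\{\tanh^{-1}|\alpha| : f:G\to\mathbb{D}\text{ holomorphic},\ f(\xi_1)=0,\ f(\xi_2)=\alpha\}.$$ For a bounded domain $G\subseteq\mathbb{C}$, $z\in G$, and an injective holomorphic map $f:G\to\mathbb{D}$ with $f(z)=0$, let $$S_G(z,f)=\sup\{s : \mathbb{D}(0,s)\subseteq f(G)\},$$ where $\mathbb{D}(0,s)$ is the Euclidean disc of radius $s$ centred at the origin. The squeezing function of $G$ is $S_G(z)=\sup_f S_G(z,f)$, the supremum over all injective holomorphic $f:G\to\mathbb{D}$ with $f(z)=0$. *)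

(* Defs.v *)
From Stdlib Require Import Reals.
From Coquelicot Require Import Coquelicot.
Open Scope R_scope.

Definition Cdisc (s : R) (w : C) : Prop := Cmod w < s.

(* A map G -> D is represented by a total function C -> C of which only the
   values on G are constrained; for open G, differentiability at the points of
   G depends only on those values. *)
Definition holomorphic_on (G : C -> Prop) (f : C -> C) : Prop :=
  forall w : C, G w -> ex_derive (K := C_AbsRing) (V := C_NormedModule) f w.

Definition holomorphic_into_disc (G : C -> Prop) (f : C -> C) : Prop :=
  holomorphic_on G f /\ (forall w : C, G w -> Cdisc 1 (f w)).

Definition injective_on (G : C -> Prop) (f : C -> C) : Prop :=
  forall u v : C, G u -> G v -> f u = f v -> u = v.

Definition image_of (G : C -> Prop) (f : C -> C) (y : C) : Prop :=
  exists w : C, G w /\ f w = y.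

(* The inverse of tanh, used on [0, 1) only. *)
Definition artanh (x : R) : R := / 2 * ln ((1 + x) / (1 - x)).

(* On a domain G and for points of G this supremum is finite, so [real] loses
   nothing. *)
Definition caratheodory (G : C -> Prop) (z1 z2 : C) : R :=
  real (Lub_Rbar (fun t : R => exists (f : C -> C) (alpha : C),
    holomorphic_into_disc G f /\ f z1 = RtoC 0 /\ f z2 = alpha /\
    t = artanh (Cmod alpha))).

(* When f maps G into the unit disc, the radii s lie in [0, 1] and s = 0
   qualifies, so this supremum is finite and lies in [0, 1]. *)
Definition squeezing_at (G : C -> Prop) (f : C -> C) : R :=
  real (Lub_Rbar (fun s : R =>
    0 <= s /\ (forall y : C, Cdisc s y -> image_of G f y))).

Definition squeezing (G : C -> Prop) (z : C) : R :=
  real (Lub_Rbar (fun t : R => exists f : C -> C,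
    holomorphic_into_disc G f /\ injective_on G f /\ f z = RtoC 0 /\
    t = squeezing_at G f)).

Definition annulus (r : R) (w : C) : Prop := r < Cmod w < 1.

Definition punctured_annulus (r : R) (w : C) : Prop :=
  annulus r w /\ w <> RtoC (- sqrt r).

(* Main.v *)
(** A competitor f for the squeezing function extends over the puncture p = -sqrt r to an
    injective map on the annulus, and omits f(p) on the punctured annulus, so the radius of
    a disc contained in its image is at most |f(p)| <= M = tanh c(z, p).  If the two
    suprema agreed, a limit of competitors would be an injective extremal map h of the
    Caratheodory problem whose image contains the disc of radius M = |h(p)|.  Extremal
    maps are unique up to rotation, so, normalised by h(p) = M, h commutes with complex
    conjugation.  Hence the preimage of the segment [0, M) is real; it starts at z > 0 and
    cannot leave the positive axis, whereas near M it must approach p < 0. *)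

Require Import Defs.
From Stdlib Require Import Reals Lra Lia Classical ClassicalEpsilon.
From Coquelicot Require Import Coquelicot.
From mathcomp Require filter.
Open Scope R_scope.

(** * Complex derivatives in epsilon-delta form *)

(** The complex analysis rests on one real-variable fact, Goursat's theorem for rectangles. The
    substitution [b + cexp (x, y)] turns circles around [b] into vertical segments, so rectangles
    alone give the mean value property and with it the maximum principle. The further theory applies
    that principle to suitable quotients and products, without power series or winding numbers.
    Limits run along a free ultrafilter on the naturals: every bounded sequence converges along it,
    so a whole family gets a pointwise limit at once and no subsequence is extracted. For such
    limits to stay differentiable, the estimates need constants that depend only on a radius and a
    bound. The delicate point is that the limit map still covers the disc of radius M, since
    preimages could drift to the boundary of the annulus. Schwarz-Pick for the inverse maps, and for
    these followed by the involution [w -> r / w], excludes both boundary circles. Uniqueness of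
    extremal maps comes from the midpoint of two of them: strict convexity of the disc leaves room
    for a correction built from the square of their difference. *)

Lemma Cmod_minus_sym (a b : C) : Cmod (a - b) = Cmod (b - a).
Proof. rewrite <- Cmod_opp. f_equal. ring. Qed.

Lemma Cmod_minus_triangle (a b c : C) : Cmod (a - c) <= Cmod (a - b) + Cmod (b - c).
Proof. replace (a - c)%C with ((a - b) + (b - c))%C by ring. apply Cmod_triangle. Qed.

Lemma Cmod_minus_le (a b : C) : Cmod (a - b) <= Cmod a + Cmod b.
Proof. rewrite <- (Cmod_opp b). apply Cmod_triangle. Qed.

Lemma Cmod_minus_ge (a b : C) : Cmod a - Cmod b <= Cmod (a - b).
Proof.
  assert (H := Cmod_triangle (a - b) b).
  replace (a - b + b)%C with a in H by ring. lra.
Qed.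

Lemma Cmod_diag (a : C) : Cmod (a - a) = 0.
Proof. replace (a - a)%C with (RtoC 0) by ring. apply Cmod_0. Qed.

Lemma Cminus_neq_0 (a b : C) : a <> b -> (a - b)%C <> 0.
Proof.
  intros H E. apply H. replace a with ((a - b) + b)%C by ring. rewrite E. ring.
Qed.

Lemma Cmod_minus_pos (a b : C) : a <> b -> 0 < Cmod (a - b).
Proof. intros H. apply Cmod_gt_0. apply Cminus_neq_0, H. Qed.

Lemma Cmod_minus_eq_0 (a b : C) : Cmod (a - b) = 0 -> a = b.
Proof.
  intros H. destruct (classic (a = b)) as [|N]; [easy|].
  apply Cmod_minus_pos in N. lra.
Qed.

Lemma Cmod_small_eq (a b : C) : (forall e, 0 < e -> Cmod (a - b) <= e) -> a = b.
Proof.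
  intros H. destruct (classic (a = b)) as [|N]; [easy|].
  apply Cmod_minus_pos in N. specialize (H (Cmod (a - b) / 2) ltac:(lra)). lra.
Qed.

Definition cderiv (f : C -> C) (a l : C) : Prop :=
  forall e, 0 < e -> exists d, 0 < d /\ forall w, Cmod (w - a) < d ->
    Cmod (f w - f a - l * (w - a)) <= e * Cmod (w - a).

Definition cdiff (f : C -> C) (a : C) : Prop := exists l, cderiv f a l.

Definition ccont (f : C -> C) (a : C) : Prop :=
  forall e, 0 < e -> exists d, 0 < d /\ forall w, Cmod (w - a) < d ->
    Cmod (f w - f a) < e.

Lemma ex_derive_cdiff (f : C -> C) (a : C) :
  ex_derive (K := C_AbsRing) (V := C_NormedModule) f a <-> cdiff f a.
Proof.
  split.
  - intros [l [_ H]]. exists l. intros e He.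
    destruct (H a (fun P h => h) (mkposreal e He)) as [d Hd].
    exists d. split; [apply cond_pos|]. intros w Hw.
    specialize (Hd w Hw). simpl in Hd.
    replace (f w - f a - l * (w - a))%C
      with (minus (minus (f w) (f a)) (scal (minus w a) l) : C).
    + exact Hd.
    + change ((f w - f a) - ((w - a) * l) = f w - f a - l * (w - a))%C. ring.
  - intros [l H]. exists l. split.
    + apply is_linear_scal_l.
    + intros x Hx. assert (E : a = x).
      { apply (is_filter_lim_locally_unique (K := C_AbsRing) (V := AbsRing_NormedModule C_AbsRing)). exact Hx. }
      subst x. intros eps. destruct (H eps (cond_pos eps)) as [d [Hd H']].
      exists (mkposreal d Hd). intros w Hw. specialize (H' w Hw).
      replace (f w - f a - l * (w - a))%C
        with (minus (minus (f w) (f a)) (scal (minus w a) l) : C) in H'.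
      * exact H'.
      * change ((f w - f a) - ((w - a) * l) = f w - f a - l * (w - a))%C. ring.
Qed.

(** Besides continuity, this supplies the crude bound on difference quotients near [a] that makes
    [a] a removable exceptional point. *)
Lemma cderiv_lipschitz (f : C -> C) (a l : C) : cderiv f a l ->
  exists d, 0 < d /\ forall w, Cmod (w - a) < d ->
    Cmod (f w - f a) <= (Cmod l + 1) * Cmod (w - a).
Proof.
  intros H. destruct (H 1 Rlt_0_1) as [d [Hd H']].
  exists d. split; [easy|]. intros w Hw. specialize (H' w Hw).
  replace (f w - f a)%C with ((f w - f a - l * (w - a)) + l * (w - a))%C by ring.
  eapply Rle_trans; [apply Cmod_triangle|]. rewrite Cmod_mult. lra.
Qed.

Lemma cdiff_ccont (f : C -> C) (a : C) : cdiff f a -> ccont f a.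
Proof.
  intros [l H] e He. destruct (cderiv_lipschitz f a l H) as [d [Hd H']].
  assert (Hl := Cmod_ge_0 l).
  exists (Rmin d (e / (Cmod l + 1))). split.
  - apply Rmin_glb_lt; [easy|]. apply Rdiv_lt_0_compat; lra.
  - intros w Hw. eapply Rle_lt_trans.
    + apply H'. eapply Rlt_le_trans; [exact Hw|apply Rmin_l].
    + assert (Cmod (w - a) < e / (Cmod l + 1)).
      { eapply Rlt_le_trans; [exact Hw|apply Rmin_r]. }
      replace e with ((Cmod l + 1) * (e / (Cmod l + 1))) by (field; lra).
      apply Rmult_lt_compat_l; lra.
Qed.


Lemma cderiv_local (f g : C -> C) (a l : C) (d : R) : 0 < d ->
  (forall w, Cmod (w - a) < d -> f w = g w) -> cderiv f a l -> cderiv g a l.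
Proof.
  intros Hd E H e He. destruct (H e He) as [d' [Hd' H']].
  exists (Rmin d d'). split; [now apply Rmin_glb_lt|].
  intros w Hw. rewrite <- !E.
  - apply H'. eapply Rlt_le_trans; [exact Hw|apply Rmin_r].
  - rewrite Cmod_diag. lra.
  - eapply Rlt_le_trans; [exact Hw|apply Rmin_l].
Qed.

Lemma cdiff_local (f g : C -> C) (a : C) (d : R) : 0 < d ->
  (forall w, Cmod (w - a) < d -> f w = g w) -> cdiff f a -> cdiff g a.
Proof. intros Hd E [l H]. exists l. now apply (cderiv_local f g a l d). Qed.

Lemma cderiv_const (c a : C) : cderiv (fun _ => c) a 0.
Proof.
  intros e He. exists 1. split; [lra|]. intros w _.
  replace (c - c - 0 * (w - a))%C with (RtoC 0) by ring. rewrite Cmod_0.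
  apply Rmult_le_pos; [lra|apply Cmod_ge_0].
Qed.

Lemma cderiv_id (a : C) : cderiv (fun w => w) a 1.
Proof.
  intros e He. exists 1. split; [lra|]. intros w _.
  replace (w - a - 1 * (w - a))%C with (RtoC 0) by ring. rewrite Cmod_0.
  apply Rmult_le_pos; [lra|apply Cmod_ge_0].
Qed.

Lemma cderiv_plus (f g : C -> C) (a l m : C) :
  cderiv f a l -> cderiv g a m -> cderiv (fun w => f w + g w)%C a (l + m).
Proof.
  intros Hf Hg e He.
  destruct (Hf (e / 2) ltac:(lra)) as [d1 [Hd1 H1]].
  destruct (Hg (e / 2) ltac:(lra)) as [d2 [Hd2 H2]].
  exists (Rmin d1 d2). split; [now apply Rmin_glb_lt|]. intros w Hw.
  specialize (H1 w (Rlt_le_trans _ _ _ Hw (Rmin_l _ _))).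
  specialize (H2 w (Rlt_le_trans _ _ _ Hw (Rmin_r _ _))).
  replace (f w + g w - (f a + g a) - (l + m) * (w - a))%C
    with ((f w - f a - l * (w - a)) + (g w - g a - m * (w - a)))%C by ring.
  eapply Rle_trans; [apply Cmod_triangle|]. lra.
Qed.

Lemma cderiv_mult (f g : C -> C) (a l m : C) :
  cderiv f a l -> cderiv g a m ->
  cderiv (fun w => f w * g w)%C a (l * g a + f a * m).
Proof.
  intros Hf Hg e He.
  destruct (cderiv_lipschitz f a l Hf) as [d3 [Hd3 H3]].
  destruct (cderiv_lipschitz g a m Hg) as [d4 [Hd4 H4]].
  assert (Pga := Cmod_ge_0 (g a)). assert (Pfa := Cmod_ge_0 (f a)).
  assert (Pl := Cmod_ge_0 l). assert (Pm := Cmod_ge_0 m).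
  set (K := Cmod (g a) + Cmod (f a) + 1).
  set (L := (Cmod l + 1) * (Cmod m + 1)).
  assert (HK : 0 < K) by (unfold K; lra). assert (HL : 0 < L) by (unfold L; nra).
  assert (HeK : 0 < e / 2 / K) by (apply Rdiv_lt_0_compat; lra).
  assert (HeL : 0 < e / 2 / L) by (apply Rdiv_lt_0_compat; lra).
  destruct (Hf (e / 2 / K) HeK) as [d1 [Hd1 H1]].
  destruct (Hg (e / 2 / K) HeK) as [d2 [Hd2 H2]].
  exists (Rmin (Rmin d1 d2) (Rmin (Rmin d3 d4) (e / 2 / L))).
  split; [repeat apply Rmin_glb_lt; easy|]. intros w Hw.
  assert (W1 : Cmod (w - a) < d1 /\ Cmod (w - a) < d2 /\ Cmod (w - a) < d3 /\
    Cmod (w - a) < d4 /\ Cmod (w - a) < e / 2 / L).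
  { repeat split; eapply Rlt_le_trans; try exact Hw.
    - eapply Rle_trans; [apply Rmin_l|apply Rmin_l].
    - eapply Rle_trans; [apply Rmin_l|apply Rmin_r].
    - eapply Rle_trans; [apply Rmin_r|]. eapply Rle_trans; [apply Rmin_l|apply Rmin_l].
    - eapply Rle_trans; [apply Rmin_r|]. eapply Rle_trans; [apply Rmin_l|apply Rmin_r].
    - eapply Rle_trans; [apply Rmin_r|apply Rmin_r]. }
  destruct W1 as [W1 [W2 [W3 [W4 W5]]]].
  specialize (H1 w W1). specialize (H2 w W2). specialize (H3 w W3). specialize (H4 w W4).
  replace (f w * g w - f a * g a - (l * g a + f a * m) * (w - a))%C
    with ((f w - f a - l * (w - a)) * g a + f a * (g w - g a - m * (w - a))
          + (f w - f a) * (g w - g a))%C by ring.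
  eapply Rle_trans; [apply Cmod_triangle|].
  eapply Rle_trans; [apply Rplus_le_compat_r, Cmod_triangle|].
  rewrite !Cmod_mult.
  set (D := Cmod (w - a)) in *. assert (PD : 0 <= D) by apply Cmod_ge_0.
  assert (A1 : Cmod (f w - f a - l * (w - a)) * Cmod (g a) <= e / 2 / K * D * Cmod (g a)).
  { apply Rmult_le_compat_r; easy. }
  assert (A2 : Cmod (f a) * Cmod (g w - g a - m * (w - a)) <= Cmod (f a) * (e / 2 / K * D)).
  { apply Rmult_le_compat_l; easy. }
  assert (A3 : Cmod (f w - f a) * Cmod (g w - g a) <= ((Cmod l + 1) * D) * ((Cmod m + 1) * D)).
  { apply Rmult_le_compat; try apply Cmod_ge_0; easy. }
  assert (A4 : L * D * D <= L * (e / 2 / L) * D).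
  { apply Rmult_le_compat_r; [easy|]. apply Rmult_le_compat_l; lra. }
  replace (L * (e / 2 / L) * D) with (e / 2 * D) in A4 by (field; lra).
  assert (A5 : e / 2 / K * D * (Cmod (g a) + Cmod (f a)) <= e / 2 / K * D * K).
  { apply Rmult_le_compat_l; [nra|unfold K; lra]. }
  replace (e / 2 / K * D * K) with (e / 2 * D) in A5 by (field; lra).
  unfold L in A4. lra.
Qed.

Lemma cderiv_comp (f g : C -> C) (a l m : C) :
  cderiv f a l -> cderiv g (f a) m -> cderiv (fun w => g (f w)) a (m * l).
Proof.
  intros Hf Hg e He.
  destruct (cderiv_lipschitz f a l Hf) as [d3 [Hd3 H3]].
  assert (Pl := Cmod_ge_0 l). assert (Pm := Cmod_ge_0 m).
  set (K := Cmod m + 1). set (L := Cmod l + 1).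
  assert (HK : 0 < K) by (unfold K; lra). assert (HL : 0 < L) by (unfold L; lra).
  assert (HeK : 0 < e / 2 / K) by (apply Rdiv_lt_0_compat; lra).
  assert (HeL : 0 < e / 2 / L) by (apply Rdiv_lt_0_compat; lra).
  destruct (Hf (e / 2 / K) HeK) as [d1 [Hd1 H1]].
  destruct (Hg (e / 2 / L) HeL) as [d2 [Hd2 H2]].
  assert (Hd2L : 0 < d2 / L) by (apply Rdiv_lt_0_compat; lra).
  exists (Rmin d1 (Rmin d3 (d2 / L))).
  split; [repeat apply Rmin_glb_lt; easy|]. intros w Hw.
  assert (W1 : Cmod (w - a) < d1 /\ Cmod (w - a) < d3 /\ Cmod (w - a) < d2 / L).
  { repeat split; eapply Rlt_le_trans; try exact Hw.
    - apply Rmin_l.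
    - eapply Rle_trans; [apply Rmin_r|apply Rmin_l].
    - eapply Rle_trans; [apply Rmin_r|apply Rmin_r]. }
  destruct W1 as [W1 [W3 W2]].
  specialize (H1 w W1). specialize (H3 w W3). fold L in H3.
  set (D := Cmod (w - a)) in *. assert (PD : 0 <= D) by apply Cmod_ge_0.
  assert (W4 : Cmod (f w - f a) < d2).
  { eapply Rle_lt_trans; [exact H3|].
    replace d2 with (L * (d2 / L)) by (field; lra). apply Rmult_lt_compat_l; lra. }
  specialize (H2 (f w) W4).
  replace (g (f w) - g (f a) - m * l * (w - a))%C
    with ((g (f w) - g (f a) - m * (f w - f a)) + m * (f w - f a - l * (w - a)))%C by ring.
  eapply Rle_trans; [apply Cmod_triangle|]. rewrite Cmod_mult.
  assert (A1 : e / 2 / L * Cmod (f w - f a) <= e / 2 / L * (L * D)).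
  { apply Rmult_le_compat_l; lra. }
  replace (e / 2 / L * (L * D)) with (e / 2 * D) in A1 by (field; lra).
  assert (A2 : Cmod m * Cmod (f w - f a - l * (w - a)) <= K * (e / 2 / K * D)).
  { apply Rmult_le_compat; try easy; [apply Cmod_ge_0|unfold K; lra]. }
  replace (K * (e / 2 / K * D)) with (e / 2 * D) in A2 by (field; lra).
  lra.
Qed.

Lemma cderiv_inv (b : C) : b <> 0 -> cderiv (fun w => / w)%C b (- / (b * b)).
Proof.
  intros Hb e He. assert (Pb : 0 < Cmod b) by now apply Cmod_gt_0.
  set (B := Cmod b) in *.
  assert (PB : 0 < e * (B * B * B) / 2) by (apply Rdiv_lt_0_compat; [|lra]; repeat apply Rmult_lt_0_compat; lra).
  exists (Rmin (B / 2) (e * (B * B * B) / 2)). split.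
  { apply Rmin_glb_lt; lra. }
  intros w Hw.
  assert (W1 := Rlt_le_trans _ _ _ Hw (Rmin_l _ _)).
  assert (W2 := Rlt_le_trans _ _ _ Hw (Rmin_r _ _)).
  assert (Pw : B / 2 < Cmod w).
  { assert (T := Cmod_minus_ge b w). rewrite Cmod_minus_sym in T. fold B in T. lra. }
  assert (w <> 0) by (apply Cmod_gt_0; lra).
  replace (/ w - / b - - / (b * b) * (w - b))%C
    with ((w - b) * (w - b) * / (w * (b * b)))%C by (field; easy).
  rewrite !Cmod_mult, Cmod_inv, !Cmod_mult.
  2: { intros E. apply Cmod_gt_0 in Hb. apply Cmod_gt_0 in H.
       assert (E' : Cmod (w * (b * b)) = 0) by (rewrite E; apply Cmod_0).
       rewrite !Cmod_mult in E'. assert (0 < Cmod w * (Cmod b * Cmod b)); [|lra].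
       repeat apply Rmult_lt_0_compat; easy. }
  fold B. set (D := Cmod (w - b)) in *. assert (PD : 0 <= D) by apply Cmod_ge_0.
  replace (e * D) with (D * e) by ring. rewrite Rmult_assoc. apply Rmult_le_compat_l; [easy|].
  assert (Q : 0 < Cmod w * (B * B)) by (repeat apply Rmult_lt_0_compat; lra).
  apply Rmult_le_reg_r with (Cmod w * (B * B)); [easy|].
  rewrite Rmult_assoc, Rinv_l by lra.
  assert (e * (B / 2 * (B * B)) <= e * (Cmod w * (B * B))).
  { apply Rmult_le_compat_l; [lra|]. apply Rmult_le_compat_r; nra. }
  lra.
Qed.

(** * Rules for complex differentiability *)

Lemma cdiff_const (c a : C) : cdiff (fun _ => c) a.
Proof. eexists. apply cderiv_const. Qed.

Lemma cdiff_id (a : C) : cdiff (fun w => w) a.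
Proof. eexists. apply cderiv_id. Qed.

Lemma cdiff_plus (f g : C -> C) (a : C) :
  cdiff f a -> cdiff g a -> cdiff (fun w => f w + g w)%C a.
Proof. intros [l Hl] [m Hm]. eexists. apply cderiv_plus; eassumption. Qed.

Lemma cdiff_mult (f g : C -> C) (a : C) :
  cdiff f a -> cdiff g a -> cdiff (fun w => f w * g w)%C a.
Proof. intros [l Hl] [m Hm]. eexists. apply cderiv_mult; eassumption. Qed.

Lemma cdiff_comp (f g : C -> C) (a : C) :
  cdiff f a -> cdiff g (f a) -> cdiff (fun w => g (f w)) a.
Proof. intros [l Hl] [m Hm]. eexists. eapply cderiv_comp; eassumption. Qed.

Lemma cdiff_minus (f g : C -> C) (a : C) :
  cdiff f a -> cdiff g a -> cdiff (fun w => f w - g w)%C a.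
Proof.
  intros Hf Hg. apply (cdiff_local (fun w => f w + (-(1)) * g w)%C _ a 1); [lra| |].
  - intros w _. ring.
  - apply cdiff_plus; [easy|]. apply cdiff_mult; [apply cdiff_const|easy].
Qed.

Lemma cdiff_inv (f : C -> C) (a : C) :
  cdiff f a -> f a <> 0 -> cdiff (fun w => / f w)%C a.
Proof.
  intros Hf H. apply (cdiff_comp f (fun w => / w)%C); [easy|].
  eexists. now apply cderiv_inv.
Qed.

Lemma cdiff_div (f g : C -> C) (a : C) :
  cdiff f a -> cdiff g a -> g a <> 0 -> cdiff (fun w => f w / g w)%C a.
Proof. intros Hf Hg H. apply cdiff_mult; [easy|]. now apply cdiff_inv. Qed.

Lemma cdiff_pow (f : C -> C) (a : C) (n : nat) :
  cdiff f a -> cdiff (fun w => f w ^ n)%C a.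
Proof.
  intros Hf. induction n as [|n IH]; simpl.
  - apply cdiff_const.
  - now apply cdiff_mult.
Qed.

Lemma cdiff_conj (f : C -> C) (a : C) :
  cdiff f (Cconj a) -> cdiff (fun w => Cconj (f (Cconj w))) a.
Proof.
  intros [l H]. exists (Cconj l). intros e He. destruct (H e He) as [d [Hd H']].
  exists d. split; [easy|]. intros w Hw.
  assert (E : Cmod (Cconj w - Cconj a) = Cmod (w - a)).
  { rewrite <- Cminus_conj. apply Cmod_conj. }
  rewrite <- E in *. specialize (H' _ Hw).
  rewrite <- Cmod_conj in H'. rewrite !Cminus_conj, Cmult_conj, Cminus_conj, !Cconj_conj in H'.
  rewrite <- (Cconj_conj w), <- (Cconj_conj a), !Cconj_conj in H' |- *.
  exact H'.
Qed.

(** * Goursat's theorem in real form *)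

(** Real differentiability with Jacobian rows [(a, -b)] and [(b, a)], that is, the Cauchy-Riemann
    equations. Nothing is assumed about continuity of the derivative, hence Goursat's subdivision
    instead of Green's formula. *)
Definition cr_diff (U V : R -> R -> R) (x0 y0 : R) : Prop :=
  exists a b, forall e, 0 < e -> exists d, 0 < d /\
    forall x y, Rabs (x - x0) < d -> Rabs (y - y0) < d ->
      Rabs (U x y - U x0 y0 - (a * (x - x0) - b * (y - y0)))
        <= e * (Rabs (x - x0) + Rabs (y - y0)) /\
      Rabs (V x y - V x0 y0 - (b * (x - x0) + a * (y - y0)))
        <= e * (Rabs (x - x0) + Rabs (y - y0)).

Lemma continuous_of_linear_error (f : R -> R) (t0 a : R) :
  (exists d, 0 < d /\ forall t, Rabs (t - t0) < d ->
     Rabs (f t - f t0 - a * (t - t0)) <= Rabs (t - t0)) ->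
  continuous f t0.
Proof.
  intros [d [Hd H]]. apply filterlim_locally. intros eps.
  assert (He := cond_pos eps). assert (Pa := Rabs_pos a).
  assert (Hq : 0 < eps / (Rabs a + 1)) by (apply Rdiv_lt_0_compat; lra).
  exists (mkposreal _ (Rmin_glb_lt _ _ _ Hd Hq)). intros t Ht.
  change (Rabs (t - t0) < Rmin d (eps / (Rabs a + 1))) in Ht.
  change (Rabs (f t - f t0) < eps).
  assert (H1 := Rlt_le_trans _ _ _ Ht (Rmin_l _ _)).
  assert (H2 := Rlt_le_trans _ _ _ Ht (Rmin_r _ _)).
  specialize (H t H1).
  replace (f t - f t0) with ((f t - f t0 - a * (t - t0)) + a * (t - t0)) by ring.
  eapply Rle_lt_trans; [apply Rabs_triang|]. rewrite Rabs_mult.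
  apply Rle_lt_trans with ((Rabs a + 1) * Rabs (t - t0)); [lra|].
  replace (pos eps) with ((Rabs a + 1) * (eps / (Rabs a + 1))) by (field; lra).
  apply Rmult_lt_compat_l; lra.
Qed.

Lemma cr_diff_continuous (U V : R -> R -> R) (x0 y0 : R) : cr_diff U V x0 y0 ->
  continuous (fun y => U x0 y) y0 /\ continuous (fun x => V x y0) x0.
Proof.
  intros [a [b H]]. destruct (H 1 Rlt_0_1) as [d [Hd H']].
  split.
  - apply continuous_of_linear_error with (- b). exists d. split; [easy|].
    intros y Hy. destruct (H' x0 y) as [H1 _].
    + rewrite Rminus_diag, Rabs_R0. easy.
    + easy.
    + rewrite Rminus_diag, Rabs_R0 in H1.
      replace (U x0 y - U x0 y0 - - b * (y - y0))
        with (U x0 y - U x0 y0 - (a * 0 - b * (y - y0))) by ring. lra.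
  - apply continuous_of_linear_error with b. exists d. split; [easy|].
    intros x Hx. destruct (H' x y0) as [_ H1].
    + easy.
    + rewrite Rminus_diag, Rabs_R0. easy.
    + rewrite Rminus_diag, Rabs_R0 in H1.
      replace (V x y0 - V x0 y0 - b * (x - x0))
        with (V x y0 - V x0 y0 - (b * (x - x0) + a * 0)) by ring. lra.
Qed.

(** The imaginary part of the contour integral of [U + i V] around the rectangle. [U] is integrated
    only along vertical sides and [V] only along horizontal ones. *)
Definition rect_flux (U V : R -> R -> R) (x1 x2 y1 y2 : R) : R :=
  RInt (fun y => U x2 y - U x1 y) y1 y2 - RInt (fun x => V x y2 - V x y1) x1 x2.

Section Goursat.

Variables (U V : R -> R -> R) (T : R).
(** A left half-plane is where the logarithmic coordinates of a punctured disc live. *)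
Hypothesis HCR : forall x y, x < T -> cr_diff U V x y.

Let cU x y : x < T -> continuous (fun y => U x y) y.
Proof. intros H. now apply (cr_diff_continuous U V), HCR. Qed.

Let cV x y : x < T -> continuous (fun x => V x y) x.
Proof. intros H. now apply (cr_diff_continuous U V), HCR. Qed.

Let iU x1 x2 y1 y2 : x1 < T -> x2 < T -> ex_RInt (fun y => U x2 y - U x1 y) y1 y2.
Proof.
  intros H1 H2. apply (ex_RInt_minus (V := R_NormedModule));
    apply (ex_RInt_continuous (V := R_CompleteNormedModule)); intros; now apply cU.
Qed.

Let iV x1 x2 y1 y2 : x1 < T -> x2 < T -> ex_RInt (fun x => V x y2 - V x y1) x1 x2.
Proof.
  intros H1 H2. apply (ex_RInt_minus (V := R_NormedModule));
    apply (ex_RInt_continuous (V := R_CompleteNormedModule)); intros x Hx; apply cV;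
    apply Rle_lt_trans with (Rmax x1 x2); try apply Hx; now apply Rmax_lub_lt.
Qed.

Lemma rect_flux_split_x (x1 m x2 y1 y2 : R) : x1 < T -> m < T -> x2 < T ->
  rect_flux U V x1 x2 y1 y2 = rect_flux U V x1 m y1 y2 + rect_flux U V m x2 y1 y2.
Proof.
  intros H1 Hm H2. unfold rect_flux.
  rewrite <- (RInt_Chasles (V := R_CompleteNormedModule) _ x1 m x2) by now apply iV.
  replace (RInt (fun y => U x2 y - U x1 y) y1 y2)
    with (plus (RInt (fun y => U m y - U x1 y) y1 y2) (RInt (fun y => U x2 y - U m y) y1 y2)).
  - unfold plus; simpl. ring.
  - rewrite <- (RInt_plus (V := R_CompleteNormedModule)) by now apply iU.
    apply RInt_ext. intros y _. unfold plus; simpl. ring.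
Qed.

Lemma rect_flux_split_y (x1 x2 y1 m y2 : R) : x1 < T -> x2 < T ->
  rect_flux U V x1 x2 y1 y2 = rect_flux U V x1 x2 y1 m + rect_flux U V x1 x2 m y2.
Proof.
  intros H1 H2. unfold rect_flux.
  rewrite <- (RInt_Chasles (V := R_CompleteNormedModule) _ y1 m y2) by now apply iU.
  replace (RInt (fun x => V x y2 - V x y1) x1 x2)
    with (plus (RInt (fun x => V x m - V x y1) x1 x2) (RInt (fun x => V x y2 - V x m) x1 x2)).
  - unfold plus; simpl. ring.
  - rewrite <- (RInt_plus (V := R_CompleteNormedModule)) by now apply iV.
    apply RInt_ext. intros y _. unfold plus; simpl. ring.
Qed.

Lemma RInt_near_const (f : R -> R) (a b c K : R) : a <= b -> ex_RInt f a b ->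
  (forall t, a <= t <= b -> Rabs (f t - c) <= K) ->
  Rabs (RInt f a b - c * (b - a)) <= K * (b - a).
Proof.
  intros Hab Hf H.
  replace (c * (b - a)) with (RInt (fun _ => c) a b)
    by (rewrite RInt_const; unfold scal; simpl; unfold mult; simpl; ring).
  replace (RInt f a b - RInt (fun _ => c) a b) with (RInt (fun t => f t - c) a b).
  - rewrite Rmult_comm. apply abs_RInt_le_const; [easy| |easy].
    apply (ex_RInt_minus (V := R_NormedModule)); [easy|apply ex_RInt_const].
  - apply (RInt_minus (V := R_CompleteNormedModule)); [easy|apply ex_RInt_const].
Qed.

(** The linear part has no flux: both integrals are close to [a * l * h], which cancels. What
    remains is an error of [2 * e * (l + h)] per unit length on sides of lengths [h] and [l]. *)
Lemma rect_flux_small (xs ys e : R) : xs < T -> 0 < e -> exists d, 0 < d /\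
  forall x y l h, 0 <= l < d -> 0 <= h < d -> x <= xs <= x + l -> y <= ys <= y + h ->
    x + l < T ->
    Rabs (rect_flux U V x (x + l) y (y + h)) <= 2 * e * (l + h) * (l + h).
Proof.
  intros Hxs He. destruct (HCR xs ys Hxs) as [a [b H]].
  destruct (H e He) as [d [Hd H']]. exists d. split; [easy|].
  intros x y l h Hl Hh Hx Hy HT.
  assert (near : forall s t, x <= s <= x + l -> y <= t <= y + h ->
    Rabs (s - xs) <= l /\ Rabs (t - ys) <= h).
  { intros s t Hs Ht. split; apply Rabs_le; lra. }
  assert (est : forall s t, x <= s <= x + l -> y <= t <= y + h ->
    Rabs (U s t - U xs ys - (a * (s - xs) - b * (t - ys))) <= e * (l + h) /\
    Rabs (V s t - V xs ys - (b * (s - xs) + a * (t - ys))) <= e * (l + h)).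
  { intros s t Hs Ht. destruct (near s t Hs Ht) as [N1 N2].
    destruct (H' s t) as [E1 E2]; [lra|lra|].
    assert (e * (Rabs (s - xs) + Rabs (t - ys)) <= e * (l + h))
      by (apply Rmult_le_compat_l; lra).
    lra. }
  unfold rect_flux.
  assert (B1 := RInt_near_const (fun t => U (x + l) t - U x t) y (y + h) (a * l)
    (2 * e * (l + h)) ltac:(lra) (iU x (x + l) y (y + h) ltac:(lra) ltac:(lra))).
  assert (B2 := RInt_near_const (fun s => V s (y + h) - V s y) x (x + l) (a * h)
    (2 * e * (l + h)) ltac:(lra) (iV x (x + l) y (y + h) ltac:(lra) ltac:(lra))).
  assert (C1 : Rabs (RInt (fun t => U (x + l) t - U x t) y (y + h) - a * l * (y + h - y))
     <= 2 * e * (l + h) * (y + h - y)).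
  { apply B1. intros t Ht.
    destruct (est x t) as [E1 _]; [lra|lra|]. destruct (est (x + l) t) as [E2 _]; [lra|lra|].
    replace (U (x + l) t - U x t - a * l) with
     ((U (x + l) t - U xs ys - (a * (x + l - xs) - b * (t - ys)))
      - (U x t - U xs ys - (a * (x - xs) - b * (t - ys)))) by ring.
    unfold Rminus at 1. eapply Rle_trans; [apply Rabs_triang|]. rewrite Rabs_Ropp. lra. }
  assert (C2 : Rabs (RInt (fun s => V s (y + h) - V s y) x (x + l) - a * h * (x + l - x))
     <= 2 * e * (l + h) * (x + l - x)).
  { apply B2. intros s Hs.
    destruct (est s y) as [_ E1]; [lra|lra|]. destruct (est s (y + h)) as [_ E2]; [lra|lra|].
    replace (V s (y + h) - V s y - a * h) with
     ((V s (y + h) - V xs ys - (b * (s - xs) + a * (y + h - ys)))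
      - (V s y - V xs ys - (b * (s - xs) + a * (y - ys)))) by ring.
    unfold Rminus at 1. eapply Rle_trans; [apply Rabs_triang|]. rewrite Rabs_Ropp. lra. }
  apply Rabs_le_between in C1. apply Rabs_le_between in C2. apply Rabs_le. lra.
Qed.

Lemma rect_flux_quarter (x y l h : R) : 0 <= l -> x + l < T ->
  exists x' y', (x' = x \/ x' = x + l / 2) /\ (y' = y \/ y' = y + h / 2) /\
    Rabs (rect_flux U V x (x + l) y (y + h))
      <= 4 * Rabs (rect_flux U V x' (x' + l / 2) y' (y' + h / 2)).
Proof.
  intros Hl HT. apply NNPP. intros N.
  assert (Q : forall x' y', (x' = x \/ x' = x + l / 2) -> (y' = y \/ y' = y + h / 2) ->
    4 * Rabs (rect_flux U V x' (x' + l / 2) y' (y' + h / 2))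
      < Rabs (rect_flux U V x (x + l) y (y + h))).
  { intros x' y' Hx Hy. apply Rnot_le_lt. intros H. apply N. now exists x', y'. }
  assert (Q1 := Q x y (or_introl eq_refl) (or_introl eq_refl)).
  assert (Q2 := Q x (y + h / 2) (or_introl eq_refl) (or_intror eq_refl)).
  assert (Q3 := Q (x + l / 2) y (or_intror eq_refl) (or_introl eq_refl)).
  assert (Q4 := Q (x + l / 2) (y + h / 2) (or_intror eq_refl) (or_intror eq_refl)).
  replace (x + l / 2 + l / 2) with (x + l) in * by field.
  replace (y + h / 2 + h / 2) with (y + h) in * by field.
  assert (S := rect_flux_split_x x (x + l / 2) (x + l) y (y + h)
    ltac:(lra) ltac:(lra) ltac:(lra)).
  assert (S1 := rect_flux_split_y x (x + l / 2) y (y + h / 2) (y + h) ltac:(lra) ltac:(lra)).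
  assert (S2 := rect_flux_split_y (x + l / 2) (x + l) y (y + h / 2) (y + h)
    ltac:(lra) ltac:(lra)).
  rewrite S1, S2 in S. clear S1 S2 N Q.
  set (W := rect_flux U V x (x + l) y (y + h)) in *.
  set (W1 := rect_flux U V x (x + l / 2) y (y + h / 2)) in *.
  set (W2 := rect_flux U V x (x + l / 2) (y + h / 2) (y + h)) in *.
  set (W3 := rect_flux U V (x + l / 2) (x + l) y (y + h / 2)) in *.
  set (W4 := rect_flux U V (x + l / 2) (x + l) (y + h / 2) (y + h)) in *.
  assert (A : Rabs W <= Rabs W1 + Rabs W2 + Rabs W3 + Rabs W4).
  { rewrite S. eapply Rle_trans; [apply Rabs_triang|].
    assert (A1 := Rabs_triang W1 W2). assert (A2 := Rabs_triang W3 W4). lra. }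
  lra.
Qed.

(** Every left endpoint lies below every right endpoint, so the supremum of the left endpoints lies
    in all the intervals. *)
Lemma nested_halving (x : nat -> R) (l : R) : 0 <= l ->
  (forall n, x (S n) = x n \/ x (S n) = x n + l / 2 ^ n / 2) ->
  exists xs, forall n, x n <= xs <= x n + l / 2 ^ n.
Proof.
  intros Hl H.
  assert (P : forall n, 0 <= l / 2 ^ n).
  { intros n. apply Rle_mult_inv_pos; [easy|]. apply pow_lt; lra. }
  assert (E : forall n, l / 2 ^ S n = l / 2 ^ n / 2).
  { intros n. simpl. field. apply pow_nonzero; lra. }
  assert (I : forall n k, x n <= x (n + k)%nat /\
     x (n + k)%nat + l / 2 ^ (n + k) <= x n + l / 2 ^ n).
  { intros n k. induction k as [|k IH].
    - rewrite Nat.add_0_r. lra.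
    - replace (n + S k)%nat with (S (n + k)) by lia. rewrite E.
      specialize (P (n + k)%nat). destruct (H (n + k)%nat) as [-> | ->]; lra. }
  assert (B : forall m n, x m <= x n + l / 2 ^ n).
  { intros m n. destruct (Nat.le_ge_cases n m) as [L|L].
    - destruct (I n (m - n)%nat) as [_ I2]. replace (n + (m - n))%nat with m in I2 by lia.
      specialize (P m). lra.
    - destruct (I m (n - m)%nat) as [I1 _]. replace (m + (n - m))%nat with n in I1 by lia.
      specialize (P n). lra. }
  destruct (completeness (fun t => exists n, t = x n)) as [xs [U1 U2]].
  - exists (x O + l / 2 ^ O). intros t [n ->]. apply B.
  - exists (x O). now exists O.
  - exists xs. intros n. split.
    + apply U1. now exists n.
    + apply U2. intros t [m ->]. apply B.
Qed.

Lemma goursat (x1 x2 y1 y2 : R) : x1 <= x2 -> x2 < T -> y1 <= y2 ->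
  rect_flux U V x1 x2 y1 y2 = 0.
Proof.
  intros Hx HT Hy. set (l := x2 - x1). set (h := y2 - y1).
  (* The implication makes the step relation total, so that [choice] yields a function on all
     states; [HT'] shows afterwards that the iteration stays in the half-plane. *)
  assert (step : forall p : R * R * nat, exists q : R * R,
    let '(x, y, n) := p in let '(x', y') := q in
    x + l / 2 ^ n < T ->
    (x' = x \/ x' = x + l / 2 ^ n / 2) /\ (y' = y \/ y' = y + h / 2 ^ n / 2) /\
    Rabs (rect_flux U V x (x + l / 2 ^ n) y (y + h / 2 ^ n))
      <= 4 * Rabs (rect_flux U V x' (x' + l / 2 ^ n / 2) y' (y' + h / 2 ^ n / 2))).
  { intros [[x y] n]. destruct (classic (x + l / 2 ^ n < T)) as [C|C].
    - destruct (rect_flux_quarter x y (l / 2 ^ n) (h / 2 ^ n)) as [x' [y' H]].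
      + apply Rle_mult_inv_pos; [unfold l; lra|apply pow_lt; lra].
      + easy.
      + exists (x', y'). intros _. exact H.
    - exists (x, y). intros C'. contradiction. }
  destruct (choice _ step) as [F HF]. clear step.
  set (s := nat_rect (fun _ => (R * R)%type) (x1, y1) (fun n p => F (fst p, snd p, n))).
  set (x := fun n => fst (s n)). set (y := fun n => snd (s n)).
  assert (E : forall c n, c / 2 ^ S n = c / 2 ^ n / 2).
  { intros c n. simpl. field. apply pow_nonzero; lra. }
  assert (P : forall n, 0 <= l / 2 ^ n).
  { intros n. apply Rle_mult_inv_pos; [unfold l; lra|]. apply pow_lt; lra. }
  assert (HF' : forall n, x n + l / 2 ^ n < T ->
    (x (S n) = x n \/ x (S n) = x n + l / 2 ^ n / 2) /\
    (y (S n) = y n \/ y (S n) = y n + h / 2 ^ n / 2) /\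
    Rabs (rect_flux U V (x n) (x n + l / 2 ^ n) (y n) (y n + h / 2 ^ n))
    <= 4 * Rabs (rect_flux U V (x (S n)) (x (S n) + l / 2 ^ S n) (y (S n)) (y (S n) + h / 2 ^ S n))).
  { intros n. rewrite !E. specialize (HF (x n, y n, n)). cbv beta iota in HF.
    assert (Es : F (x n, y n, n) = (x (S n), y (S n))).
    { unfold x, y. simpl. now destruct (F _). }
    rewrite Es in HF. exact HF. }
  assert (HT' : forall n, x n + l / 2 ^ n < T).
  { induction n as [|n IH].
    - unfold x, l; simpl. lra.
    - destruct (HF' n IH) as [[-> | ->] _]; rewrite E; specialize (P n); lra. }
  assert (K : forall n, Rabs (rect_flux U V x1 x2 y1 y2) <=
    4 ^ n * Rabs (rect_flux U V (x n) (x n + l / 2 ^ n) (y n) (y n + h / 2 ^ n))).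
  { induction n as [|n IH].
    - replace (x O) with x1 by easy. replace (y O) with y1 by easy.
      replace (x1 + l / 2 ^ 0) with x2 by (unfold l; simpl; field).
      replace (y1 + h / 2 ^ 0) with y2 by (unfold h; simpl; field). simpl. lra.
    - eapply Rle_trans; [exact IH|]. simpl pow at 4. rewrite (Rmult_comm 4), Rmult_assoc.
      apply Rmult_le_compat_l; [apply pow_le; lra|]. apply HF', HT'. }
  destruct (nested_halving x l) as [xs Hxs]; [unfold l; lra|intros n; apply HF', HT'|].
  destruct (nested_halving y h) as [ys Hys]; [unfold h; lra|intros n; apply HF', HT'|].
  assert (Hxs' : xs < T) by (specialize (Hxs O); specialize (HT' O); lra).
  (* The factor [4 ^ N] from the subdivision cancels against the square of the scale [/ 2 ^ N]. *)
  assert (Z : forall e, 0 < e ->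
     Rabs (rect_flux U V x1 x2 y1 y2) <= 2 * e * (l + h) * (l + h)).
  { intros e He. destruct (rect_flux_small xs ys e Hxs' He) as [d [Hd Hs]].
    destruct (pow_lt_1_zero (/ 2) ltac:(rewrite Rabs_right; lra) (d / (l + h + 1)))
      as [N HN].
    { apply Rdiv_lt_0_compat; [easy|unfold l, h; lra]. }
    specialize (HN N (le_n _)).
    assert (P2 : 0 < 2 ^ N) by (apply pow_lt; lra).
    assert (Pi : 0 < / 2 ^ N) by now apply Rinv_0_lt_compat.
    rewrite pow_inv, Rabs_right in HN by lra.
    assert (S1 : (l + h + 1) * / 2 ^ N < d).
    { replace d with ((l + h + 1) * (d / (l + h + 1))) by (field; unfold l, h; lra).
      apply Rmult_lt_compat_l; [unfold l, h; lra|easy]. }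
    assert (Pl : 0 <= l * / 2 ^ N) by (apply Rmult_le_pos; [unfold l|]; lra).
    assert (Ph : 0 <= h * / 2 ^ N) by (apply Rmult_le_pos; [unfold h|]; lra).
    specialize (Hs (x N) (y N) (l / 2 ^ N) (h / 2 ^ N)).
    unfold Rdiv in Hs. specialize (Hs ltac:(lra) ltac:(lra) (Hxs N) (Hys N) (HT' N)).
    eapply Rle_trans; [apply (K N)|].
    apply Rle_trans with (4 ^ N * (2 * e * (l * / 2 ^ N + h * / 2 ^ N) * (l * / 2 ^ N + h * / 2 ^ N))).
    - apply Rmult_le_compat_l; [apply pow_le; lra|exact Hs].
    - replace 4 with (2 * 2) by ring. rewrite Rpow_mult_distr.
      right. field. lra. }
  destruct (Req_dec (rect_flux U V x1 x2 y1 y2) 0) as [|N]; [easy|].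
  apply Rabs_pos_lt in N.
  set (A := 2 * (l + h) * (l + h)). assert (PA : 0 <= A) by (unfold A, l, h; nra).
  (* With this [e] the bound reads [w <= w * q] for some [q < 1], impossible for [w > 0]. *)
  assert (He : 0 < Rabs (rect_flux U V x1 x2 y1 y2) / (2 * (A + 1))) by (apply Rdiv_lt_0_compat; lra).
  specialize (Z _ He). set (w := Rabs _) in *.
  replace (2 * (w / (2 * (A + 1))) * (l + h) * (l + h)) with (w * (A / (2 * (A + 1)))) in Z
    by (unfold A; field; fold A; lra).
  assert (A / (2 * (A + 1)) < 1).
  { apply Rmult_lt_reg_r with (2 * (A + 1)); [lra|].
    unfold Rdiv. rewrite Rmult_assoc, Rinv_l; lra. }
  nra.
Qed.

End Goursat.

(** * The mean value property *)

Definition cexp (w : C) : C := (exp (fst w) * cos (snd w), exp (fst w) * sin (snd w)).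

Lemma cexp_plus (v w : C) : cexp (v + w) = (cexp v * cexp w)%C.
Proof.
  unfold cexp. destruct v as [a b], w as [c d]. simpl.
  rewrite exp_plus, cos_plus, sin_plus. apply injective_projections; simpl; ring.
Qed.

Lemma Cmod_cexp (w : C) : Cmod (cexp w) = exp (fst w).
Proof.
  unfold Cmod, cexp. simpl.
  replace (_ + _) with (exp (fst w) ^ 2 * (Rsqr (sin (snd w)) + Rsqr (cos (snd w))))
    by (unfold Rsqr; ring).
  rewrite sin2_cos2, Rmult_1_r, sqrt_pow2; [easy|]. left. apply exp_pos.
Qed.

Lemma derivable_pt_lim_linear_error (f : R -> R) (x l e : R) : derivable_pt_lim f x l -> 0 < e ->
  exists d, 0 < d /\ forall t, Rabs t < d -> Rabs (f (x + t) - f x - l * t) <= e * Rabs t.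
Proof.
  intros H He. destruct (H e He) as [d Hd]. exists d. split; [apply cond_pos|].
  intros t Ht. destruct (Req_dec t 0) as [->|N].
  - rewrite Rplus_0_r, Rmult_0_r, !Rminus_diag, Rabs_R0. lra.
  - specialize (Hd t N Ht).
    replace (f (x + t) - f x - l * t) with (((f (x + t) - f x) / t - l) * t) by now field.
    rewrite Rabs_mult. apply Rmult_le_compat_r; [apply Rabs_pos|lra].
Qed.

Lemma Cmod_le_Rabs (w : C) : Cmod w <= Rabs (fst w) + Rabs (snd w).
Proof.
  assert (A := Rabs_pos (fst w)). assert (B := Rabs_pos (snd w)).
  unfold Cmod. apply Rsqr_incr_0_var; [|lra].
  rewrite Rsqr_sqrt by nra. unfold Rsqr.
  rewrite <- (pow2_abs (fst w)), <- (pow2_abs (snd w)). nra.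
Qed.

Lemma cderiv_cexp_0 : cderiv cexp 0 1.
Proof.
  intros e He.
  destruct (derivable_pt_lim_linear_error exp 0 _ (e / 8) (derivable_pt_lim_exp 0) ltac:(lra)) as [d1 [Hd1 H1]].
  destruct (derivable_pt_lim_linear_error cos 0 _ (e / 8) (derivable_pt_lim_cos 0) ltac:(lra)) as [d2 [Hd2 H2]].
  destruct (derivable_pt_lim_linear_error sin 0 _ (e / 8) (derivable_pt_lim_sin 0) ltac:(lra)) as [d3 [Hd3 H3]].
  destruct (derivable_pt_lim_linear_error exp 0 _ 1 (derivable_pt_lim_exp 0) ltac:(lra)) as [d4 [Hd4 H4]].
  destruct (derivable_pt_lim_linear_error sin 0 _ 1 (derivable_pt_lim_sin 0) ltac:(lra)) as [d5 [Hd5 H5]].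
  (* [1 / 2] and [e / 16] absorb the quadratic terms [2 * D * (e / 8 * D)] and [2 * D * (2 * D)];
     [d4] and [d5] give the crude bounds [2 * D] that enter these products. *)
  exists (Rmin (Rmin (Rmin d1 d2) (Rmin d3 d4)) (Rmin d5 (Rmin (1 / 2) (e / 16)))).
  split.
  { repeat apply Rmin_glb_lt; lra. }
  intros w. replace (w - 0)%C with w by ring. intros Hw.
  assert (M := Rmax_Cmod w).
  assert (X := Rle_trans _ _ _ (Rmax_l _ _) M). assert (Y := Rle_trans _ _ _ (Rmax_r _ _) M).
  set (D := Cmod w) in *. clearbody D. destruct w as [x y]. simpl in X, Y.
  assert (m : D < d1 /\ D < d2 /\ D < d3 /\ D < d4 /\ D < d5 /\ D < 1 / 2 /\ D < e / 16).
  { repeat split; eapply Rlt_le_trans; try exact Hw;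
    unfold Rmin; repeat destruct Rle_dec; lra. }
  specialize (H1 x ltac:(lra)). specialize (H2 y ltac:(lra)). specialize (H3 y ltac:(lra)).
  specialize (H4 x ltac:(lra)). specialize (H5 y ltac:(lra)).
  rewrite Rplus_0_l, exp_0 in H1, H4. rewrite Rplus_0_l, sin_0, cos_0 in *.
  replace (cos y - 1 - - (0) * y) with (cos y - 1) in H2 by ring.
  replace (sin y - 0 - 1 * y) with (sin y - y) in H3, H5 by ring.
  replace (exp x - 1 - 1 * x) with (exp x - 1 - x) in H1, H4 by ring.
  assert (Px := Rabs_pos x). assert (Py := Rabs_pos y).
  assert (Ex : Rabs (exp x - 1) <= 2 * D).
  { replace (exp x - 1) with ((exp x - 1 - x) + x) by ring.
    eapply Rle_trans; [apply Rabs_triang|]. lra. }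
  assert (Sy : Rabs (sin y) <= 2 * D).
  { replace (sin y) with ((sin y - y) + y) by ring.
    eapply Rle_trans; [apply Rabs_triang|]. lra. }
  assert (c8 : Rabs (cos y - 1) <= e / 8 * D).
  { eapply Rle_trans; [exact H2|]. apply Rmult_le_compat_l; lra. }
  assert (e8 : Rabs (exp x - 1 - x) <= e / 8 * D).
  { eapply Rle_trans; [exact H1|]. apply Rmult_le_compat_l; lra. }
  assert (s8 : Rabs (sin y - y) <= e / 8 * D).
  { eapply Rle_trans; [exact H3|]. apply Rmult_le_compat_l; lra. }
  eapply Rle_trans; [apply Cmod_le_Rabs|].
  unfold cexp. simpl. rewrite exp_0, cos_0, sin_0.
  replace (exp x * cos y + - (1 * 1) + - (1 * x - 0 * y))
    with ((exp x - 1) * (cos y - 1) + (exp x - 1 - x) + (cos y - 1)) by ring.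
  replace (exp x * sin y + - (1 * 0) + - (1 * y + 0 * x))
    with ((exp x - 1) * sin y + (sin y - y)) by ring.
  assert (T1 : Rabs ((exp x - 1) * (cos y - 1) + (exp x - 1 - x) + (cos y - 1))
     <= 2 * D * (e / 8 * D) + e / 8 * D + e / 8 * D).
  { eapply Rle_trans; [apply Rabs_triang|]. apply Rplus_le_compat; [|easy].
    eapply Rle_trans; [apply Rabs_triang|]. apply Rplus_le_compat; [|easy].
    rewrite Rabs_mult. apply Rmult_le_compat; auto using Rabs_pos. }
  assert (T2 : Rabs ((exp x - 1) * sin y + (sin y - y)) <= 2 * D * (2 * D) + e / 8 * D).
  { eapply Rle_trans; [apply Rabs_triang|]. apply Rplus_le_compat; [|easy].
    rewrite Rabs_mult. apply Rmult_le_compat; auto using Rabs_pos. }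
  eapply Rle_trans; [apply Rplus_le_compat; [exact T1|exact T2]|].
  assert (PD : 0 <= D) by lra.
  assert (2 * D * (e / 8 * D) <= e / 8 * D).
  { rewrite <- (Rmult_1_l (e / 8 * D)) at 2. apply Rmult_le_compat_r; [|lra].
    apply Rmult_le_pos; lra. }
  assert (2 * D * (2 * D) <= e / 4 * D) by nra.
  nra.
Qed.

Lemma cderiv_cexp (a : C) : cderiv cexp a (cexp a).
Proof.
  assert (H : cderiv (fun w => cexp a * cexp (w - a))%C a
    (0 * cexp (a - a) + cexp a * (1 * (1 + 0)))%C).
  { apply (cderiv_mult (fun _ => cexp a) (fun w => cexp (w - a))%C); [apply cderiv_const|].
    apply (cderiv_comp (fun w => w - a)%C cexp).
    - apply (cderiv_plus (fun w => w) (fun _ => - a)%C); [apply cderiv_id|apply cderiv_const].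
    - replace (a - a)%C with (RtoC 0) by ring. apply cderiv_cexp_0. }
  replace (0 * cexp (a - a) + cexp a * (1 * (1 + 0)))%C with (cexp a) in H by ring.
  apply (cderiv_local _ _ _ _ 1 ltac:(lra)) with (2 := H).
  intros w _. rewrite <- cexp_plus. f_equal. ring.
Qed.

Lemma cdiff_cr_diff (F : C -> C) (x y : R) : cdiff F (x, y) ->
  cr_diff (fun x y => fst (F (x, y))) (fun x y => snd (F (x, y))) x y.
Proof.
  intros [[a b] H]. exists a, b. intros e He. destruct (H e He) as [d [Hd H']].
  exists (d / 2). split; [lra|]. intros x' y' Hx Hy.
  assert (Hc := Cmod_le_Rabs ((x', y') - (x, y))%C). simpl in Hc.
  specialize (H' (x', y') ltac:(unfold Rminus in *; lra)).
  assert (M := Rmax_Cmod (F (x', y') - F (x, y) - (a, b) * ((x', y') - (x, y)))%C).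
  assert (M1 := Rle_trans _ _ _ (Rmax_l _ _) M). assert (M2 := Rle_trans _ _ _ (Rmax_r _ _) M).
  simpl in M1, M2.
  assert (e * Cmod ((x', y') - (x, y))%C <= e * (Rabs (x' - x) + Rabs (y' - y))).
  { apply Rmult_le_compat_l; [lra|exact Hc]. }
  split; (eapply Rle_trans; [|eapply Rle_trans; [exact H'|exact H0]]).
  - eapply Rle_trans; [right; apply (f_equal Rabs)|exact M1]. ring.
  - eapply Rle_trans; [right; apply (f_equal Rabs)|exact M2]. ring.
Qed.

(** In the coordinates [b + cexp (x, y)] the two circles are the vertical sides of a rectangle of
    height [2 * PI]. By periodicity its horizontal sides cancel, so Goursat equates the vertical
    ones. *)
Lemma mean_value_circles (f : C -> C) (b : C) (X x1 x2 : R) :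
  (forall w, w <> b -> Cmod (w - b) < exp X -> cdiff f w) -> x1 <= x2 < X ->
  let u x y := fst (f (b + cexp (x, y))%C) in
  ex_RInt (u x1) 0 (2 * PI) /\ ex_RInt (u x2) 0 (2 * PI) /\
  RInt (u x1) 0 (2 * PI) = RInt (u x2) 0 (2 * PI).
Proof.
  intros Hf Hx u.
  set (v x y := snd (f (b + cexp (x, y))%C)).
  assert (CR : forall x y, x < X -> cr_diff u v x y).
  { intros x y HxX. apply (cdiff_cr_diff (fun w => f (b + cexp w)%C)).
    apply (cdiff_comp (fun w => b + cexp w)%C f).
    - apply cdiff_plus; [apply cdiff_const|]. eexists. apply cderiv_cexp.
    - assert (E : (b + cexp (x, y) - b)%C = cexp (x, y)) by ring.
      assert (M : Cmod (b + cexp (x, y) - b) = exp x) by (rewrite E, Cmod_cexp; easy).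
      apply Hf.
      + intros E'. rewrite E', Cmod_diag in M. assert (P := exp_pos x). lra.
      + rewrite M. now apply exp_increasing. }
  assert (I : forall x, x < X -> ex_RInt (u x) 0 (2 * PI)).
  { intros x HxX. apply (ex_RInt_continuous (V := R_CompleteNormedModule)). intros z _.
    now apply (cr_diff_continuous u v), CR. }
  split; [apply I; lra|]. split; [apply I; lra|].
  assert (G := goursat u v X CR x1 x2 0 (2 * PI) ltac:(lra) ltac:(lra)
    ltac:(assert (P := PI_RGT_0); lra)).
  unfold rect_flux in G.
  rewrite (RInt_ext (fun x => v x (2 * PI) - v x 0) (fun _ => 0)) in G.
  2:{ intros x _. unfold v, cexp. simpl. rewrite cos_2PI, sin_2PI, cos_0, sin_0. ring. }
  rewrite RInt_const in G.
  assert (G' : RInt (fun y => u x2 y - u x1 y) 0 (2 * PI)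
     = RInt (u x2) 0 (2 * PI) - RInt (u x1) 0 (2 * PI)).
  { apply (RInt_minus (V := R_CompleteNormedModule)); apply I; lra. }
  rewrite G' in G. unfold scal in G; simpl in G; unfold mult in G; simpl in G. lra.
Qed.

(* A quadratic perturbation turns this into the maximum principle without any
   connectedness argument. *)
Lemma Re_no_strict_peak (f : C -> C) (b : C) (R0 e : R) : 0 < R0 -> 0 < e ->
  (forall w, Cmod (w - b) < R0 -> cdiff f w) ->
  ~ (forall w, Cmod (w - b) < R0 -> fst (f w) <= fst (f b) - e * Cmod (w - b) ^ 2).
Proof.
  intros HR He Hf H. set (X := ln R0). set (x2 := X - 1).
  assert (EX : exp X = R0) by now apply exp_ln.
  set (rho := exp x2). assert (Pr : 0 < rho) by apply exp_pos.
  assert (Hk : 0 < e * rho ^ 2) by (apply Rmult_lt_0_compat; [|apply pow_lt]; lra).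
  (* On the circle of radius [rho] the assumed peak costs at least [e * rho ^ 2], while on a small
     circle continuity at [b] allows a loss of at most half of that; yet the two means agree. *)
  destruct (cdiff_ccont f b) with (e := e * rho ^ 2 / 2) as [d [Hd Hc]].
  { apply Hf. rewrite Cmod_diag. easy. }
  { lra. }
  set (x1 := Rmin x2 (ln d - 1)).
  assert (H1 : x1 <= x2) by apply Rmin_l.
  assert (H1' : exp x1 < d).
  { rewrite <- (exp_ln d) by easy. apply exp_increasing.
    apply Rle_lt_trans with (ln d - 1); [apply Rmin_r|lra]. }
  assert (PP := PI_RGT_0).
  destruct (mean_value_circles f b X x1 x2) as [I1 [I2 E]].
  { intros w _. rewrite EX. apply Hf. }
  { unfold x2 in *. lra. }
  assert (M : forall x y, Cmod (b + cexp (x, y) - b) = exp x).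
  { intros x y. replace (b + cexp (x, y) - b)%C with (cexp (x, y)) by ring. apply Cmod_cexp. }
  assert (L2 : RInt (fun y => fst (f (b + cexp (x2, y))%C)) 0 (2 * PI)
     <= RInt (fun _ => fst (f b) - e * rho ^ 2) 0 (2 * PI)).
  { apply RInt_le; [lra|easy|apply ex_RInt_const|]. intros y _.
    unfold rho. rewrite <- (M x2 y). apply H. rewrite M. rewrite <- EX. apply exp_increasing.
    unfold x2; lra. }
  assert (L1 : RInt (fun _ => fst (f b) - e * rho ^ 2 / 2) 0 (2 * PI)
     <= RInt (fun y => fst (f (b + cexp (x1, y))%C)) 0 (2 * PI)).
  { apply RInt_le; [lra|apply ex_RInt_const|easy|]. intros y _.
    specialize (Hc (b + cexp (x1, y))%C). rewrite M in Hc. specialize (Hc H1').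
    assert (T := re_le_Cmod (f (b + cexp (x1, y)) - f b)%C). unfold Re in T. simpl in T.
    assert (T' := Rle_lt_trans _ _ _ T Hc). apply Rabs_lt_between in T'. lra. }
  rewrite E in L1. assert (L := Rle_trans _ _ _ L1 L2).
  rewrite !RInt_const in L. unfold scal in L; simpl in L; unfold mult in L; simpl in L.
  rewrite Rminus_0_r in L. nra.
Qed.

(** * Limits along an ultrafilter *)

(** The set [U] holds the properties true for almost all indices. [ultra_em] makes bounded sequences
    converge; [ultra_tail] makes the limit ignore finitely many terms. *)
Record ultrafilter (U : (nat -> Prop) -> Prop) : Prop := {
  ultra_and : forall P Q, U P -> U Q -> U (fun n => P n /\ Q n);
  ultra_mono : forall P Q : nat -> Prop, (forall n, P n -> Q n) -> U P -> U Q;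
  ultra_ex : forall P, U P -> exists n, P n;
  ultra_em : forall P, U P \/ U (fun n => ~ P n);
  ultra_tail : forall N, U (fun n => (N <= n)%nat) }.

Lemma free_ultrafilter : exists U, ultrafilter U.
Proof.
  destruct (@filter.ultraFilterLemma nat filter.eventually filter.eventually_filter)
    as [U [HU sub]].
  assert (PU := @filter.ultra_proper _ _ HU).
  assert (FU := @filter.filter_filter _ _ PU).
  exists U. split.
  - intros P Q. apply (@filter.filterI _ _ FU).
  - intros P Q H. apply (@filter.filterS _ _ FU). exact H.
  - intros P HP. apply NNPP. intros N. apply (@filter.filter_not_empty _ _ PU).
    revert HP. apply (@filter.filterS _ _ FU). intros n Hn. apply N. now exists n.
  - intros P. exact (@filter.in_ultra_setVsetC _ _ P HU).
  - intros N. apply sub. exists N; [easy|]. intros n Hn. simpl in Hn.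
    destruct (@ssrnat.leP N n); easy.
Qed.

Section Ultralimit.

Variable U : (nat -> Prop) -> Prop.
Hypothesis HU : ultrafilter U.

Lemma ultra_all (P : nat -> Prop) : (forall n, P n) -> U P.
Proof. intros H. apply (ultra_mono U HU) with (2 := ultra_tail U HU O). intros n _. apply H. Qed.

Definition ulim (x : nat -> C) (l : C) : Prop :=
  forall e, 0 < e -> U (fun n => Cmod (x n - l) < e).

(** The limit is the supremum of the levels that almost all terms reach; [ultra_em] decides each
    level. *)
Lemma real_ulim (x : nat -> R) (K : R) : U (fun n => Rabs (x n) <= K) ->
  exists l, forall e, 0 < e -> U (fun n => Rabs (x n - l) < e).
Proof.
  intros HK. set (S := fun t => U (fun n => t <= x n)).
  destruct (completeness S) as [l [L1 L2]].
  - exists K. intros t Ht. destruct (ultra_ex U HU _ (ultra_and U HU _ _ HK Ht)) as [n [A B]].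
    apply Rabs_le_between in A. lra.
  - exists (- K). apply (ultra_mono U HU) with (2 := HK). intros n A.
    apply Rabs_le_between in A. lra.
  - exists l. intros e He.
    assert (A : U (fun n => l - e < x n)).
    { destruct (ultra_em U HU (fun n => l - e / 2 <= x n)) as [A|A].
      - apply (ultra_mono U HU) with (2 := A). intros; lra.
      - exfalso. assert (l <= l - e / 2); [|lra]. apply L2. intros t Ht.
        destruct (ultra_ex U HU _ (ultra_and U HU _ _ A Ht)) as [n [B1 B2]]. lra. }
    assert (B : U (fun n => x n < l + e)).
    { destruct (ultra_em U HU (fun n => l + e <= x n)) as [B|B].
      - exfalso. specialize (L1 _ B). lra.
      - apply (ultra_mono U HU) with (2 := B). intros; lra. }
    apply (ultra_mono U HU) with (2 := ultra_and U HU _ _ A B). intros n [A' B'].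
    apply Rabs_lt_between. lra.
Qed.

Lemma ulim_exists (x : nat -> C) (K : R) : U (fun n => Cmod (x n) <= K) ->
  exists l, ulim x l.
Proof.
  intros HK.
  assert (M : forall n, Rabs (fst (x n)) <= Cmod (x n) /\ Rabs (snd (x n)) <= Cmod (x n)).
  { intros n. assert (M := Rmax_Cmod (x n)). split; eapply Rle_trans; try exact M.
    - apply Rmax_l. - apply Rmax_r. }
  destruct (real_ulim (fun n => fst (x n)) K) as [a Ha].
  { apply (ultra_mono U HU) with (2 := HK). intros n. specialize (M n). lra. }
  destruct (real_ulim (fun n => snd (x n)) K) as [b Hb].
  { apply (ultra_mono U HU) with (2 := HK). intros n. specialize (M n). lra. }
  exists (a, b). intros e He.
  assert (A := ultra_and U HU _ _ (Ha (e / 2) ltac:(lra)) (Hb (e / 2) ltac:(lra))).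
  apply (ultra_mono U HU) with (2 := A). intros n [A1 A2].
  eapply Rle_lt_trans; [apply Cmod_le_Rabs|]. simpl. unfold Rminus in *. lra.
Qed.

Lemma ulim_le (x y : nat -> C) (a b : C) (K : R) : ulim x a -> ulim y b ->
  U (fun n => Cmod (x n - y n) <= K) -> Cmod (a - b) <= K.
Proof.
  intros Hx Hy HK. apply le_epsilon. intros e He.
  assert (A := ultra_and U HU _ _ (Hx (e / 2) ltac:(lra)) (Hy (e / 2) ltac:(lra))).
  destruct (ultra_ex U HU _ (ultra_and U HU _ _ A HK)) as [n [[A1 A2] A3]].
  replace (a - b)%C with ((y n - b) + (x n - y n) - (x n - a))%C by ring.
  eapply Rle_trans; [apply Cmod_minus_le|].
  assert (T := Cmod_triangle (y n - b) (x n - y n)). lra.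
Qed.

Lemma ulim_const (c : C) : ulim (fun _ => c) c.
Proof. intros e He. apply ultra_all. intros _. now rewrite Cmod_diag. Qed.

Lemma ulim_unique (x : nat -> C) (a b : C) : ulim x a -> ulim x b -> a = b.
Proof.
  intros Ha Hb. apply Cmod_minus_eq_0. apply Rle_antisym; [|apply Cmod_ge_0].
  apply (ulim_le x x); [easy|easy|]. apply ultra_all. intros n. rewrite Cmod_diag. lra.
Qed.

Lemma ulim_dist (x y : nat -> C) (a : C) : ulim x a ->
  (forall e, 0 < e -> U (fun n => Cmod (y n - x n) < e)) -> ulim y a.
Proof.
  intros Hx H e He.
  apply (ultra_mono U HU) with (2 := ultra_and U HU _ _ (Hx (e / 2) ltac:(lra)) (H (e / 2) ltac:(lra))).
  intros n [A B]. eapply Rle_lt_trans; [apply (Cmod_minus_triangle _ (x n))|]. lra.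
Qed.

Lemma ulim_cont (f : C -> C) (x : nat -> C) (a : C) : ccont f a -> ulim x a ->
  ulim (fun n => f (x n)) (f a).
Proof.
  intros Hf Hx e He. destruct (Hf e He) as [d [Hd H]].
  apply (ultra_mono U HU) with (2 := Hx d Hd). intros n. apply H.
Qed.

Lemma ulim_mod_le (x : nat -> C) (a : C) (K : R) : ulim x a ->
  U (fun n => Cmod (x n) <= K) -> Cmod a <= K.
Proof.
  intros Hx HK. replace a with (a - 0)%C by ring.
  apply (ulim_le x (fun _ => 0%C)); [easy|apply ulim_const|].
  apply (ultra_mono U HU) with (2 := HK). intros n. now replace (x n - 0)%C with (x n) by ring.
Qed.

Lemma ulim_mod_ge (x : nat -> C) (a : C) (K : R) : ulim x a ->
  U (fun n => K <= Cmod (x n)) -> K <= Cmod a.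
Proof.
  intros Hx HK. apply le_epsilon. intros e He.
  destruct (ultra_ex U HU _ (ultra_and U HU _ _ (Hx e He) HK)) as [n [A1 A2]].
  assert (T := Cmod_minus_ge (x n) a). lra.
Qed.

End Ultralimit.

Lemma inv_INR_eventually (U : (nat -> Prop) -> Prop) (e : R) : ultrafilter U -> 0 < e ->
  U (fun n => / INR (S n) < e).
Proof.
  intros HU He. destruct (archimed_cor1 e He) as [N [HN PN]].
  apply (ultra_mono U HU) with (2 := ultra_tail U HU N). intros n Hn.
  eapply Rle_lt_trans; [|exact HN]. apply Rinv_le_contravar.
  - now apply lt_0_INR.
  - apply le_INR. lia.
Qed.

(** Ultralimits replace sequential compactness, applied twice: to points where [w] exceeds [INR n],
    which shows boundedness, and to a maximising sequence. *)
Lemma closed_disc_max (w : C -> R) (a : C) (R0 : R) : 0 <= R0 ->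
  (forall b, Cmod (b - a) <= R0 -> forall e, 0 < e -> exists d, 0 < d /\
     forall v, Cmod (v - b) < d -> Rabs (w v - w b) < e) ->
  exists b, Cmod (b - a) <= R0 /\ forall v, Cmod (v - a) <= R0 -> w v <= w b.
Proof.
  intros HR Hc. destruct free_ultrafilter as [U HU].
  assert (L : forall v : nat -> C, (forall n, Cmod (v n - a) <= R0) ->
    exists b, Cmod (b - a) <= R0 /\ forall e, 0 < e -> U (fun n => Rabs (w (v n) - w b) < e)).
  { intros v Hv. destruct (ulim_exists U HU v (R0 + Cmod a)) as [b Hb].
    - apply ultra_all; [easy|]. intros n. specialize (Hv n).
      assert (T := Cmod_minus_ge (v n) a). lra.
    - assert (Hba : Cmod (b - a) <= R0).
      { apply (ulim_le U HU v (fun _ => a)); [easy|now apply ulim_const|].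
        apply ultra_all; easy. }
      exists b. split; [easy|]. intros e He. destruct (Hc b Hba e He) as [d [Hd H]].
      apply (ultra_mono U HU) with (2 := Hb d Hd). intros n. apply H. }
  assert (bnd : exists m, is_upper_bound (fun t => exists v, Cmod (v - a) <= R0 /\ t = w v) m).
  { apply NNPP. intros N.
    assert (N' : forall n, exists v, Cmod (v - a) <= R0 /\ INR n < w v).
    { intros n. apply NNPP. intros N'. apply N. exists (INR n). intros t [v [Hv ->]].
      apply Rnot_lt_le. intros Hl. apply N'. now exists v. }
    destruct (choice _ N') as [v Hv]. destruct (L v) as [b [_ Hb]]; [apply Hv|].
    destruct (INR_unbounded (w b + 1)) as [M HM].
    destruct (ultra_ex U HU _ (ultra_and U HU _ _ (Hb 1 Rlt_0_1) (ultra_tail U HU M)))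
      as [n [A B]].
    apply le_INR in B. destruct (Hv n) as [_ C]. apply Rabs_lt_between in A. lra. }
  destruct (completeness _ bnd) as [m [M1 M2]].
  { exists (w a), a. rewrite Cmod_diag. easy. }
  assert (N' : forall n, exists v, Cmod (v - a) <= R0 /\ m - / INR (S n) < w v).
  { intros n. apply NNPP. intros N'. assert (P : 0 < / INR (S n)).
    { apply Rinv_0_lt_compat, lt_0_INR. lia. }
    assert (m <= m - / INR (S n)); [|lra]. apply M2. intros t [v [Hv ->]].
    apply Rnot_lt_le. intros Hl. apply N'. now exists v. }
  destruct (choice _ N') as [v Hv]. destruct (L v) as [b [Hba Hb]]; [apply Hv|].
  exists b. split; [easy|]. intros z Hz.
  apply Rle_trans with m; [apply M1; now exists z|].
  apply le_epsilon. intros e He.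
  destruct (ultra_ex U HU _ (ultra_and U HU _ _ (Hb (e / 2) ltac:(lra))
    (inv_INR_eventually U (e / 2) HU ltac:(lra)))) as [n [A B]].
  destruct (Hv n) as [_ C]. apply Rabs_lt_between in A. lra.
Qed.

(** * Maximum principle and removable singularities *)

(** The middle term is the real part of a holomorphic function of [v], so it can be absorbed into
    the function being maximised. *)
Lemma Cmod_sqr_shift (v b a : C) :
  Cmod (v - a) ^ 2 = Cmod (b - a) ^ 2 + 2 * fst ((v - b) * Cconj (b - a))%C + Cmod (v - b) ^ 2.
Proof.
  rewrite !Cmod2_alt. destruct v, b, a. unfold Re, Im. simpl. ring.
Qed.

(** Differentiability is replaced at zeros of [F] by continuity alone. This admits products with a
    factor that vanishes at the singular points. *)
Lemma max_principle (F : C -> C) (a : C) (R0 B : R) : 0 < R0 -> 0 <= B ->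
  (forall b, Cmod (b - a) <= R0 -> ccont F b) ->
  (forall b, Cmod (b - a) < R0 ->
     F b = 0 \/ exists d, 0 < d /\ forall w, Cmod (w - b) < d -> cdiff F w) ->
  (forall b, Cmod (b - a) = R0 -> Cmod (F b) <= B) ->
  forall z, Cmod (z - a) <= R0 -> Cmod (F z) <= B.
Proof.
  intros HR HB Hc Hd Hcirc z Hz. apply Rnot_lt_le. intros HF.
  set (m := Cmod (F z)) in *. assert (Pm : 0 < m) by lra.
  assert (Nm : RtoC m <> 0) by (intros E; apply RtoC_inj in E; lra).
  (* A rotation making the value at [z] equal to [m > 0], so that real parts suffice. *)
  set (tau := (Cconj (F z) / m)%C).
  assert (Mt : Cmod tau = 1).
  { unfold tau. rewrite Cmod_div by easy. rewrite Cmod_conj, Cmod_R, Rabs_right by lra.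
    fold m. field. lra. }
  assert (Tz : (tau * F z)%C = RtoC m).
  { unfold tau. replace (Cconj (F z) / m * F z)%C with (F z * Cconj (F z) / m)%C by (field; easy).
    rewrite <- Cmod2_conj. fold m. rewrite RtoC_pow. field. easy. }
  assert (HR2 : 0 < R0 ^ 2) by (apply pow_lt; lra).
  (* The perturbation stays below half the gap [m - B], so the maximum point of [w] is neither on
     the circle nor a zero of [F]. *)
  set (e := (m - B) / 2 / R0 ^ 2).
  assert (He : 0 < e) by (unfold e; repeat apply Rdiv_lt_0_compat; lra).
  assert (EeR : e * R0 ^ 2 = (m - B) / 2) by (unfold e; field; lra).
  set (w := fun v => fst (tau * F v)%C + e * Cmod (v - a) ^ 2).
  destruct (closed_disc_max w a R0 ltac:(lra)) as [b [Hb Hmax]].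
  { intros b Hb e' He'.
    destruct (Hc b Hb (e' / 2) ltac:(lra)) as [d [Pd H]].
    assert (PK : 0 < e * (2 * R0 + 1)) by (apply Rmult_lt_0_compat; lra).
    assert (PQ : 0 < e' / 2 / (e * (2 * R0 + 1))) by (apply Rdiv_lt_0_compat; lra).
    exists (Rmin d (Rmin 1 (e' / 2 / (e * (2 * R0 + 1))))). split.
    { repeat apply Rmin_glb_lt; lra. }
    intros v Hv.
    assert (V : Cmod (v - b) < d /\ Cmod (v - b) < 1 /\ Cmod (v - b) < e' / 2 / (e * (2 * R0 + 1))).
    { repeat split; eapply Rlt_le_trans; try exact Hv;
      unfold Rmin; repeat destruct Rle_dec; lra. }
    destruct V as [V1 [V2 V3]]. specialize (H v V1).
    assert (T1 : Rabs (fst (tau * F v)%C - fst (tau * F b)%C) < e' / 2).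
    { assert (T := re_le_Cmod (tau * (F v - F b))%C). rewrite Cmod_mult, Mt in T.
      unfold Re in T. replace (fst (tau * F v)%C - fst (tau * F b)%C)
        with (fst (tau * (F v - F b))%C) by (simpl; ring). lra. }
    assert (T2 : Rabs (Cmod (v - a) ^ 2 - Cmod (b - a) ^ 2) <= Cmod (v - b) * (2 * R0 + 1)).
    { assert (A1 := Cmod_minus_triangle v b a). assert (A2 := Cmod_minus_triangle b v a).
      rewrite (Cmod_minus_sym b v) in A2.
      assert (A3 := Cmod_ge_0 (v - a)). assert (A4 := Cmod_ge_0 (b - a)).
      assert (A5 := Cmod_ge_0 (v - b)).
      set (p := Cmod (v - a)) in *. set (q := Cmod (b - a)) in *. set (t := Cmod (v - b)) in *.
      apply Rabs_le. nra. }
    assert (T3 : e * (Cmod (v - b) * (2 * R0 + 1)) < e' / 2).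
    { replace (e' / 2) with (e * ((e' / 2 / (e * (2 * R0 + 1))) * (2 * R0 + 1))) by (field; lra).
      apply Rmult_lt_compat_l; [lra|]. apply Rmult_lt_compat_r; lra. }
    unfold w.
    replace (fst (tau * F v)%C + e * Cmod (v - a) ^ 2 - (fst (tau * F b)%C + e * Cmod (b - a) ^ 2))
      with ((fst (tau * F v)%C - fst (tau * F b)%C) + e * (Cmod (v - a) ^ 2 - Cmod (b - a) ^ 2)) by ring.
    eapply Rle_lt_trans; [apply Rabs_triang|]. rewrite Rabs_mult, (Rabs_right e) by lra.
    assert (e * Rabs (Cmod (v - a) ^ 2 - Cmod (b - a) ^ 2) <= e * (Cmod (v - b) * (2 * R0 + 1)))
      by (apply Rmult_le_compat_l; lra).
    lra. }
  assert (Wz : m <= w b).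
  { eapply Rle_trans; [|apply (Hmax z Hz)]. unfold w. rewrite Tz. simpl.
    assert (0 <= e * (Cmod (z - a) * (Cmod (z - a) * 1))); [|lra].
    apply Rmult_le_pos; [lra|]. assert (A := Cmod_ge_0 (z - a)). nra. }
  assert (Sq : e * Cmod (b - a) ^ 2 <= e * R0 ^ 2).
  { apply Rmult_le_compat_l; [lra|]. apply pow_incr. split; [apply Cmod_ge_0|easy]. }
  destruct (Rle_lt_or_eq_dec _ _ Hb) as [Hlt|Heq].
  - destruct (Hd b Hlt) as [F0|[d [Pd Hdiff]]].
    + unfold w in Wz. rewrite F0, Cmult_0_r in Wz. simpl fst in Wz. lra.
    (* Moving the linear term of the shifted square into [f] leaves exactly [e * Cmod (v - b) ^ 2],
       a strict peak at [b]. *)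
    + set (f := fun v => (tau * F v + (2 * e) * (v - b) * Cconj (b - a))%C).
      apply (Re_no_strict_peak f b (Rmin d (R0 - Cmod (b - a))) e).
      * apply Rmin_glb_lt; lra.
      * easy.
      * intros v Hv. unfold f. apply cdiff_plus.
        -- apply cdiff_mult; [apply cdiff_const|]. apply Hdiff.
           eapply Rlt_le_trans; [exact Hv|apply Rmin_l].
        -- apply cdiff_mult; [|apply cdiff_const]. apply cdiff_mult; [apply cdiff_const|].
           apply cdiff_minus; [apply cdiff_id|apply cdiff_const].
      * intros v Hv.
        assert (Hva : Cmod (v - a) <= R0).
        { assert (V := Rlt_le_trans _ _ _ Hv (Rmin_r _ _)).
          assert (T := Cmod_minus_triangle v b a). lra. }
        specialize (Hmax v Hva). unfold w in Hmax. rewrite (Cmod_sqr_shift v b a) in Hmax.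
        assert (E1 : fst (f v) = fst (tau * F v)%C + 2 * e * fst ((v - b) * Cconj (b - a))%C).
        { unfold f. simpl. ring. }
        assert (E2 : fst (f b) = fst (tau * F b)%C).
        { unfold f. simpl. ring. }
        rewrite E1, E2. lra.
  - specialize (Hcirc b Heq). unfold w in Wz.
    assert (T := re_le_Cmod (tau * F b)%C). rewrite Cmod_mult, Mt in T. unfold Re in T.
    apply Rabs_le_between in T. lra.
Qed.

(** * The maximum principle with exceptional points *)

Lemma pow_dominates (x B C0 k : R) : 0 < k -> 0 < B < x ->
  (forall n, k * x ^ n <= C0 * B ^ n) -> False.
Proof.
  intros Hk HB H.
  assert (PC : 0 < C0) by (specialize (H O); simpl in H; lra).
  destruct (Pow_x_infinity (x / B)) with (b := C0 / k + 1) as [N HN].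
  { rewrite Rabs_right.
    - apply Rmult_lt_reg_r with B; [lra|]. unfold Rdiv. rewrite Rmult_assoc, Rinv_l; lra.
    - apply Rle_ge, Rlt_le, Rdiv_lt_0_compat; lra. }
  specialize (HN N (le_n _)). specialize (H N).
  assert (PB : 0 < B ^ N) by (apply pow_lt; lra).
  assert (Px : 0 < x ^ N) by (apply pow_lt; lra).
  rewrite Rabs_right in HN.
  2:{ apply Rle_ge, pow_le. apply Rlt_le, Rdiv_lt_0_compat; lra. }
  unfold Rdiv in HN. rewrite Rpow_mult_distr, pow_inv in HN.
  assert (HN' : (C0 * / k + 1) * B ^ N <= x ^ N).
  { replace (x ^ N) with ((x ^ N * / B ^ N) * B ^ N) by (field; lra).
    apply Rmult_le_compat_r; lra. }
  assert (k * ((C0 * / k + 1) * B ^ N) <= k * x ^ N) by (apply Rmult_le_compat_l; lra).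
  replace (k * ((C0 * / k + 1) * B ^ N)) with (C0 * B ^ N + k * B ^ N) in H0 by (field; lra).
  assert (0 < k * B ^ N) by (apply Rmult_lt_0_compat; lra). lra.
Qed.

(** The arbitrary value [F c] is multiplied by [h c = 0], so boundedness of [F] around [c] is
    enough. *)
Lemma ccont_zero_factor (h F : C -> C) (c : C) (K d : R) : 0 < d -> h c = 0 -> ccont h c ->
  (forall w, w <> c -> Cmod (w - c) < d -> Cmod (F w) <= K) -> ccont (fun w => h w * F w)%C c.
Proof.
  intros Hd h0 Hh HF e He.
  assert (PK : 0 < Rmax K 0 + 1) by (assert (X := Rmax_r K 0); lra).
  destruct (Hh (e / (Rmax K 0 + 1))) as [d' [Hd' H]].
  { apply Rdiv_lt_0_compat; lra. }
  exists (Rmin d d'). split; [now apply Rmin_glb_lt|]. intros w Hw.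
  destruct (classic (w = c)) as [->|N].
  - rewrite Cmod_diag. easy.
  - specialize (HF w N (Rlt_le_trans _ _ _ Hw (Rmin_l _ _))).
    specialize (H w (Rlt_le_trans _ _ _ Hw (Rmin_r _ _))).
    rewrite h0 in H |- *. replace (h w - 0)%C with (h w) in H by ring.
    replace (h w * F w - 0 * F c)%C with (h w * F w)%C by ring.
    rewrite Cmod_mult. assert (X := Rmax_l K 0).
    apply Rle_lt_trans with (Cmod (h w) * (Rmax K 0 + 1)).
    + apply Rmult_le_compat_l; [apply Cmod_ge_0|lra].
    + replace e with (e / (Rmax K 0 + 1) * (Rmax K 0 + 1)) at 1 by (field; lra).
      apply Rmult_lt_compat_r; lra.
Qed.

(* Applying the maximum principle to [(w - c1) (w - c2) F^n] for all [n] makes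
   the exceptional points and the extra factor harmless. *)
Lemma max_principle_punctured (F : C -> C) (a c1 c2 : C) (R0 B K : R) : 0 < R0 -> 0 <= B ->
  Cmod (c1 - a) < R0 -> Cmod (c2 - a) < R0 ->
  (forall b, Cmod (b - a) <= R0 -> b <> c1 -> b <> c2 -> cdiff F b) ->
  (forall b, Cmod (b - a) <= R0 -> b <> c1 -> b <> c2 -> Cmod (F b) <= K) ->
  (forall b, Cmod (b - a) = R0 -> Cmod (F b) <= B) ->
  forall z, Cmod (z - a) <= R0 -> z <> c1 -> z <> c2 -> Cmod (F z) <= B.
Proof.
  intros HR HB H1 H2 Hd HK Hcirc z Hz N1 N2. apply Rnot_lt_le. intros HF.
  (* Strictly between [B] and [Cmod (F z)], hence positive even for [B = 0], as [pow_dominates]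
     requires. The constant [4 * R0 ^ 2] bounds the two linear factors on the circle. *)
  set (B' := (B + Cmod (F z)) / 2).
  apply (pow_dominates (Cmod (F z)) B' (4 * R0 ^ 2) (Cmod (z - c1) * Cmod (z - c2))).
  { apply Rmult_lt_0_compat; now apply Cmod_minus_pos. }
  { unfold B'; lra. }
  intros n.
  set (h := fun w => ((w - c1) * (w - c2))%C).
  assert (Dh : forall w, cdiff h w).
  { intros w. apply cdiff_mult; apply cdiff_minus; apply cdiff_id || apply cdiff_const. }
  assert (X : Cmod (h z * F z ^ n) <= 4 * R0 ^ 2 * B' ^ n).
  { apply (max_principle (fun w => h w * F w ^ n)%C a R0 (4 * R0 ^ 2 * B' ^ n)); try easy.
    - apply Rmult_le_pos; [nra|]. apply pow_le. unfold B'. lra.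
    - intros b Hb. destruct (classic (b = c1 \/ b = c2)) as [E|E].
      + assert (Hba : Cmod (b - a) < R0) by (destruct E; subst b; easy).
        assert (hb : h b = 0) by (unfold h; destruct E; subst b; ring).
        assert (Q : exists d, 0 < d /\ forall w, w <> b -> Cmod (w - b) < d -> w <> c1 /\ w <> c2).
        { destruct (classic (c1 = c2)) as [E'|E'].
          - exists 1. split; [lra|]. intros w Nw _. destruct E; subst; easy.
          - apply Cmod_minus_pos in E'. exists (Cmod (c1 - c2)). split; [easy|].
            intros w Nw Hw. destruct E; subst b; split; try easy; intros ->.
            + rewrite Cmod_minus_sym in Hw. lra.
            + lra. }
        destruct Q as [d [Pd Q]].
        apply (ccont_zero_factor h (fun w => F w ^ n)%C b (K ^ n) (Rmin d (R0 - Cmod (b - a)))).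
        * apply Rmin_glb_lt; lra.
        * easy.
        * now apply cdiff_ccont.
        * intros w Nw Hw. destruct (Q w Nw) as [Q1 Q2].
          { eapply Rlt_le_trans; [exact Hw|apply Rmin_l]. }
          assert (V := Rlt_le_trans _ _ _ Hw (Rmin_r _ _)).
          assert (T := Cmod_minus_triangle w b a).
          rewrite Cmod_pow. apply pow_incr. split; [apply Cmod_ge_0|].
          apply HK; [lra|easy|easy].
      + apply cdiff_ccont. apply cdiff_mult; [apply Dh|]. apply cdiff_pow.
        apply Hd; [easy| |]; intros ->; apply E; auto.
    - intros b Hb. destruct (classic (b = c1 \/ b = c2)) as [E|E].
      + left. unfold h. destruct E; subst b; ring.
      + right.
        assert (P1 : 0 < Cmod (b - c1)) by (apply Cmod_minus_pos; intros ->; auto).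
        assert (P2 : 0 < Cmod (b - c2)) by (apply Cmod_minus_pos; intros ->; auto).
        exists (Rmin (R0 - Cmod (b - a)) (Rmin (Cmod (b - c1)) (Cmod (b - c2)))). split.
        { repeat apply Rmin_glb_lt; lra. }
        intros w Hw.
        assert (V : Cmod (w - b) < R0 - Cmod (b - a) /\ Cmod (w - b) < Cmod (b - c1) /\
          Cmod (w - b) < Cmod (b - c2)).
        { repeat split; eapply Rlt_le_trans; try exact Hw;
          unfold Rmin; repeat destruct Rle_dec; lra. }
        destruct V as [V1 [V2 V3]].
        apply cdiff_mult; [apply Dh|]. apply cdiff_pow. apply Hd.
        * assert (T := Cmod_minus_triangle w b a). lra.
        * intros ->. rewrite Cmod_minus_sym in V2. lra.
        * intros ->. rewrite Cmod_minus_sym in V3. lra.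
    - intros b Hb. unfold h. rewrite !Cmod_mult, Cmod_pow.
      assert (T1 : Cmod (b - c1) <= 2 * R0).
      { assert (T := Cmod_minus_triangle b a c1). rewrite (Cmod_minus_sym a c1) in T. lra. }
      assert (T2 : Cmod (b - c2) <= 2 * R0).
      { assert (T := Cmod_minus_triangle b a c2). rewrite (Cmod_minus_sym a c2) in T. lra. }
      apply Rmult_le_compat.
      + apply Rmult_le_pos; apply Cmod_ge_0.
      + apply pow_le, Cmod_ge_0.
      + replace (4 * R0 ^ 2) with ((2 * R0) * (2 * R0)) by ring.
        apply Rmult_le_compat; auto using Cmod_ge_0.
      + apply pow_incr. split; [apply Cmod_ge_0|]. specialize (Hcirc b Hb). unfold B'. lra. }
  unfold h in X. rewrite !Cmod_mult, Cmod_pow in X. exact X.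
Qed.

(* The difference quotient based at w is bounded, with exceptional points a and w only. *)
Lemma lipschitz_punctured (F : C -> C) (a : C) (R0 K : R) : 0 < R0 ->
  (forall b, Cmod (b - a) <= R0 -> b <> a -> cdiff F b /\ Cmod (F b) <= K) ->
  forall v w, v <> a -> w <> a -> Cmod (v - a) <= R0 / 2 -> Cmod (w - a) <= R0 / 2 ->
    Cmod (F v - F w) <= 4 * K / R0 * Cmod (v - w).
Proof.
  intros HR H v w Nv Nw Hv Hw.
  assert (PK : 0 <= K).
  { destruct (H v ltac:(lra) Nv) as [_ Q]. assert (X := Cmod_ge_0 (F v)). lra. }
  destruct (classic (v = w)) as [->|Nvw].
  { rewrite !Cmod_diag. lra. }
  destruct (H w ltac:(lra) Nw) as [[l Hl] Kw].
  destruct (cderiv_lipschitz F w l Hl) as [d [Pd Lw]].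
  set (q := fun b => ((F b - F w) / (b - w))%C).
  assert (Pl := Cmod_ge_0 l).
  assert (HB : 0 <= 4 * K / R0) by (apply Rle_mult_inv_pos; lra).
  assert (X : Cmod (q v) <= 4 * K / R0).
  (* The [Rmax] only certifies that [q] is bounded. The constant in the conclusion comes from the
     circle, where the numerator is at most [2 * K] and the denominator at least [R0 / 2]. *)
  { apply (max_principle_punctured q a a w R0 _ (Rmax (Cmod l + 1) (2 * K / d))); try easy.
    - rewrite Cmod_diag. easy.
    - lra.
    - intros b Hb Na Nb. apply cdiff_div.
      + apply cdiff_minus; [now apply H|apply cdiff_const].
      + apply cdiff_minus; [apply cdiff_id|apply cdiff_const].
      + now apply Cminus_neq_0.
    - intros b Hb Na Nb. unfold q. rewrite Cmod_div by now apply Cminus_neq_0.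
      assert (P := Cmod_minus_pos _ _ Nb).
      destruct (Rlt_le_dec (Cmod (b - w)) d) as [L|L].
      + eapply Rle_trans; [|apply Rmax_l]. apply Rmult_le_reg_r with (Cmod (b - w)); [easy|].
        unfold Rdiv. rewrite Rmult_assoc, Rinv_l, Rmult_1_r by lra. now apply Lw.
      + eapply Rle_trans; [|apply Rmax_r]. unfold Rdiv. apply Rmult_le_compat.
        * apply Cmod_ge_0.
        * left. now apply Rinv_0_lt_compat.
        * eapply Rle_trans; [apply Cmod_minus_le|]. destruct (H b Hb Na). lra.
        * apply Rinv_le_contravar; easy.
    - intros b Hb. assert (Na : b <> a) by (intros ->; rewrite Cmod_diag in Hb; lra).
      assert (T : R0 / 2 <= Cmod (b - w)).
      { assert (T := Cmod_minus_triangle b w a). lra. }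
      assert (Nb : b <> w) by (intros ->; rewrite Cmod_diag in T; lra).
      unfold q. rewrite Cmod_div by now apply Cminus_neq_0.
      replace (4 * K / R0) with (2 * K / (R0 / 2)) by (field; lra).
      unfold Rdiv at 1 2. apply Rmult_le_compat.
      + apply Cmod_ge_0.
      + left. apply Rinv_0_lt_compat. lra.
      + eapply Rle_trans; [apply Cmod_minus_le|]. destruct (H b ltac:(lra) Na). lra.
      + apply Rinv_le_contravar; lra.
    - lra. }
  assert (P := Cmod_minus_pos _ _ Nvw).
  unfold q in X. rewrite Cmod_div in X by now apply Cminus_neq_0.
  apply Rmult_le_compat_r with (r := Cmod (v - w)) in X; [|lra].
  unfold Rdiv in X at 1. rewrite Rmult_assoc, Rinv_l, Rmult_1_r in X by lra. exact X.
Qed.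

(** [L] is an ultralimit along the points [x n] tending to [a]; the Lipschitz estimate between [v]
    and [x n] then passes to the limit. *)
Lemma limit_punctured (F : C -> C) (a : C) (R0 K : R) : 0 < R0 ->
  (forall b, Cmod (b - a) <= R0 -> b <> a -> cdiff F b /\ Cmod (F b) <= K) ->
  exists L, Cmod L <= K /\ forall v, v <> a -> Cmod (v - a) <= R0 / 2 ->
    Cmod (F v - L) <= 4 * K / R0 * Cmod (v - a).
Proof.
  intros HR H. destruct free_ultrafilter as [U HU].
  set (x := fun n => (a + RtoC (R0 / 2 * / INR (S n)))%C).
  assert (Pn : forall n, 0 < / INR (S n) <= 1).
  { intros n. assert (1 <= INR (S n)) by (rewrite S_INR; assert (X := pos_INR n); lra).
    split; [apply Rinv_0_lt_compat; lra|]. rewrite <- Rinv_1. apply Rinv_le_contravar; lra. }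
  assert (Mx : forall n, Cmod (x n - a) = R0 / 2 * / INR (S n)).
  { intros n. unfold x. replace (a + RtoC (R0 / 2 * / INR (S n)) - a)%C
      with (RtoC (R0 / 2 * / INR (S n))) by ring.
    rewrite Cmod_R, Rabs_right; [easy|]. specialize (Pn n). nra. }
  assert (Bx : forall n, Cmod (x n - a) <= R0 / 2 /\ x n <> a).
  { intros n. specialize (Pn n). specialize (Mx n). split.
    - rewrite Mx. nra.
    - intros E. rewrite E, Cmod_diag in Mx. nra. }
  destruct (ulim_exists U HU (fun n => F (x n)) K) as [L HL].
  { apply ultra_all; [easy|]. intros n. destruct (Bx n). apply H; [lra|easy]. }
  exists L. split.
  { apply (ulim_mod_le U HU (fun n => F (x n))); [easy|]. apply ultra_all; [easy|].
    intros n. destruct (Bx n). apply H; [lra|easy]. }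
  intros v Nv Hv.
  assert (PK : 0 <= K).
  { destruct (H v ltac:(lra) Nv) as [_ Q]. assert (X := Cmod_ge_0 (F v)). lra. }
  assert (PKR : 0 <= 4 * K / R0) by (apply Rle_mult_inv_pos; lra).
  apply le_epsilon. intros e He.
  apply (ulim_le U HU (fun _ => F v) (fun n => F (x n))); [now apply ulim_const|easy|].
  assert (Pe : 0 < e / ((4 * K / R0 + 1) * (R0 / 2))).
  { apply Rdiv_lt_0_compat; [easy|]. apply Rmult_lt_0_compat; lra. }
  apply (ultra_mono U HU) with (2 := inv_INR_eventually U _ HU Pe). intros n Hn.
  destruct (Bx n) as [B1 B2].
  eapply Rle_trans; [apply (lipschitz_punctured F a R0 K); easy|].
  assert (T := Cmod_minus_triangle v a (x n)). rewrite (Cmod_minus_sym a (x n)), Mx in T.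
  assert (4 * K / R0 * Cmod (v - x n) <= 4 * K / R0 * (Cmod (v - a) + R0 / 2 * / INR (S n))).
  { apply Rmult_le_compat_l; lra. }
  assert ((4 * K / R0 + 1) * (R0 / 2) * / INR (S n) < e).
  { replace e with ((4 * K / R0 + 1) * (R0 / 2) * (e / ((4 * K / R0 + 1) * (R0 / 2)))) at 1
      by (field; split; lra).
    apply Rmult_lt_compat_l; [|easy]. apply Rmult_lt_0_compat; lra. }
  specialize (Pn n). nra.
Qed.

(* The constants depend on R0 and K only, so that this estimate survives pointwise limits. *)
Lemma taylor_punctured (F : C -> C) (a : C) (R0 K : R) : 0 < R0 ->
  (forall b, Cmod (b - a) <= R0 -> b <> a -> cdiff F b /\ Cmod (F b) <= K) ->
  exists L l, Cmod l <= 4 * K / R0 /\ forall v, v <> a -> Cmod (v - a) <= R0 / 4 ->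
    Cmod (F v - L - l * (v - a)) <= 32 * K / R0 ^ 2 * Cmod (v - a) ^ 2.
Proof.
  intros HR H. destruct (limit_punctured F a R0 K HR H) as [L [_ HL]].
  set (q := fun v => ((F v - L) / (v - a))%C).
  (* The difference quotient is bounded by [4 * K / R0] on the half-size disc, so it has a limit as
     well, and [4 * (4 * K / R0) / (R0 / 2)] is the constant [32 * K / R0 ^ 2]. *)
  destruct (limit_punctured q a (R0 / 2) (4 * K / R0)) as [l [Hl Hq]].
  - lra.
  - intros b Hb Nb. split.
    + apply cdiff_div.
      * apply cdiff_minus; [apply H; [lra|easy]|apply cdiff_const].
      * apply cdiff_minus; [apply cdiff_id|apply cdiff_const].
      * now apply Cminus_neq_0.
    + unfold q. rewrite Cmod_div by now apply Cminus_neq_0.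
      assert (P := Cmod_minus_pos _ _ Nb).
      apply Rmult_le_reg_r with (Cmod (b - a)); [easy|].
      unfold Rdiv at 1. rewrite Rmult_assoc, Rinv_l, Rmult_1_r by lra. now apply HL.
  - exists L, l. split; [easy|]. intros v Nv Hv. specialize (Hq v Nv ltac:(lra)).
    assert (N := Cminus_neq_0 _ _ Nv).
    replace (F v - L - l * (v - a))%C with ((q v - l) * (v - a))%C by (unfold q; field; easy).
    rewrite Cmod_mult. apply Rmult_le_compat_r with (r := Cmod (v - a)) in Hq; [|apply Cmod_ge_0].
    eapply Rle_trans; [exact Hq|]. right. field. lra.
Qed.

Lemma cderiv_of_quadratic_error (F : C -> C) (a l : C) (d K : R) : 0 < d ->
  (forall v, v <> a -> Cmod (v - a) <= d -> Cmod (F v - F a - l * (v - a)) <= K * Cmod (v - a) ^ 2) ->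
  cderiv F a l.
Proof.
  intros Hd H e He. assert (PK : 0 < Rmax K 0 + 1) by (assert (X := Rmax_r K 0); lra).
  assert (Pe : 0 < e / (Rmax K 0 + 1)) by (apply Rdiv_lt_0_compat; lra).
  exists (Rmin d (e / (Rmax K 0 + 1))). split; [now apply Rmin_glb_lt|].
  intros w Hw. destruct (classic (w = a)) as [->|N].
  - replace (F a - F a - l * (a - a))%C with (RtoC 0) by ring. rewrite Cmod_0, Cmod_diag. lra.
  - assert (W1 := Rlt_le_trans _ _ _ Hw (Rmin_l _ _)). assert (W2 := Rlt_le_trans _ _ _ Hw (Rmin_r _ _)).
    specialize (H w N ltac:(lra)). eapply Rle_trans; [exact H|].
    set (D := Cmod (w - a)) in *. assert (PD : 0 <= D) by apply Cmod_ge_0.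
    replace (K * D ^ 2) with (K * D * D) by ring. apply Rmult_le_compat_r; [easy|].
    assert (X := Rmax_l K 0).
    apply Rle_trans with ((Rmax K 0 + 1) * D); [apply Rmult_le_compat_r; lra|].
    replace e with ((Rmax K 0 + 1) * (e / (Rmax K 0 + 1))) by (field; lra).
    apply Rmult_le_compat_l; lra.
Qed.

Lemma riemann_removable (F : C -> C) (a : C) (R0 K : R) : 0 < R0 ->
  (forall b, Cmod (b - a) <= R0 -> b <> a -> cdiff F b /\ Cmod (F b) <= K) ->
  exists G, (forall v, v <> a -> G v = F v) /\ cdiff G a.
Proof.
  intros HR H. destruct (taylor_punctured F a R0 K HR H) as [L [l [_ Hl]]].
  exists (fun v => if excluded_middle_informative (v = a) then L else F v).
  split.
  - intros v Nv. now destruct excluded_middle_informative.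
  - exists l. apply (cderiv_of_quadratic_error _ _ _ (R0 / 4) (32 * K / R0 ^ 2)); [lra|].
    intros v Nv Hv. repeat (destruct excluded_middle_informative; try easy). now apply Hl.
Qed.

Lemma limit_eq_value (F : C -> C) (a L : C) (d K : R) : 0 < d -> ccont F a ->
  (forall v, v <> a -> Cmod (v - a) <= d -> Cmod (F v - L) <= K * Cmod (v - a)) -> L = F a.
Proof.
  intros Hd Hc HL. apply Cmod_small_eq. intros e He.
  destruct (Hc (e / 2) ltac:(lra)) as [d1 [P1 H1]].
  assert (PK : 0 < Rmax K 0 + 1) by (assert (X := Rmax_r K 0); lra).
  assert (Pe : 0 < e / 2 / (Rmax K 0 + 1)) by (apply Rdiv_lt_0_compat; lra).
  set (t := Rmin (d1 / 2) (Rmin d (e / 2 / (Rmax K 0 + 1)))).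
  assert (Pt : 0 < t) by (repeat apply Rmin_glb_lt; lra).
  assert (T : t <= d1 / 2 /\ t <= d /\ t <= e / 2 / (Rmax K 0 + 1)).
  { unfold t. unfold Rmin; repeat destruct Rle_dec; lra. }
  assert (M : Cmod (a + RtoC t - a) = t).
  { replace (a + RtoC t - a)%C with (RtoC t) by ring. rewrite Cmod_R, Rabs_right; lra. }
  specialize (H1 (a + RtoC t)%C ltac:(rewrite M; lra)).
  assert (Na : (a + RtoC t)%C <> a) by (intros X; rewrite X, Cmod_diag in M; lra).
  specialize (HL (a + RtoC t)%C Na ltac:(rewrite M; lra)). rewrite M in HL.
  assert (K * t <= (Rmax K 0 + 1) * t).
  { apply Rmult_le_compat_r; [lra|]. assert (X := Rmax_l K 0). lra. }
  assert (Q : (Rmax K 0 + 1) * t <= (Rmax K 0 + 1) * (e / 2 / (Rmax K 0 + 1))).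
  { apply Rmult_le_compat_l; lra. }
  replace ((Rmax K 0 + 1) * (e / 2 / (Rmax K 0 + 1))) with (e / 2) in Q by (field; lra).
  replace (L - F a)%C with ((F (a + t)%C - F a) - (F (a + t)%C - L))%C by ring.
  eapply Rle_trans; [apply Cmod_minus_le|]. lra.
Qed.

(** Continuity forces the removable value to be [F a], so [F] itself is differentiable there,
    without redefinition. *)
Lemma removable_continuous (F : C -> C) (a : C) (R0 : R) : 0 < R0 ->
  (forall b, Cmod (b - a) <= R0 -> b <> a -> cdiff F b) -> ccont F a -> cdiff F a.
Proof.
  intros HR H Hc. destruct (Hc 1 Rlt_0_1) as [d [Pd Hd]].
  set (R1 := Rmin R0 (d / 2)). assert (PR1 : 0 < R1) by (apply Rmin_glb_lt; lra).
  assert (HF : forall b, Cmod (b - a) <= R1 -> b <> a ->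
    cdiff F b /\ Cmod (F b) <= Cmod (F a) + 1).
  { intros b Hb Nb. split.
    - apply H; [|easy]. eapply Rle_trans; [exact Hb|apply Rmin_l].
    - assert (B := Rle_trans _ _ _ Hb (Rmin_r _ _)). specialize (Hd b ltac:(lra)).
      assert (T := Cmod_minus_ge (F b) (F a)). lra. }
  destruct (taylor_punctured F a _ _ PR1 HF) as [L [l [_ Hl]]].
  set (M := 32 * (Cmod (F a) + 1) / R1 ^ 2) in Hl.
  assert (PM : 0 <= M).
  { apply Rle_mult_inv_pos; [|apply pow_lt; easy]. assert (X := Cmod_ge_0 (F a)). lra. }
  assert (EL : L = F a).
  { apply (limit_eq_value F a L (R1 / 4) (M * R1 + Cmod l)); [lra|easy|].
    intros v Nv Hv. specialize (Hl v Nv Hv).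
    replace (F v - L)%C with ((F v - L - l * (v - a)) + l * (v - a))%C by ring.
    eapply Rle_trans; [apply Cmod_triangle|]. rewrite Cmod_mult.
    assert (PD := Cmod_ge_0 (v - a)). set (D := Cmod (v - a)) in *.
    assert (M * D ^ 2 <= M * R1 * D); [|lra].
    replace (M * D ^ 2) with (M * D * D) by ring.
    apply Rmult_le_compat_r; [easy|]. apply Rmult_le_compat_l; lra. }
  subst L. exists l. apply (cderiv_of_quadratic_error F a l (R1 / 4) M); [lra|exact Hl].
Qed.

Lemma lipschitz_disc (F : C -> C) (a : C) (R0 K : R) : 0 < R0 ->
  (forall b, Cmod (b - a) <= R0 -> cdiff F b /\ Cmod (F b) <= K) ->
  forall v, Cmod (v - a) <= R0 / 2 -> Cmod (F v - F a) <= 4 * K / R0 * Cmod (v - a).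
Proof.
  intros HR H v Hv. destruct (limit_punctured F a R0 K HR (fun b Hb _ => H b Hb)) as [L [_ HL]].
  assert (EL : L = F a).
  { apply (limit_eq_value F a L (R0 / 2) (4 * K / R0)); [lra| |easy].
    apply cdiff_ccont, H. rewrite Cmod_diag. lra. }
  subst L. destruct (classic (v = a)) as [->|N].
  - rewrite !Cmod_diag. lra.
  - now apply HL.
Qed.

Lemma taylor_disc (F : C -> C) (a : C) (R0 K : R) : 0 < R0 ->
  (forall b, Cmod (b - a) <= R0 -> cdiff F b /\ Cmod (F b) <= K) ->
  exists l, Cmod l <= 4 * K / R0 /\ forall v, Cmod (v - a) <= R0 / 4 ->
    Cmod (F v - F a - l * (v - a)) <= 32 * K / R0 ^ 2 * Cmod (v - a) ^ 2.
Proof.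
  intros HR H. destruct (taylor_punctured F a R0 K HR (fun b Hb _ => H b Hb)) as [L [l [Bl Hl]]].
  set (M := 32 * K / R0 ^ 2) in *.
  assert (PK : 0 <= K).
  { destruct (H a ltac:(rewrite Cmod_diag; lra)) as [_ Q]. assert (X := Cmod_ge_0 (F a)). lra. }
  assert (PM : 0 <= M).
  { apply Rle_mult_inv_pos; [lra|apply pow_lt; easy]. }
  assert (EL : L = F a).
  { apply (limit_eq_value F a L (R0 / 4) (M * R0 + Cmod l)); [lra| |].
    { apply cdiff_ccont, H. rewrite Cmod_diag. lra. }
    intros v Nv Hv. specialize (Hl v Nv Hv).
    replace (F v - L)%C with ((F v - L - l * (v - a)) + l * (v - a))%C by ring.
    eapply Rle_trans; [apply Cmod_triangle|]. rewrite Cmod_mult.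
    assert (PD := Cmod_ge_0 (v - a)). set (D := Cmod (v - a)) in *.
    assert (M * D ^ 2 <= M * R0 * D); [|lra].
    replace (M * D ^ 2) with (M * D * D) by ring.
    apply Rmult_le_compat_r; [easy|]. apply Rmult_le_compat_l; lra. }
  subst L. exists l. split; [easy|]. intros v Hv. destruct (classic (v = a)) as [->|N].
  - replace (F a - F a - l * (a - a))%C with (RtoC 0) by ring. rewrite Cmod_0, Cmod_diag. lra.
  - now apply Hl.
Qed.

(** * Normal families *)

(** The derivatives at [a] are bounded by [4 * K / R0] and have an ultralimit; the quadratic Taylor
    error, with a constant independent of [n], is inherited by the limit function. *)
Lemma ultralimit_cdiff (U : (nat -> Prop) -> Prop) (f : nat -> C -> C) (H : C -> C)
  (a : C) (R0 K : R) : ultrafilter U -> 0 < R0 ->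
  (forall n b, Cmod (b - a) <= R0 -> cdiff (f n) b /\ Cmod (f n b) <= K) ->
  (forall b, Cmod (b - a) <= R0 -> ulim U (fun n => f n b) (H b)) -> cdiff H a.
Proof.
  intros HU HR Hf HH.
  destruct (choice _ (fun n => taylor_disc (f n) a R0 K HR (Hf n))) as [l Hl].
  destruct (ulim_exists U HU l (4 * K / R0)) as [L HL].
  { apply ultra_all; [easy|]. intros n. apply Hl. }
  exists L. apply (cderiv_of_quadratic_error H a L (R0 / 4) (32 * K / R0 ^ 2)); [lra|].
  intros v _ Hv.
  assert (Ha : Cmod (a - a) <= R0) by (rewrite Cmod_diag; lra).
  replace (H v - H a - L * (v - a))%C with (H v - (H a + L * (v - a)))%C by ring.
  apply (ulim_le U HU (fun n => f n v) (fun n => f n a + l n * (v - a))%C).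
  - apply HH. lra.
  - intros e He. assert (PD := Cmod_ge_0 (v - a)).
    assert (Pe : 0 < e / 2 / (Cmod (v - a) + 1)) by (apply Rdiv_lt_0_compat; lra).
    apply (ultra_mono U HU) with (2 := ultra_and U HU _ _ (HH a Ha (e / 2) ltac:(lra)) (HL _ Pe)).
    intros n [A B].
    replace (f n a + l n * (v - a) - (H a + L * (v - a)))%C
      with ((f n a - H a) + (l n - L) * (v - a))%C by ring.
    eapply Rle_lt_trans; [apply Cmod_triangle|]. rewrite Cmod_mult.
    assert (Q : Cmod (l n - L) * (Cmod (v - a) + 1) < e / 2 / (Cmod (v - a) + 1) * (Cmod (v - a) + 1)).
    { apply Rmult_lt_compat_r; lra. }
    replace (e / 2 / (Cmod (v - a) + 1) * (Cmod (v - a) + 1)) with (e / 2) in Q by (field; lra).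
    assert (X := Cmod_ge_0 (l n - L)). lra.
  - apply ultra_all; [easy|]. intros n. destruct (Hl n) as [_ T]. specialize (T v Hv).
    now replace (f n v - (f n a + l n * (v - a)))%C with (f n v - f n a - l n * (v - a))%C by ring.
Qed.

(** The common Lipschitz constant is equicontinuity: the evaluation point may move with [n]. *)
Lemma ultralimit_eval (U : (nat -> Prop) -> Prop) (f : nat -> C -> C) (x : nat -> C)
  (a h : C) (R0 K : R) : ultrafilter U -> 0 < R0 ->
  (forall n b, Cmod (b - a) <= R0 -> cdiff (f n) b /\ Cmod (f n b) <= K) ->
  ulim U x a -> ulim U (fun n => f n a) h -> ulim U (fun n => f n (x n)) h.
Proof.
  intros HU HR Hf Hx Hh. apply (ulim_dist U HU (fun n => f n a)); [easy|]. intros e He.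
  assert (PK : 0 <= K).
  { destruct (Hf O a ltac:(rewrite Cmod_diag; lra)) as [_ Q].
    assert (X := Cmod_ge_0 (f O a)). lra. }
  assert (PKR : 0 <= 4 * K / R0) by (apply Rle_mult_inv_pos; lra).
  assert (Pe : 0 < e / (4 * K / R0 + 1)) by (apply Rdiv_lt_0_compat; lra).
  apply (ultra_mono U HU) with
    (2 := ultra_and U HU _ _ (Hx (R0 / 2) ltac:(lra)) (Hx _ Pe)).
  intros n [A B].
  eapply Rle_lt_trans; [apply (lipschitz_disc (f n) a R0 K HR (Hf n)); lra|].
  assert (Q : (4 * K / R0 + 1) * Cmod (x n - a) < (4 * K / R0 + 1) * (e / (4 * K / R0 + 1))).
  { apply Rmult_lt_compat_l; lra. }
  replace ((4 * K / R0 + 1) * (e / (4 * K / R0 + 1))) with e in Q by (field; lra).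
  assert (X := Cmod_ge_0 (x n - a)). lra.
Qed.

(** * Zeros and the open mapping theorem *)

Definition copen (G : C -> Prop) : Prop :=
  forall a, G a -> exists d, 0 < d /\ forall w, Cmod (w - a) < d -> G w.

Lemma copen_closed_disc (G : C -> Prop) (a : C) (r : R) : copen G -> G a -> 0 < r ->
  exists d, 0 < d < r /\ forall w, Cmod (w - a) <= d -> G w.
Proof.
  intros HG Ha Hr. destruct (HG a Ha) as [d [Hd H]]. exists (Rmin (d / 2) (r / 2)). split.
  - split; [apply Rmin_glb_lt; lra|]. eapply Rle_lt_trans; [apply Rmin_r|lra].
  - intros w Hw. apply H. eapply Rle_lt_trans; [exact Hw|].
    eapply Rle_lt_trans; [apply Rmin_l|lra].
Qed.

Lemma bounded_on_disc (f : C -> C) (a : C) (R0 : R) : 0 <= R0 ->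
  (forall b, Cmod (b - a) <= R0 -> ccont f b) ->
  exists K, 0 <= K /\ forall b, Cmod (b - a) <= R0 -> Cmod (f b) <= K.
Proof.
  intros HR Hf. destruct (closed_disc_max (fun v => Cmod (f v)) a R0 HR) as [b [Hb Hm]].
  - intros b Hb e He. destruct (Hf b Hb e He) as [d [Hd H]]. exists d. split; [easy|].
    intros v Hv. specialize (H v Hv).
    assert (T1 := Cmod_minus_ge (f v) (f b)). assert (T2 := Cmod_minus_ge (f b) (f v)).
    rewrite (Cmod_minus_sym (f b)) in T2. apply Rabs_lt_between. lra.
  - exists (Cmod (f b)). split; [apply Cmod_ge_0|easy].
Qed.

(** The singularity of [f w / (w - p)] at [p] is removable. The factorisation holds on all of [C],
    because [f1] is this quotient everywhere else, so divisions can be iterated freely. *)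
Lemma divide_zero (G : C -> Prop) (f : C -> C) (p : C) : copen G -> G p ->
  (forall w, G w -> cdiff f w) -> f p = 0 ->
  exists f1, (forall w, G w -> cdiff f1 w) /\ forall w, f w = ((w - p) * f1 w)%C.
Proof.
  intros HG Hp Hf f0. destruct (Hf p Hp) as [l Hl].
  destruct (cderiv_lipschitz f p l Hl) as [d [Hd Lip]].
  destruct (copen_closed_disc G p d HG Hp Hd) as [r [Hr Hball]].
  set (q := fun w => (f w / (w - p))%C).
  assert (Dq : forall w, G w -> w <> p -> cdiff q w).
  { intros w Hw Nw. apply cdiff_div; [now apply Hf| |now apply Cminus_neq_0].
    apply cdiff_minus; [apply cdiff_id|apply cdiff_const]. }
  destruct (riemann_removable q p r (Cmod l + 1)) as [f1 [E D]].
  - easy.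
  - intros b Hb Nb. split; [apply Dq; auto|].
    specialize (Lip b ltac:(lra)). rewrite f0 in Lip. replace (f b - 0)%C with (f b) in Lip by ring.
    assert (P := Cmod_minus_pos _ _ Nb).
    unfold q. rewrite Cmod_div by now apply Cminus_neq_0.
    apply Rmult_le_reg_r with (Cmod (b - p)); [easy|].
    unfold Rdiv. rewrite Rmult_assoc, Rinv_l, Rmult_1_r by lra. exact Lip.
  - exists f1. split.
    + intros w Hw. destruct (classic (w = p)) as [->|Nw]; [easy|].
      apply (cdiff_local q f1 w (Cmod (w - p))); [now apply Cmod_minus_pos| |now apply Dq].
      intros v Hv. symmetry. apply E. intros ->. rewrite Cmod_minus_sym in Hv. lra.
    + intros w. destruct (classic (w = p)) as [->|Nw].
      * rewrite f0. ring.
      * rewrite E by easy. unfold q. field. now apply Cminus_neq_0.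
Qed.

(* If f were divisible by every (w - p)^m, the maximum principle for the quotients
   would give |f w| <= K (|w - p| / R0)^m for all m. *)
Lemma finite_order (G : C -> Prop) (f : C -> C) (p : C) (R0 : R) : copen G -> 0 < R0 ->
  (forall w, Cmod (w - p) <= R0 -> G w) -> (forall w, G w -> cdiff f w) ->
  (forall w, Cmod (w - p) < R0 -> f w = 0) \/
  exists m f1, (forall w, G w -> cdiff f1 w) /\ f1 p <> 0 /\
    forall w, f w = ((w - p) ^ m * f1 w)%C.
Proof.
  intros HG HR Hball Hf.
  assert (Hp : G p) by (apply Hball; rewrite Cmod_diag; lra).
  destruct (classic (exists m f1, (forall w, G w -> cdiff f1 w) /\ f1 p <> 0 /\
    forall w, f w = ((w - p) ^ m * f1 w)%C)) as [|N]; [now right|left].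
  assert (A : forall m, exists f1, (forall w, G w -> cdiff f1 w) /\
    forall w, f w = ((w - p) ^ m * f1 w)%C).
  { induction m as [|m [f1 [D E]]].
    - exists f. split; [easy|]. intros w. simpl. ring.
    - assert (Z : f1 p = 0).
      { apply NNPP. intros Z. apply N. now exists m, f1. }
      destruct (divide_zero G f1 p HG Hp D Z) as [f2 [D2 E2]].
      exists f2. split; [easy|]. intros w. rewrite E, E2. simpl. ring. }
  destruct (bounded_on_disc f p R0 ltac:(lra)) as [K [PK HK]].
  { intros b Hb. now apply cdiff_ccont, Hf, Hball. }
  intros w Hw. apply NNPP. intros Nf.
  assert (Nw : w <> p).
  { intros ->. destruct (A 1%nat) as [f1 [_ E]]. apply Nf. rewrite E. simpl. ring. }
  apply (pow_dominates R0 (Cmod (w - p)) K (Cmod (f w))).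
  - now apply Cmod_gt_0.
  - split; [now apply Cmod_minus_pos|easy].
  - intros n. destruct (A n) as [f1 [D E]].
    assert (Pn : 0 < R0 ^ n) by now apply pow_lt.
    assert (B : Cmod (f1 w) <= K / R0 ^ n).
    { apply (max_principle f1 p R0); try lra.
      - apply Rle_mult_inv_pos; easy.
      - intros b Hb. now apply cdiff_ccont, D, Hball.
      - intros b Hb. right. exists (R0 - Cmod (b - p)). split; [lra|].
        intros v Hv. apply D, Hball. assert (T := Cmod_minus_triangle v b p). lra.
      - intros b Hb. specialize (HK b ltac:(lra)). rewrite E, Cmod_mult, Cmod_pow, Hb in HK.
        apply Rmult_le_reg_l with (R0 ^ n); [easy|].
        replace (R0 ^ n * (K / R0 ^ n)) with K by (field; lra). exact HK. }
    rewrite E, Cmod_mult, Cmod_pow.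
    apply Rmult_le_compat_r with (r := R0 ^ n) in B; [|lra].
    replace (K / R0 ^ n * R0 ^ n) with K in B by (field; lra).
    assert (P := pow_le _ n (Cmod_ge_0 (w - p))).
    rewrite Rmult_assoc, (Rmult_comm K). now apply Rmult_le_compat_l.
Qed.

Lemma nonzero_near (f : C -> C) (p : C) : ccont f p -> f p <> 0 ->
  exists d, 0 < d /\ forall w, Cmod (w - p) < d -> Cmod (f p) / 2 < Cmod (f w).
Proof.
  intros Hf N. apply Cmod_gt_0 in N. destruct (Hf (Cmod (f p) / 2) ltac:(lra)) as [d [Hd H]].
  exists d. split; [easy|]. intros w Hw. specialize (H w Hw).
  assert (T := Cmod_minus_ge (f p) (f w)). rewrite (Cmod_minus_sym (f p)) in T. lra.
Qed.

Lemma isolated_zero (G : C -> Prop) (f : C -> C) (p : C) : copen G -> G p ->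
  (forall w, G w -> cdiff f w) ->
  (exists d, 0 < d /\ forall w, Cmod (w - p) < d -> f w = 0) \/
  (exists d, 0 < d /\ forall w, w <> p -> Cmod (w - p) < d -> f w <> 0).
Proof.
  intros HG Hp Hf. destruct (copen_closed_disc G p 1 HG Hp Rlt_0_1) as [r [Hr Hball]].
  destruct (finite_order G f p r HG ltac:(lra) Hball Hf) as [Z|[m [f1 [D [N E]]]]].
  - left. exists r. split; [lra|easy].
  - right. destruct (nonzero_near f1 p) as [d [Hd H]]; [now apply cdiff_ccont, D|easy|].
    exists d. split; [easy|]. intros w Nw Hw. rewrite E. specialize (H w Hw).
    apply Cmult_neq_0.
    + apply Cpow_nz. now apply Cminus_neq_0.
    + apply Cmod_gt_0. assert (X := Cmod_ge_0 (f1 p)). lra.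
Qed.

(** The maximum principle for [/ u]. The slack factor 2 makes the negation contradictory at once, so
    no minimum point on the circle has to be found. *)
Lemma min_principle (u : C -> C) (a : C) (R0 : R) : 0 < R0 ->
  (forall b, Cmod (b - a) <= R0 -> cdiff u b /\ u b <> 0) ->
  exists b, Cmod (b - a) = R0 /\ Cmod (u b) <= 2 * Cmod (u a).
Proof.
  intros HR H. apply NNPP. intros N.
  assert (Ha : Cmod (a - a) <= R0) by (rewrite Cmod_diag; lra).
  destruct (H a Ha) as [_ Na]. assert (Pa := Na). apply Cmod_gt_0 in Pa.
  assert (X : Cmod (/ u a) <= / (2 * Cmod (u a))).
  { apply (max_principle (fun b => / u b)%C a R0); try easy.
    - left. apply Rinv_0_lt_compat. lra.
    - intros b Hb. apply cdiff_ccont, cdiff_inv; now apply H.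
    - intros b Hb. right. exists (R0 - Cmod (b - a)). split; [lra|]. intros w Hw.
      assert (T := Cmod_minus_triangle w b a). apply cdiff_inv; apply H; lra.
    - intros b Hb. rewrite Cmod_inv by (apply H; lra). apply Rinv_le_contravar; [lra|].
      apply Rnot_lt_le. intros L. apply N. exists b. split; [easy|lra]. }
  rewrite Cmod_inv in X by easy. rewrite Rinv_mult in X.
  assert (0 < / Cmod (u a)) by now apply Rinv_0_lt_compat. lra.
Qed.

(** If [v] were omitted, [f - v] would have no zero in a disc around [a], and the minimum principle
    would make it small on a circle where [f] stays away from [f a]. *)
Lemma open_mapping (G : C -> Prop) (f : C -> C) (a : C) (r : R) : copen G -> G a -> 0 < r ->
  (forall w, G w -> cdiff f w) ->
  (~ exists d, 0 < d /\ forall w, Cmod (w - a) < d -> f w = f a) ->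
  exists m, 0 < m /\ forall v, Cmod (v - f a) < m -> exists w, G w /\ Cmod (w - a) < r /\ f w = v.
Proof.
  intros HG Ha Hr Hf N. destruct (copen_closed_disc G a r HG Ha Hr) as [r1 [Hr1 Hball]].
  assert (Hf' : forall w, G w -> cdiff (fun w => f w - f a)%C w).
  { intros w Hw. apply cdiff_minus; [now apply Hf|apply cdiff_const]. }
  destruct (finite_order G (fun w => f w - f a)%C a r1 HG ltac:(lra) Hball Hf') as [Z|[k [f1 [D [N1 E]]]]].
  { exfalso. apply N. exists r1. split; [lra|]. intros w Hw.
    apply Cmod_minus_eq_0. rewrite (Z w Hw). apply Cmod_0. }
  destruct (nonzero_near f1 a) as [d [Hd Hnz]]; [now apply cdiff_ccont, D|easy|].
  apply Cmod_gt_0 in N1.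
  set (rho := Rmin r1 (d / 2)). assert (Pr : 0 < rho) by (apply Rmin_glb_lt; lra).
  assert (L1 : rho <= r1) by apply Rmin_l. assert (L2 : rho <= d / 2) by apply Rmin_r.
  set (m := rho ^ k * (Cmod (f1 a) / 2)).
  assert (Pm : 0 < m) by (apply Rmult_lt_0_compat; [now apply pow_lt|lra]).
  assert (Hm : forall b, Cmod (b - a) = rho -> m <= Cmod (f b - f a)).
  { intros b Hb. rewrite E, Cmod_mult, Cmod_pow, Hb. apply Rmult_le_compat_l.
    - apply pow_le; lra.
    - left. apply Hnz. lra. }
  (* On the circle [f] is at distance at least [m] from [f a], whereas the minimum principle yields
     a point at distance less than [2 * m / 3 + m / 3]. *)
  exists (m / 3). split; [lra|]. intros v Hv. apply NNPP. intros Nv.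
  destruct (min_principle (fun w => f w - v)%C a rho) as [b [Hb Hmin]].
  - easy.
  - intros b Hb. split.
    + apply cdiff_minus; [apply Hf, Hball; lra|apply cdiff_const].
    + apply Cminus_neq_0. intros Eb. apply Nv. exists b. split; [apply Hball; lra|split; [lra|easy]].
  - specialize (Hm b Hb). rewrite (Cmod_minus_sym (f a)) in Hmin.
    assert (T := Cmod_minus_triangle (f b) v (f a)). lra.
Qed.

(** * The identity theorem *)

(** Connectedness of an interval, used for the identity theorem and for keeping real preimages on
    the positive axis. *)
Lemma locally_constant_interval (P : R -> Prop) (b : R) : P 0 ->
  (forall t, 0 <= t <= b -> exists d, 0 < d /\ forall s, 0 <= s <= b -> Rabs (s - t) < d ->
     (P s <-> P t)) ->
  forall t, 0 <= t <= b -> P t.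
Proof.
  intros P0 HP t1 Ht1.
  set (S := fun t => 0 <= t <= t1 /\ forall s, 0 <= s <= t -> P s).
  assert (S0 : S 0).
  { split; [lra|]. intros s Hs. now replace s with 0 by lra. }
  destruct (completeness S) as [m [M1 M2]].
  { exists t1. intros t [Ht _]. lra. }
  { now exists 0. }
  assert (m0 : 0 <= m) by now apply M1.
  assert (m1 : m <= t1) by (apply M2; intros t [Ht _]; lra).
  destruct (HP m ltac:(lra)) as [d [Hd H]].
  assert (E : exists t, S t /\ m - d < t).
  { apply NNPP. intros N. assert (m <= m - d); [|lra]. apply M2. intros t St.
    apply Rnot_lt_le. intros L. apply N. now exists t. }
  destruct E as [t [[Ht St] Hmt]].
  assert (tm : t <= m) by now apply M1.
  assert (Pm : P m).
  { apply (H t); [lra| |apply St; lra]. apply Rabs_lt_between. lra. }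
  assert (S' : S (Rmin (m + d / 2) t1)).
  { assert (L1 := Rmin_l (m + d / 2) t1). assert (L2 := Rmin_r (m + d / 2) t1). split.
    - split; [|easy]. apply Rmin_glb; lra.
    - intros s Hs. destruct (Rle_lt_dec s t) as [L|L].
      + apply St. lra.
      + apply H; [lra| |easy]. apply Rabs_lt_between. lra. }
  assert (B := M1 _ S'). destruct S' as [_ S']. apply S'. split; [lra|].
  unfold Rmin in *. destruct Rle_dec; lra.
Qed.

(** Since zeros are isolated or fill a neighbourhood, vanishing near [g t] is a locally constant
    property of [t]. *)
Lemma identity_along_path (G : C -> Prop) (f : C -> C) (g : R -> C) (b : R) : copen G ->
  (forall w, G w -> cdiff f w) -> 0 <= b ->
  (forall t, 0 <= t <= b -> G (g t)) ->
  (forall t, 0 <= t <= b -> forall e, 0 < e -> exists d, 0 < d /\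
     forall s, Rabs (s - t) < d -> Cmod (g s - g t) < e) ->
  (exists d, 0 < d /\ forall w, Cmod (w - g 0) < d -> f w = 0) -> f (g b) = 0.
Proof.
  intros HG Hf Hb HGg Hg H0.
  assert (A : exists d, 0 < d /\ forall w, Cmod (w - g b) < d -> f w = 0).
  { apply (locally_constant_interval
      (fun t => exists d, 0 < d /\ forall w, Cmod (w - g t) < d -> f w = 0) b); try lra.
    - easy.
    - intros t Ht. destruct (isolated_zero G f (g t) HG (HGg t Ht) Hf) as [[d [Hd Z]]|[d [Hd Z]]].
      + destruct (Hg t Ht (d / 2) ltac:(lra)) as [d' [Hd' H]]. exists d'. split; [easy|].
        intros s _ Hs. specialize (H s Hs). split; intros _.
        * now exists d.
        * exists (d / 2). split; [lra|]. intros w Hw. apply Z.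
          assert (T := Cmod_minus_triangle w (g s) (g t)). lra.
      + destruct (Hg t Ht d Hd) as [d' [Hd' H]]. exists d'. split; [easy|].
        intros s _ Hs. specialize (H s Hs).
        (* A disc of zeros around [c] would contain a point other than [g t]: either [c] itself or,
           if [c = g t], the shifted point [c + e]. *)
        assert (no : forall c, Cmod (c - g t) < d ->
          ~ exists d, 0 < d /\ forall w, Cmod (w - c) < d -> f w = 0).
        { intros c Hc [d1 [Hd1 H1]].
          set (e := Rmin d1 (d - Cmod (c - g t)) / 2).
          assert (Pe : 0 < Rmin d1 (d - Cmod (c - g t))) by (apply Rmin_glb_lt; lra).
          assert (L1 := Rmin_l d1 (d - Cmod (c - g t))). assert (L2 := Rmin_r d1 (d - Cmod (c - g t))).
          assert (M : Cmod (c + RtoC e - c) = e).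
          { replace (c + RtoC e - c)%C with (RtoC e) by ring.
            rewrite Cmod_R, Rabs_right; unfold e; lra. }
          assert (Q : forall v, v <> g t -> Cmod (v - c) <= e -> False).
          { intros v Nv Hv. apply (Z v Nv).
            - assert (T := Cmod_minus_triangle v c (g t)). unfold e in Hv. lra.
            - apply H1. unfold e in Hv. lra. }
          destruct (classic (c = g t)) as [E|E].
          - apply (Q (c + RtoC e)%C); [|lra]. rewrite <- E. intros X. rewrite X, Cmod_diag in M.
            unfold e in M. lra.
          - apply (Q c E). rewrite Cmod_diag. unfold e. lra. }
        split; intros X; exfalso.
        * now apply (no (g s)).
        * apply (no (g t)); [rewrite Cmod_diag|]; easy. }
  destruct A as [d [Hd A]]. apply A. rewrite Cmod_diag. easy.
Qed.

(** * Connectedness of the annulus *)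

Lemma polar_form (w : C) : w <> 0 -> exists t, w = cexp (ln (Cmod w), t).
Proof.
  intros Hw. assert (P := Hw). apply Cmod_gt_0 in P.
  destruct w as [x y]. set (m := Cmod (x, y)) in *.
  assert (E : m ^ 2 = x ^ 2 + y ^ 2) by (unfold m; rewrite Cmod2_alt; easy).
  set (c := x / m). set (s := y / m).
  assert (Ecs : c ^ 2 + s ^ 2 = 1).
  { unfold c, s. replace ((x / m) ^ 2 + (y / m) ^ 2) with ((x ^ 2 + y ^ 2) / m ^ 2) by (field; lra).
    rewrite <- E. field. lra. }
  assert (Bc : -1 <= c <= 1) by nra.
  assert (Sq : 1 - Rsqr c = Rsqr s) by (unfold Rsqr; lra).
  assert (X : exists t, cos t = c /\ sin t = s).
  { destruct (Rle_dec 0 s) as [L|L].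
    - exists (acos c). rewrite cos_acos, sin_acos by easy. rewrite Sq, sqrt_Rsqr by easy. easy.
    - exists (- acos c). rewrite cos_neg, sin_neg, cos_acos, sin_acos by easy.
      rewrite Sq, sqrt_Rsqr_abs, Rabs_left by lra. split; [easy|ring]. }
  destruct X as [t [E1 E2]]. exists t. unfold cexp. simpl fst; simpl snd.
  rewrite E1, E2, exp_ln by easy. unfold c, s.
  apply injective_projections; simpl; field; lra.
Qed.

Lemma annulus_open (r : R) : copen (annulus r).
Proof.
  intros a [H1 H2]. exists (Rmin (Cmod a - r) (1 - Cmod a)). split; [apply Rmin_glb_lt; lra|].
  intros w Hw. assert (W1 := Rlt_le_trans _ _ _ Hw (Rmin_l _ _)).
  assert (W2 := Rlt_le_trans _ _ _ Hw (Rmin_r _ _)).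
  assert (T1 := Cmod_minus_ge w a). assert (T2 := Cmod_minus_ge a w).
  rewrite (Cmod_minus_sym a) in T2. split; lra.
Qed.

(** The annulus is the image under [cexp] of a vertical strip, which is convex; the path is the
    image of a segment between two logarithms. *)
Lemma annulus_identity (r : R) (f : C -> C) (p : C) : 0 < r ->
  (forall w, annulus r w -> cdiff f w) -> annulus r p ->
  (exists d, 0 < d /\ forall w, Cmod (w - p) < d -> f w = 0) ->
  forall q, annulus r q -> f q = 0.
Proof.
  intros Hr Hf Hp H0 q Hq.
  assert (polar : forall w, annulus r w -> exists t, w = cexp t /\ ln r < fst t < 0).
  { intros w [H1 H2]. destruct (polar_form w) as [t E].
    - apply Cmod_gt_0. lra.
    - exists (ln (Cmod w), t). split; [easy|]. simpl. split.
      + apply ln_increasing; lra.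
      + rewrite <- ln_1. apply ln_increasing; lra. }
  destruct (polar p Hp) as [al [Ep Hal]]. destruct (polar q Hq) as [be [Eq Hbe]].
  set (g := fun t : R => cexp (al + t * (be - al))).
  replace q with (g 1) by (unfold g; rewrite Eq; f_equal; ring).
  apply (identity_along_path (annulus r) f g 1); try easy.
  - apply annulus_open.
  - lra.
  - intros t Ht. unfold g, annulus. rewrite Cmod_cexp. simpl.
    set (u := fst al) in *. set (v := fst be) in *.
    replace (u + (t * (v + - u) - 0 * (snd be + - snd al))) with ((1 - t) * u + t * v) by ring.
    assert (B : ln r < (1 - t) * u + t * v < 0) by (destruct (Rle_dec u v); split; nra).
    split.
    + rewrite <- (exp_ln r Hr) at 1. now apply exp_increasing.
    + apply Rlt_le_trans with (exp 0); [now apply exp_increasing|rewrite exp_0; lra].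
  - intros t Ht e He.
    destruct (cdiff_ccont cexp (al + t * (be - al))%C (ex_intro _ _ (cderiv_cexp _)) e He)
      as [d [Hd H]].
    set (K := Cmod (be - al) + 1). assert (PK : 0 < K).
    { assert (X := Cmod_ge_0 (be - al)). unfold K. lra. }
    exists (d / K). split; [now apply Rdiv_lt_0_compat|]. intros s Hs. apply H.
    replace (al + s * (be - al) - (al + t * (be - al)))%C with (RtoC (s - t) * (be - al))%C
      by (rewrite RtoC_minus; ring).
    rewrite Cmod_mult, Cmod_R.
    apply Rle_lt_trans with (Rabs (s - t) * K).
    + apply Rmult_le_compat_l; [apply Rabs_pos|unfold K; lra].
    + replace d with (d / K * K) by (field; lra). apply Rmult_lt_compat_r; easy.
  - destruct H0 as [d [Hd H0]]. exists d. split; [easy|].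
    replace (g 0) with p; [easy|]. unfold g. rewrite Ep. f_equal. ring.
Qed.

(** * Injective holomorphic maps *)

Definition locally_constant_at (f : C -> C) (a : C) : Prop :=
  exists d, 0 < d /\ forall w, Cmod (w - a) < d -> f w = f a.

(** Injectivity is assumed off [a] only, so the lemma applies at a filled puncture; the two points
    [a + r] and [a + r / 2] collide. *)
Lemma injective_not_locally_constant (G : C -> Prop) (f : C -> C) (a : C) : copen G -> G a ->
  injective_on (fun w => G w /\ w <> a) f -> ~ locally_constant_at f a.
Proof.
  intros HG Ha Hinj [d [Hd H]]. destruct (copen_closed_disc G a d HG Ha Hd) as [r [Hr Hb]].
  assert (M : forall t, 0 < t <= r -> Cmod (a + RtoC t - a) = t).
  { intros t Ht. replace (a + RtoC t - a)%C with (RtoC t) by ring. rewrite Cmod_R, Rabs_right; lra. }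
  assert (N : forall t, 0 < t <= r -> (a + RtoC t)%C <> a).
  { intros t Ht E. specialize (M t Ht). rewrite E, Cmod_diag in M. lra. }
  assert (E : (a + RtoC r)%C = (a + RtoC (r / 2))%C).
  { apply Hinj.
    - split; [apply Hb; rewrite M; lra|apply N; lra].
    - split; [apply Hb; rewrite M; lra|apply N; lra].
    - rewrite (H (a + RtoC r)%C), (H (a + RtoC (r / 2))%C); [easy| |]; rewrite M; lra. }
  assert (E' : RtoC r = RtoC (r / 2)).
  { replace (RtoC r) with (a + RtoC r - a)%C by ring. rewrite E. ring. }
  apply RtoC_inj in E'. lra.
Qed.

(* f n - f n w1 has no zero near w0, so by the minimum principle it is small somewhere
   on a fixed circle around w0; in the limit H takes the value H w0 on that circle. *)
Lemma hurwitz_injective (U : (nat -> Prop) -> Prop) (f : nat -> C -> C) (H : C -> C)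
  (G : C -> Prop) (K : R) : ultrafilter U -> copen G ->
  (forall n w, G w -> cdiff (f n) w /\ Cmod (f n w) <= K) ->
  (forall n, injective_on G (f n)) ->
  (forall w, G w -> ulim U (fun n => f n w) (H w)) ->
  (forall w, G w -> cdiff H w) ->
  (forall a, G a -> ~ locally_constant_at H a) -> injective_on G H.
Proof.
  intros HU HG Hf Hinj HH HD Hnc w0 w1 G0 G1 E. apply NNPP. intros N.
  destruct (isolated_zero G (fun w => H w - H w0)%C w0 HG G0) as [[d [Hd Z]]|[d [Hd Z]]].
  { intros w Hw. apply cdiff_minus; [now apply HD|apply cdiff_const]. }
  { apply (Hnc w0 G0). exists d. split; [easy|]. intros w Hw.
    apply Cmod_minus_eq_0. rewrite (Z w Hw). apply Cmod_0. }
  assert (P := Cmod_minus_pos _ _ N).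
  destruct (copen_closed_disc G w0 (Rmin d (Cmod (w0 - w1))) HG G0) as [r [Hr Hb]].
  { now apply Rmin_glb_lt. }
  assert (r1 : r < d) by (eapply Rlt_le_trans; [apply Hr|apply Rmin_l]).
  assert (r2 : r < Cmod (w0 - w1)) by (eapply Rlt_le_trans; [apply Hr|apply Rmin_r]).
  assert (X : forall n, exists b, Cmod (b - w0) = r /\
     Cmod (f n b - f n w1) <= 2 * Cmod (f n w0 - f n w1)).
  { intros n. apply (min_principle (fun w => f n w - f n w1)%C w0 r); [lra|].
    intros b Hbr. split.
    - apply cdiff_minus; [apply Hf; auto|apply cdiff_const].
    - apply Cminus_neq_0. intros Eb. apply Hinj in Eb; auto. subst b.
      rewrite (Cmod_minus_sym w1) in Hbr. lra. }
  destruct (choice _ X) as [b HX]. clear X.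
  destruct (ulim_exists U HU b (Cmod w0 + r)) as [c Hc].
  { apply ultra_all; [easy|]. intros n. destruct (HX n) as [E1 _].
    assert (T := Cmod_minus_ge (b n) w0). lra. }
  assert (Cr : Cmod (c - w0) = r).
  { assert (L : ulim U (fun n => b n - w0)%C (c - w0)%C).
    { apply (ulim_cont U HU (fun w => w - w0)%C); [|easy]. apply cdiff_ccont.
      apply cdiff_minus; [apply cdiff_id|apply cdiff_const]. }
    apply Rle_antisym.
    - apply (ulim_mod_le U HU _ _ _ L). apply ultra_all; [easy|]. intros n. right. apply HX.
    - apply (ulim_mod_ge U HU _ _ _ L). apply ultra_all; [easy|]. intros n. right. symmetry. apply HX. }
  assert (Gc : G c) by (apply Hb; lra).
  destruct (copen_closed_disc G c 1 HG Gc Rlt_0_1) as [rc [Hrc Hbc]].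
  assert (Lc : ulim U (fun n => f n (b n)) (H c)).
  { apply (ultralimit_eval U f b c (H c) rc K); auto; lra. }
  apply (Z c).
  - intros ->. rewrite Cmod_diag in Cr. lra.
  - lra.
  - rewrite E. replace (H c - H w1)%C with (RtoC 0); [easy|].
    symmetry. apply Cmod_eq_0. apply Rle_antisym; [|apply Cmod_ge_0].
    apply le_epsilon. intros e He.
    apply (ulim_le U HU (fun n => f n (b n)) (fun n => f n w1)); [easy|now apply HH|].
    apply (ultra_mono U HU) with (2 := ultra_and U HU _ _ (HH w0 G0 (e / 4) ltac:(lra))
      (HH w1 G1 (e / 4) ltac:(lra))).
    intros n [A1 A2]. destruct (HX n) as [_ B].
    replace (f n w0 - f n w1)%C with ((f n w0 - H w0) - (f n w1 - H w1))%C in B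
      by (rewrite E; ring).
    assert (T := Cmod_minus_le (f n w0 - H w0) (f n w1 - H w1)). lra.
Qed.

(** If [f q = f p], disjoint neighbourhoods of [p] and [q] both map onto a neighbourhood of the
    common value, so some nearby value has two preimages off [p]. *)
Lemma injective_on_puncture_filled (G : C -> Prop) (f : C -> C) (p : C) : copen G -> G p ->
  (forall w, G w -> cdiff f w) -> injective_on (fun w => G w /\ w <> p) f -> injective_on G f.
Proof.
  intros HG Hp Hf Hinj.
  assert (key : forall q, G q -> q <> p -> f q = f p -> False).
  { intros q Hq N E. assert (P := Cmod_minus_pos _ _ N).
    destruct (open_mapping G f p (Cmod (q - p) / 2) HG Hp ltac:(lra) Hf) as [m1 [Hm1 O1]].
    { now apply (injective_not_locally_constant G). }
    destruct (open_mapping G f q (Cmod (q - p) / 2) HG Hq ltac:(lra) Hf) as [m2 [Hm2 O2]].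
    (* The domain is cut down to a disc around [q] that avoids [p], where the injectivity hypothesis
       applies. *)
    { intros [d [Hd H]].
      apply (injective_not_locally_constant (fun w => Cmod (w - q) < Cmod (q - p) /\ G w) f q).
      - intros a [Ha Ga]. destruct (HG a Ga) as [d' [Hd' H']].
        exists (Rmin d' (Cmod (q - p) - Cmod (a - q))). split; [apply Rmin_glb_lt; lra|].
        intros w Hw. split.
        + assert (T := Cmod_minus_triangle w a q).
          assert (V := Rlt_le_trans _ _ _ Hw (Rmin_r _ _)). lra.
        + apply H'. eapply Rlt_le_trans; [exact Hw|apply Rmin_l].
      - rewrite Cmod_diag. easy.
      - intros u v [[Hu Gu] _] [[Hv Gv] _] Euv. apply Hinj; try easy; split; try easy; intros ->;
          rewrite Cmod_minus_sym in *; lra.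
      - now exists d. }
    (* A nonzero shift: the value [f p + t] differs from [f p], so neither preimage is [p]. *)
    set (t := Rmin m1 m2 / 2). assert (Pt : 0 < Rmin m1 m2) by now apply Rmin_glb_lt.
    assert (L1 := Rmin_l m1 m2). assert (L2 := Rmin_r m1 m2).
    assert (M : Cmod (f p + RtoC t - f p) = t).
    { replace (f p + RtoC t - f p)%C with (RtoC t) by ring. rewrite Cmod_R, Rabs_right; unfold t; lra. }
    destruct (O1 (f p + RtoC t)%C) as [u [Gu [Du Eu]]]; [rewrite M; unfold t; lra|].
    destruct (O2 (f p + RtoC t)%C) as [v [Gv [Dv Ev]]]; [rewrite E, M; unfold t; lra|].
    assert (Nu : u <> p).
    { intros ->. rewrite <- Eu, Cmod_diag in M. unfold t in M. lra. }
    assert (Nv : v <> p).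
    { intros ->. rewrite <- Ev, Cmod_diag in M. unfold t in M. lra. }
    assert (Euv : u = v) by (apply Hinj; [easy|easy|congruence]). subst v.
    assert (T := Cmod_minus_triangle q u p). rewrite (Cmod_minus_sym q u) in T. lra. }
  intros u v Gu Gv E. destruct (classic (u = p)) as [->|Nu]; destruct (classic (v = p)) as [->|Nv].
  - easy.
  - exfalso. now apply (key v).
  - exfalso. now apply (key u).
  - now apply Hinj.
Qed.

(** * Differentiability of inverse maps *)

Lemma cderiv_pow_shift (c w : C) (k : nat) :
  cderiv (fun w => (w - c) ^ S k)%C w (INR (S k) * (w - c) ^ k)%C.
Proof.
  assert (D1 : cderiv (fun w => w - c)%C w 1).
  { replace (RtoC 1) with (1 + 0)%C by ring.
    apply (cderiv_plus (fun w => w) (fun _ => - c)%C); [apply cderiv_id|apply cderiv_const]. }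
  induction k as [|k IH].
  - simpl. replace (1 * 1)%C with (1 * 1 + (w - c) * 0)%C by ring.
    apply (cderiv_mult (fun w => w - c)%C (fun _ => RtoC 1)); [easy|apply cderiv_const].
  - rewrite S_INR, RtoC_plus.
    replace ((INR (S k) + 1) * (w - c) ^ S k)%C
      with (1 * (w - c) ^ S k + (w - c) * (INR (S k) * (w - c) ^ k))%C by (simpl Cpow; ring).
    exact (cderiv_mult (fun w => w - c)%C (fun w => (w - c) ^ S k)%C w _ _ D1 IH).
Qed.

(** With [f - f p] equal to [(w - p) ^ S k * f1], the derivative is [(w - p) ^ k] times a factor
    close to [INR (S k) * f1 p]. *)
Lemma derivative_nonzero_near (G : C -> Prop) (f : C -> C) (p : C) : copen G -> G p ->
  (forall w, G w -> cdiff f w) -> ~ locally_constant_at f p ->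
  exists d, 0 < d /\ forall w, w <> p -> Cmod (w - p) < d -> exists l : C, l <> 0 /\ cderiv f w l.
Proof.
  intros HG Hp Hf N. destruct (copen_closed_disc G p 1 HG Hp Rlt_0_1) as [r [Hr Hball]].
  destruct (finite_order G (fun w => f w - f p)%C p r HG ltac:(lra) Hball) as [Z|[m [f1 [D [N1 E]]]]].
  { intros w Hw. apply cdiff_minus; [now apply Hf|apply cdiff_const]. }
  { exfalso. apply N. exists r. split; [lra|]. intros w Hw.
    apply Cmod_minus_eq_0. rewrite (Z w Hw). apply Cmod_0. }
  destruct m as [|k].
  { exfalso. apply N1. specialize (E p). simpl in E.
    replace (f1 p) with (1 * f1 p)%C by ring. rewrite <- E. ring. }
  destruct (bounded_on_disc f1 p r ltac:(lra)) as [K [PK HK]].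
  { intros b Hb. now apply cdiff_ccont, D, Hball. }
  destruct (nonzero_near f1 p) as [d1 [Hd1 Hnz]]; [now apply cdiff_ccont, D|easy|].
  apply Cmod_gt_0 in N1.
  (* A bound for the derivative of [f1] uniform over points near [p]. It keeps the term
     [(w - p) * l1] below [Cmod (f1 p) / 2], hence below [Cmod (f1 w)]. *)
  set (L := 4 * K / (r / 2)). assert (PL : 0 <= L) by (apply Rle_mult_inv_pos; lra).
  assert (P3 : 0 < Cmod (f1 p) / 2 / (L + 1)) by (apply Rdiv_lt_0_compat; lra).
  exists (Rmin (r / 2) (Rmin d1 (Cmod (f1 p) / 2 / (L + 1)))). split.
  { repeat apply Rmin_glb_lt; lra. }
  intros w Nw Hw.
  assert (V : Cmod (w - p) < r / 2 /\ Cmod (w - p) < d1 /\ Cmod (w - p) < Cmod (f1 p) / 2 / (L + 1)).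
  { repeat split; eapply Rlt_le_trans; try exact Hw; unfold Rmin; repeat destruct Rle_dec; lra. }
  destruct V as [V1 [V2 V3]]. specialize (Hnz w V2).
  destruct (taylor_disc f1 w (r / 2) K) as [l1 [B1 T1]].
  - lra.
  - intros b Hb. assert (T := Cmod_minus_triangle b w p). split; [apply D, Hball|apply HK]; lra.
  - fold L in B1.
    assert (D1 : cderiv f1 w l1).
    { apply (cderiv_of_quadratic_error f1 w l1 (r / 2 / 4) (32 * K / (r / 2) ^ 2)); [lra|].
      intros v _ Hv. now apply T1. }
    exists ((w - p) ^ k * (INR (S k) * f1 w + (w - p) * l1))%C. split.
    + apply Cmult_neq_0; [now apply Cpow_nz, Cminus_neq_0|].
      apply Cmod_gt_0.
      assert (A1 : Cmod (f1 w) <= Cmod (INR (S k) * f1 w)).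
      { rewrite Cmod_mult, Cmod_R, Rabs_right by (apply Rle_ge, pos_INR).
        rewrite <- (Rmult_1_l (Cmod (f1 w))) at 1. apply Rmult_le_compat_r; [apply Cmod_ge_0|].
        rewrite S_INR. assert (X := pos_INR k). lra. }
      assert (A2 : Cmod ((w - p) * l1) <= Cmod (f1 p) / 2).
      { rewrite Cmod_mult.
        apply Rle_trans with (Cmod (f1 p) / 2 / (L + 1) * (L + 1)).
        - apply Rmult_le_compat; try apply Cmod_ge_0; lra.
        - right. field. lra. }
      assert (T := Cmod_minus_ge (INR (S k) * f1 w) (- ((w - p) * l1))).
      rewrite Cmod_opp in T.
      replace (INR (S k) * f1 w - - ((w - p) * l1))%C with (INR (S k) * f1 w + (w - p) * l1)%C in T by ring.
      lra.
    + assert (Q := cderiv_plus _ _ _ _ _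
        (cderiv_mult _ _ _ _ _ (cderiv_pow_shift p w k) D1) (cderiv_const (f p) w)).
      cbv beta in Q.
      replace (INR (S k) * (w - p) ^ k * f1 w + (w - p) ^ S k * l1 + 0)%C
        with ((w - p) ^ k * (INR (S k) * f1 w + (w - p) * l1))%C in Q by (simpl Cpow; ring).
      apply (cderiv_local _ f w _ 1 Rlt_0_1) with (2 := Q).
      intros v _. rewrite <- E. ring.
Qed.

Lemma cderiv_inverse (f g : C -> C) (v l : C) : cderiv f (g v) l -> l <> 0 -> ccont g v ->
  (exists d, 0 < d /\ forall u, Cmod (u - v) < d -> f (g u) = u) -> cderiv g v (/ l).
Proof.
  intros Hf Nl Hg [d0 [Hd0 Hinv]] e He.
  assert (Ev : f (g v) = v) by (apply Hinv; rewrite Cmod_diag; easy).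
  assert (Pl := Nl). apply Cmod_gt_0 in Pl. set (L := Cmod l) in *.
  (* The first bound makes [g] Lipschitz at [v] with constant [2 / L]; the second is then what the
     error [e] requires. *)
  set (e1 := Rmin (L / 2) (e * L * L / 2)).
  assert (Pe1 : 0 < e1).
  { apply Rmin_glb_lt; [lra|]. apply Rdiv_lt_0_compat; [|lra]. repeat apply Rmult_lt_0_compat; easy. }
  assert (E1 : e1 <= L / 2) by apply Rmin_l. assert (E2 : e1 <= e * L * L / 2) by apply Rmin_r.
  destruct (Hf e1 Pe1) as [d1 [Hd1 H1]]. destruct (Hg d1 Hd1) as [d2 [Hd2 H2]].
  exists (Rmin d0 d2). split; [now apply Rmin_glb_lt|]. intros u Hu.
  specialize (Hinv u (Rlt_le_trans _ _ _ Hu (Rmin_l _ _))).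
  specialize (H2 u (Rlt_le_trans _ _ _ Hu (Rmin_r _ _))).
  specialize (H1 (g u) H2). rewrite Hinv, Ev in H1.
  set (D := Cmod (g u - g v)) in *. assert (PD : 0 <= D) by apply Cmod_ge_0.
  assert (A : L * D <= Cmod (u - v) + e1 * D).
  { unfold L, D at 1. rewrite <- Cmod_mult.
    replace (l * (g u - g v))%C with ((u - v) - (u - v - l * (g u - g v)))%C by ring.
    eapply Rle_trans; [apply Cmod_minus_le|]. lra. }
  assert (A' : L / 2 * D <= Cmod (u - v)) by nra.
  replace (g u - g v - / l * (u - v))%C with (- / l * (u - v - l * (g u - g v)))%C by (field; easy).
  rewrite Cmod_mult, Cmod_opp, Cmod_inv by easy. fold L.
  apply Rmult_le_reg_l with L; [easy|]. rewrite <- Rmult_assoc, Rinv_r, Rmult_1_l by lra.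
  eapply Rle_trans; [exact H1|].
  apply Rle_trans with (e * L * L / 2 * D); [apply Rmult_le_compat_r; easy|].
  replace (e * L * L / 2 * D) with (e * L * (L / 2 * D)) by field.
  replace (L * (e * Cmod (u - v))) with (e * L * Cmod (u - v)) by ring.
  apply Rmult_le_compat_l; [nra|easy].
Qed.

(* Critical points of f are isolated, so the continuous inverse is differentiable off
   isolated points, which are removable. *)
Lemma inverse_cdiff (G : C -> Prop) (f g : C -> C) (s : R) : copen G ->
  (forall w, G w -> cdiff f w) -> injective_on G f ->
  (forall v, Cmod v < s -> G (g v) /\ f (g v) = v) ->
  forall v, Cmod v < s -> cdiff g v.
Proof.
  intros HG Hf Hinj Hg.
  assert (nlc : forall a, G a -> ~ locally_constant_at f a).
  { intros a Ha. apply (injective_not_locally_constant G); auto.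
    intros x y [Gx _] [Gy _]. now apply Hinj. }
  assert (near : forall v, Cmod v < s -> forall u, Cmod (u - v) < s - Cmod v -> Cmod u < s).
  { intros v Hv u Hu. assert (T := Cmod_minus_ge u v). lra. }
  assert (cont : forall v, Cmod v < s -> ccont g v).
  { intros v Hv e He. destruct (Hg v Hv) as [Gv Ev].
    destruct (open_mapping G f (g v) e HG Gv He Hf (nlc _ Gv)) as [m [Hm O]].
    rewrite Ev in O. exists (Rmin m (s - Cmod v)). split; [apply Rmin_glb_lt; lra|].
    intros u Hu. destruct (O u (Rlt_le_trans _ _ _ Hu (Rmin_l _ _))) as [w [Gw [Dw Ew]]].
    destruct (Hg u (near v Hv u (Rlt_le_trans _ _ _ Hu (Rmin_r _ _)))) as [Gu Eu].
    replace (g u) with w; [easy|]. apply Hinj; congruence. }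
  intros v Hv. destruct (Hg v Hv) as [Gv Ev].
  destruct (derivative_nonzero_near G f (g v) HG Gv Hf (nlc _ Gv)) as [d [Hd Hder]].
  destruct (cont v Hv d Hd) as [d' [Hd' Hc]].
  set (R0 := Rmin d' (s - Cmod v) / 2).
  assert (PR : 0 < Rmin d' (s - Cmod v)) by (apply Rmin_glb_lt; lra).
  assert (L1 := Rmin_l d' (s - Cmod v)). assert (L2 := Rmin_r d' (s - Cmod v)).
  apply (removable_continuous g v R0); [unfold R0; lra| |now apply cont].
  intros u Hu Nu. assert (Hus : Cmod u < s) by (apply (near v Hv); unfold R0 in Hu; lra).
  destruct (Hg u Hus) as [Gu Eu].
  destruct (Hder (g u)) as [l [Nl Hl]].
  - intros X. apply Nu. congruence.
  - apply Hc. unfold R0 in Hu. lra.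
  - exists (/ l)%C. apply (cderiv_inverse f g u l Hl Nl (cont u Hus)).
    exists (s - Cmod u). split; [lra|]. intros x Hx. apply Hg. now apply (near u Hus).
Qed.

(** * The Schwarz-Pick inequality *)

Lemma pseudo_hyperbolic_identity (a b : C) :
  Cmod (1 - Cconj a * b) ^ 2 - Cmod (b - a) ^ 2 = (1 - Cmod a ^ 2) * (1 - Cmod b ^ 2).
Proof. rewrite !Cmod2_alt. destruct a, b. unfold Re, Im. simpl. ring. Qed.

Lemma one_minus_conj_pos (a b : C) : Cmod a < 1 -> Cmod b <= 1 ->
  1 - Cmod a <= Cmod (1 - Cconj a * b).
Proof.
  intros Ha Hb. assert (T := Cmod_minus_ge 1 (Cconj a * b)).
  rewrite Cmod_1, Cmod_mult, Cmod_conj in T.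
  assert (X := Cmod_ge_0 a). nra.
Qed.

Lemma pseudo_hyperbolic_le (a b : C) : Cmod a < 1 -> Cmod b <= 1 ->
  Cmod (b - a) <= Cmod (1 - Cconj a * b).
Proof.
  intros Ha Hb. assert (E := pseudo_hyperbolic_identity a b).
  assert (X := Cmod_ge_0 a). assert (Y := Cmod_ge_0 b).
  assert (X1 := Cmod_ge_0 (b - a)). assert (Y1 := Cmod_ge_0 (1 - Cconj a * b)).
  assert (P : 0 <= (1 - Cmod a ^ 2) * (1 - Cmod b ^ 2)) by (apply Rmult_le_pos; nra).
  rewrite <- E in P. apply Rnot_lt_le. intros L. nra.
Qed.

(** For [b] on the unit circle the two moduli are equal, which a ratio [q < 1] forbids. This keeps
    limits of preimages off the boundary. *)
Lemma pseudo_hyperbolic_strict (a b : C) (q : R) : Cmod a < 1 -> Cmod b <= 1 -> q < 1 ->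
  Cmod (b - a) <= q * Cmod (1 - Cconj a * b) -> Cmod b < 1.
Proof.
  intros Ha Hb Hq H. destruct (Rle_lt_or_eq_dec _ _ Hb) as [|E]; [easy|exfalso].
  assert (I := pseudo_hyperbolic_identity a b). rewrite E in I.
  assert (P := one_minus_conj_pos a b Ha Hb).
  assert (X1 := Cmod_ge_0 (b - a)).
  set (x := Cmod (1 - Cconj a * b)) in *. set (y := Cmod (b - a)) in *.
  replace ((1 - Cmod a ^ 2) * (1 - 1 ^ 2)) with 0 in I by ring.
  assert (x = y) by nra. nra.
Qed.

(** Schwarz's lemma for [k] followed by the disc automorphism moving [k 0] to 0. The smaller radius
    [s'] provides a closed disc inside the domain. *)
Lemma schwarz_pick (k : C -> C) (s s' : R) : 0 < s' < s ->
  (forall v, Cmod v < s -> cdiff k v /\ Cmod (k v) <= 1) -> Cmod (k 0) < 1 ->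
  forall v, Cmod v < s' ->
    Cmod (k v - k 0) <= Cmod v / s' * Cmod (1 - Cconj (k 0) * k v).
Proof.
  intros Hs Hk H0 v Hv.
  destruct (classic (v = 0)) as [->|Nv].
  { rewrite Cmod_diag, Cmod_0. unfold Rdiv. rewrite !Rmult_0_l. lra. }
  set (a := k 0) in *.
  assert (den : forall w, Cmod w < s -> (1 - Cconj a * k w)%C <> 0).
  { intros w Hw. apply Cmod_gt_0.
    assert (P := one_minus_conj_pos a (k w) H0 (proj2 (Hk w Hw))). lra. }
  set (F := fun w => ((k w - a) / (1 - Cconj a * k w) / w)%C).
  assert (m0 : forall w, Cmod (w - 0) = Cmod w) by (intros w; f_equal; ring).
  destruct (Hk 0) as [[l Hl] _]; [rewrite Cmod_0; lra|].
  destruct (cderiv_lipschitz k 0 l Hl) as [d [Hd Lip]]. fold a in Lip.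
  assert (Pl := Cmod_ge_0 l).
  assert (mF : forall w, Cmod w < s -> w <> 0 ->
    Cmod (F w) = Cmod (k w - a) / Cmod (1 - Cconj a * k w) / Cmod w).
  { intros w Hw Nw. unfold F. rewrite !Cmod_div; auto. }
  assert (X : Cmod (F v) <= / s').
  (* Both exceptional points are 0. The [Rmax] merges a Lipschitz bound near 0 with the bound [/ d]
     away from it. *)
  { apply (max_principle_punctured F 0 0 0 s' (/ s')
      (Rmax ((Cmod l + 1) / (1 - Cmod a)) (/ d))).
    - lra.
    - left. apply Rinv_0_lt_compat. lra.
    - rewrite m0, Cmod_0. lra.
    - rewrite m0, Cmod_0. lra.
    - intros w Hw Nw _. rewrite m0 in Hw. destruct (Hk w ltac:(lra)) as [Dk _].
      unfold F. apply cdiff_div; [apply cdiff_div|apply cdiff_id|easy].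
      + apply cdiff_minus; [easy|apply cdiff_const].
      + apply cdiff_minus; [apply cdiff_const|]. apply cdiff_mult; [apply cdiff_const|easy].
      + apply den. lra.
    - intros w Hw Nw _. rewrite m0 in Hw. rewrite mF by (easy || lra).
      assert (P := one_minus_conj_pos a (k w) H0 (proj2 (Hk w ltac:(lra)))).
      assert (Q := pseudo_hyperbolic_le a (k w) H0 (proj2 (Hk w ltac:(lra)))).
      assert (Pw := Nw). apply Cmod_gt_0 in Pw.
      destruct (Rlt_le_dec (Cmod w) d) as [L|L].
      + eapply Rle_trans; [|apply Rmax_l]. specialize (Lip w). rewrite m0 in Lip. specialize (Lip L).
        apply Rmult_le_reg_r with (Cmod w); [easy|].
        unfold Rdiv at 1. rewrite Rmult_assoc, Rinv_l, Rmult_1_r by lra.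
        replace ((Cmod l + 1) / (1 - Cmod a) * Cmod w) with ((Cmod l + 1) * Cmod w / (1 - Cmod a))
          by (field; lra).
        unfold Rdiv. apply Rmult_le_compat; [apply Cmod_ge_0| |easy|].
        * left. apply Rinv_0_lt_compat. lra.
        * apply Rinv_le_contravar; lra.
      + eapply Rle_trans; [|apply Rmax_r].
        rewrite <- (Rmult_1_l (/ d)). unfold Rdiv at 1. apply Rmult_le_compat.
        * apply Rle_mult_inv_pos; [apply Cmod_ge_0|lra].
        * left. now apply Rinv_0_lt_compat.
        * apply Rmult_le_reg_r with (Cmod (1 - Cconj a * k w)); [lra|].
          unfold Rdiv. rewrite Rmult_assoc, Rinv_l; lra.
        * now apply Rinv_le_contravar.
    - intros w Hw. rewrite m0 in Hw.
      assert (Nw : w <> 0) by (apply Cmod_gt_0; lra).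
      rewrite mF by (easy || lra). rewrite Hw.
      assert (P := one_minus_conj_pos a (k w) H0 (proj2 (Hk w ltac:(lra)))).
      assert (Q := pseudo_hyperbolic_le a (k w) H0 (proj2 (Hk w ltac:(lra)))).
      rewrite <- (Rmult_1_l (/ s')). unfold Rdiv at 1. apply Rmult_le_compat_r.
      + left. apply Rinv_0_lt_compat. lra.
      + apply Rmult_le_reg_r with (Cmod (1 - Cconj a * k w)); [lra|].
        unfold Rdiv. rewrite Rmult_assoc, Rinv_l; lra.
    - rewrite m0. lra.
    - easy.
    - easy. }
  rewrite mF in X by (easy || lra).
  assert (P := one_minus_conj_pos a (k v) H0 (proj2 (Hk v ltac:(lra)))).
  apply Cmod_gt_0 in Nv.
  apply Rmult_le_compat_r with (r := Cmod v * Cmod (1 - Cconj a * k v)) in X.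
  2:{ apply Rmult_le_pos; lra. }
  replace (Cmod (k v - a) / Cmod (1 - Cconj a * k v) / Cmod v * (Cmod v * Cmod (1 - Cconj a * k v)))
    with (Cmod (k v - a)) in X by (field; split; lra).
  eapply Rle_trans; [exact X|]. right. field. lra.
Qed.

(** * Extremal functions on the annulus *)

(** The closed disc, unlike the open one, is stable under pointwise limits. *)
Definition into_closed_disc (G : C -> Prop) (f : C -> C) : Prop :=
  forall w, G w -> cdiff f w /\ Cmod (f w) <= 1.

Definition extremal_bound (G : C -> Prop) (z p : C) (M : R) : Prop :=
  forall f, into_closed_disc G f -> f z = 0 -> Cmod (f p) <= M.

(** The parallelogram law bounds the squared modulus of the mean by [1 - Cmod (a - b) ^ 2 / 4], and
    [sqrt (1 - u) <= 1 - u / 2]. *)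
Lemma parallelogram_bound (a b : C) : Cmod a <= 1 -> Cmod b <= 1 ->
  Cmod ((a + b) / 2) + Cmod (a - b) ^ 2 / 8 <= 1.
Proof.
  intros Ha Hb.
  assert (E : Cmod (a + b) ^ 2 + Cmod (a - b) ^ 2 = 2 * Cmod a ^ 2 + 2 * Cmod b ^ 2).
  { rewrite !Cmod2_alt. destruct a, b. unfold Re, Im. simpl. ring. }
  assert (N2 : RtoC 2 <> 0) by (intros X; apply RtoC_inj in X; lra).
  rewrite Cmod_div, Cmod_R, Rabs_right by (easy || lra).
  assert (A1 := Cmod_ge_0 a). assert (B1 := Cmod_ge_0 b). assert (X1 := Cmod_ge_0 (a + b)).
  set (x := Cmod (a + b)) in *. set (d := Cmod (a - b) ^ 2) in *.
  assert (Hd : 0 <= d) by apply pow2_ge_0.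
  assert (x ^ 2 + d <= 4) by nra.
  apply Rnot_lt_le. intros L.
  assert (1 - d / 8 < x / 2) by lra. assert (0 <= 1 - d / 8) by nra.
  assert ((1 - d / 8) ^ 2 < (x / 2) ^ 2) by nra.
  nra.
Qed.

(* If two extremal functions differ, their mean [k] and difference [d] satisfy
   [|k| + |d|^2 / 8 <= 1]; dividing [d^2] by its zero at [p] leaves room near [p]
   to push the value of [k] at [p] beyond the extremal one. *)
Lemma extremal_unique (r M : R) (z p : C) (f g : C -> C) : 0 < r -> 0 <= M ->
  annulus r p -> annulus r z -> z <> p -> extremal_bound (annulus r) z p M ->
  into_closed_disc (annulus r) f -> into_closed_disc (annulus r) g ->
  f z = 0 -> g z = 0 -> f p = RtoC M -> g p = RtoC M ->
  forall w, annulus r w -> f w = g w.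
Proof.
  intros Hr PM Hp Hz Nzp Hext Hf Hg fz gz fp gp.
  destruct (copen_closed_disc _ p 1 (annulus_open r) Hp Rlt_0_1) as [rho [Hrho Hball]].
  set (d := fun w => (f w - g w)%C).
  assert (Dd : forall w, annulus r w -> cdiff d w).
  { intros w Hw. apply cdiff_minus; [now apply Hf|now apply Hg]. }
  destruct (finite_order _ d p rho (annulus_open r) ltac:(lra) Hball Dd) as [Z|[m [d1 [D1 [N1 E1]]]]].
  { intros w Hw. apply Cmod_minus_eq_0.
    change (Cmod (d w) = 0). rewrite (annulus_identity r d p Hr Dd Hp); [apply Cmod_0| |easy].
    exists rho. split; [lra|easy]. }
  exfalso. assert (P1 := N1). apply Cmod_gt_0 in P1. set (q := Cmod (d1 p)) in *.
  assert (Nq : RtoC q <> 0) by (intros X; apply RtoC_inj in X; lra).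
  (* The rotation makes the correction at [p] positive, so that it adds to [M]. *)
  set (tau := (Cconj (d1 p) / q)%C).
  assert (Mt : Cmod tau = 1).
  { unfold tau. rewrite Cmod_div by easy. rewrite Cmod_conj, Cmod_R, Rabs_right by lra.
    fold q. field. lra. }
  assert (Tp : (tau * d1 p)%C = RtoC q).
  { unfold tau. replace (Cconj (d1 p) / q * d1 p)%C with (d1 p * Cconj (d1 p) / q)%C by (field; easy).
    rewrite <- Cmod2_conj. fold q. rewrite RtoC_pow. field; easy. }
  (* Outside the [rho]-disc this gives [c * Cmod (d1 w) ^ 2 <= Cmod (d w) ^ 2 / 8], the room left by
     [parallelogram_bound]. *)
  set (c := (rho ^ m) ^ 2 / 8).
  assert (Pc : 0 < c).
  { unfold c. apply Rdiv_lt_0_compat; [|lra]. apply pow_lt, pow_lt. lra. }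
  set (h := fun w => ((f w + g w) / 2 + c * (tau * d1 w) ^ 2)%C).
  assert (N2 : RtoC 2 <> 0) by (intros X; apply RtoC_inj in X; lra).
  assert (Dh : forall w, annulus r w -> cdiff h w).
  { intros w Hw. apply cdiff_plus.
    - apply cdiff_div; [|apply cdiff_const|easy]. apply cdiff_plus; [now apply Hf|now apply Hg].
    - apply cdiff_mult; [apply cdiff_const|]. apply cdiff_pow.
      apply cdiff_mult; [apply cdiff_const|now apply D1]. }
  assert (far : forall w, annulus r w -> rho <= Cmod (w - p) -> Cmod (h w) <= 1).
  { intros w Hw Hfar.
    eapply Rle_trans; [|apply (parallelogram_bound (f w) (g w)); [now apply Hf|now apply Hg]].
    unfold h. eapply Rle_trans; [apply Cmod_triangle|]. apply Rplus_le_compat_l.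
    change (f w - g w)%C with (d w). rewrite E1.
    rewrite !Cmod_mult, !Cmod_pow, Cmod_mult, Mt, Rmult_1_l, Cmod_R, Rabs_right by lra.
    rewrite Rpow_mult_distr. unfold c.
    assert ((rho ^ m) ^ 2 <= (Cmod (w - p) ^ m) ^ 2).
    { apply pow_incr. split; [apply pow_le; lra|]. apply pow_incr. lra. }
    assert (X := pow2_ge_0 (Cmod (d1 w))). nra. }
  (* Inside the disc the direct comparison fails, but the maximum principle carries over the bound
     from its circle. *)
  assert (near : forall w, Cmod (w - p) <= rho -> Cmod (h w) <= 1).
  { apply (max_principle h p rho 1); try lra.
    - intros b Hb. now apply cdiff_ccont, Dh, Hball.
    - intros b Hb. right. exists (rho - Cmod (b - p)). split; [lra|]. intros w Hw.
      apply Dh, Hball. assert (T := Cmod_minus_triangle w b p). lra.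
    - intros b Hb. apply far; [apply Hball|]; lra. }
  assert (hz : h z = 0).
  { assert (dz : d1 z = 0).
    { apply NNPP. intros N. apply (Cmult_neq_0 ((z - p) ^ m) (d1 z)); [|easy|].
      - now apply Cpow_nz, Cminus_neq_0.
      - rewrite <- E1. unfold d. rewrite fz, gz. ring. }
    unfold h. rewrite dz, fz, gz. field; easy. }
  assert (hp : h p = RtoC (M + c * q ^ 2)).
  { unfold h. rewrite Tp, fp, gp, RtoC_plus, RtoC_mult, RtoC_pow. field; easy. }
  assert (B : Cmod (h p) <= M).
  { apply Hext; [|easy]. intros w Hw. split; [now apply Dh|].
    destruct (Rle_dec (Cmod (w - p)) rho) as [L|L]; [now apply near|apply far; [easy|lra]]. }
  assert (0 < c * q ^ 2) by (apply Rmult_lt_0_compat; [|apply pow_lt]; easy).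
  rewrite hp, Cmod_R, Rabs_right in B by lra. lra.
Qed.

(** * Symmetry under complex conjugation *)

Lemma annulus_conj (r : R) (w : C) : annulus r w -> annulus r (Cconj w).
Proof. unfold annulus. now rewrite Cmod_conj. Qed.

Lemma Cconj_RtoC (x : R) : Cconj (RtoC x) = RtoC x.
Proof. apply injective_projections; simpl; ring. Qed.

Lemma Cconj_fixed (w : C) : Cconj w = w -> w = RtoC (fst w).
Proof.
  intros E. destruct w as [x y]. apply (f_equal snd) in E. simpl in E.
  apply injective_projections; simpl; lra.
Qed.

(** Because [z], [p] and [M] are real, the reflected map [Cconj (f (Cconj w))] solves the same
    extremal problem. *)
Lemma extremal_symmetric (r M z p : R) (f : C -> C) : 0 < r -> 0 <= M ->
  annulus r p -> annulus r z -> z <> p -> extremal_bound (annulus r) z p M ->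
  into_closed_disc (annulus r) f -> f z = 0 -> f p = RtoC M ->
  forall w, annulus r w -> f (Cconj w) = Cconj (f w).
Proof.
  intros Hr PM Hp Hz Nzp Hext Hf fz fp w Hw.
  rewrite <- (Cconj_conj (f (Cconj w))). f_equal. symmetry.
  apply (extremal_unique r M z p f (fun w => Cconj (f (Cconj w)))); auto.
  - intros X. now apply RtoC_inj in X.
  - intros v Hv. split.
    + apply cdiff_conj, Hf. now apply annulus_conj.
    + rewrite Cmod_conj. apply Hf. now apply annulus_conj.
  - rewrite Cconj_RtoC, fz. apply Cconj_RtoC.
  - rewrite Cconj_RtoC, fp. apply Cconj_RtoC.
Qed.

(* The preimages of [0, M) under a symmetric map are real, so they stay in (r, 1)
   once they start at z; but those of values close to M must be close to p < 0. *)
Lemma symmetric_injective_absurd (r M z p : R) (f : C -> C) : 0 < r -> 0 < M ->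
  r < z < 1 -> annulus r p -> p < 0 ->
  (forall w, annulus r w -> cdiff f w) -> injective_on (annulus r) f ->
  (forall w, annulus r w -> f (Cconj w) = Cconj (f w)) ->
  f z = 0 -> f p = RtoC M ->
  (forall v, Cmod v < M -> image_of (annulus r) f v) -> False.
Proof.
  intros Hr PM Hz Hp Np Hf Hinj Hsym fz fp Hsurj.
  assert (HG := annulus_open r).
  assert (nlc : forall a, annulus r a -> ~ locally_constant_at f a).
  { intros a Ha. apply (injective_not_locally_constant (annulus r)); auto.
    intros x y [Gx _] [Gy _]. now apply Hinj. }
  assert (real_pre : forall w (t : R), annulus r w -> f w = RtoC t -> w = RtoC (fst w)).
  { intros w t Hw E. apply Cconj_fixed. apply Hinj; [now apply annulus_conj|easy|].
    rewrite Hsym, E by easy. apply Cconj_RtoC. }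
  assert (pos : forall t1, 0 <= t1 < M -> exists x : R, 0 < x /\ annulus r x /\ f x = RtoC t1).
  { intros t1 Ht1.
    apply (locally_constant_interval (fun t => exists x : R, 0 < x /\ annulus r x /\ f x = RtoC t) t1);
      [| |lra].
    - exists z. split; [lra|]. split; [|easy]. unfold annulus. rewrite Cmod_R, Rabs_right; lra.
    - intros t Ht. destruct (Hsurj t) as [w [Hw Ew]].
      { rewrite Cmod_R, Rabs_right; lra. }
      assert (Rw := real_pre w t Hw Ew). set (x := fst w) in *. rewrite Rw in Hw, Ew. clear Rw.
      assert (Ax : r < Rabs x < 1) by (unfold annulus in Hw; now rewrite Cmod_R in Hw).
      (* Nearby values have preimages within [r] of [x]; as [Rabs x > r], these keep the sign of
         [x]. *)
      destruct (open_mapping _ f x r HG Hw Hr Hf (nlc _ Hw)) as [m [Hm O]].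
      rewrite Ew in O. exists m. split; [easy|].
      assert (iff : forall s : R, Rabs (s - t) < m ->
        ((exists y : R, 0 < y /\ annulus r y /\ f y = RtoC s) <-> 0 < x)).
      { intros s Hs. destruct (O s) as [v [Hv [Dv Ev]]].
        { rewrite <- RtoC_minus, Cmod_R. easy. }
        assert (Rv := real_pre v s Hv Ev). set (y := fst v) in *. rewrite Rv in Hv, Dv, Ev. clear Rv.
        rewrite <- RtoC_minus, Cmod_R in Dv. apply Rabs_lt_between in Dv.
        split.
        - intros [y' [Py [Hy Ey]]].
          assert (E : RtoC y' = RtoC y) by (apply Hinj; congruence). apply RtoC_inj in E. subst y'.
          unfold Rabs in Ax. destruct Rcase_abs in Ax; lra.
        - intros Px. exists y. split; [|easy]. rewrite Rabs_right in Ax; lra. }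
      intros s _ Hs. rewrite (iff s Hs). rewrite (iff t); [easy|].
      rewrite Rminus_diag, Rabs_R0. easy. }
  (* Values near [M] have their preimages within [- p] of [p], which no positive real is. *)
  destruct (open_mapping _ f p (- p) HG Hp ltac:(lra) Hf (nlc _ Hp)) as [m [Hm O]].
  rewrite fp in O.
  assert (L1 := Rmax_l 0 (M - m / 2)). assert (L2 := Rmax_r 0 (M - m / 2)).
  assert (L3 : Rmax 0 (M - m / 2) < M) by (apply Rmax_lub_lt; lra).
  set (t := Rmax 0 (M - m / 2)) in *.
  destruct (pos t ltac:(lra)) as [x [Px [Hx Ex]]].
  destruct (O t) as [w [Hw [Dw Ew]]].
  { rewrite <- RtoC_minus, Cmod_R, Rabs_left; lra. }
  assert (E : w = RtoC x) by (apply Hinj; congruence). subst w.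
  rewrite <- RtoC_minus, Cmod_R, Rabs_right in Dw; lra.
Qed.

(** * Limits of maps whose images contain large discs *)

(* Schwarz-Pick for g and r / g, where g is the inverse of f on the disc of radius s:
   these bounds, uniform in f, keep w away from both boundary circles. *)
Lemma preimage_schwarz_pick (r z s s' : R) (f : C -> C) (v w : C) : 0 < r ->
  r < z < 1 -> (forall w, annulus r w -> cdiff f w) -> injective_on (annulus r) f ->
  f z = 0 -> (forall y, Cmod y < s -> image_of (annulus r) f y) ->
  Cmod v < s' < s -> annulus r w -> f w = v ->
  Cmod (w - z) <= Cmod v / s' * Cmod (1 - Cconj z * w) /\
  Cmod (r / w - r / z) <= Cmod v / s' * Cmod (1 - Cconj (r / z) * (r / w)).
Proof.
  intros Hr Hz Hf Hinj fz Hsurj Hv Hw Ew.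
  assert (Pv := Cmod_ge_0 v).
  assert (ch : forall y, exists x, Cmod y < s -> annulus r x /\ f x = y).
  { intros y. destruct (classic (Cmod y < s)) as [L|L].
    - destruct (Hsurj y L) as [x Hx]. now exists x.
    - exists 0%C. easy. }
  destruct (choice _ ch) as [g Hg]. clear ch.
  assert (Dg := inverse_cdiff (annulus r) f g s (annulus_open r) Hf Hinj Hg).
  assert (Az : annulus r z) by (unfold annulus; rewrite Cmod_R, Rabs_right; lra).
  assert (M0 : Cmod 0 < s) by (rewrite Cmod_0; lra).
  assert (g0 : g 0 = z) by (destruct (Hg 0 M0); apply Hinj; congruence).
  assert (gv : g v = w) by (destruct (Hg v ltac:(lra)); apply Hinj; congruence).
  assert (nz : forall u, annulus r u -> u <> 0) by (intros u [Hu _]; apply Cmod_gt_0; lra).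
  rewrite <- gv, <- g0. split.
  - apply (schwarz_pick g s s').
    + lra.
    + intros u Hu. split; [now apply Dg|]. destruct (Hg u Hu) as [[_ X] _]. lra.
    + rewrite g0, Cmod_R, Rabs_right; lra.
    + easy.
  - apply (schwarz_pick (fun u => r / g u)%C s s').
    + lra.
    + intros u Hu. destruct (Hg u Hu) as [[X Y] _]. split.
      * apply cdiff_div; [apply cdiff_const|now apply Dg|]. apply Cmod_gt_0. lra.
      * rewrite Cmod_div by (apply Cmod_gt_0; lra). rewrite Cmod_R, Rabs_right by lra.
        apply Rmult_le_reg_r with (Cmod (g u)); [lra|].
        unfold Rdiv. rewrite Rmult_assoc, Rinv_l; lra.
    + rewrite g0, <- RtoC_div by lra. rewrite Cmod_R, Rabs_right.
      * apply Rmult_lt_reg_r with z; [lra|]. unfold Rdiv. rewrite Rmult_assoc, Rinv_l; lra.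
      * apply Rle_ge, Rle_mult_inv_pos; lra.
    + easy.
Qed.

Lemma ulim_mod_compare (U : (nat -> Prop) -> Prop) (x y : nat -> C) (a b : C) (q : R) :
  ultrafilter U -> 0 <= q -> ulim U x a -> ulim U y b ->
  U (fun n => Cmod (x n) <= q * Cmod (y n)) -> Cmod a <= q * Cmod b.
Proof.
  intros HU Hq Hx Hy H. apply le_epsilon. intros e He.
  assert (P : 0 < e / 2 / (q + 1)) by (apply Rdiv_lt_0_compat; lra).
  destruct (ultra_ex U HU _ (ultra_and U HU _ _ H
    (ultra_and U HU _ _ (Hx (e / 2) ltac:(lra)) (Hy _ P)))) as [n [A [B D]]].
  assert (T1 := Cmod_minus_ge a (x n)). rewrite Cmod_minus_sym in T1.
  assert (T2 := Cmod_minus_ge (y n) b).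
  assert (q * Cmod (y n) <= q * (Cmod b + e / 2 / (q + 1))) by (apply Rmult_le_compat_l; lra).
  assert ((q + 1) * (e / 2 / (q + 1)) = e / 2) by (field; lra). nra.
Qed.

(** Preimages of [v] under the [f n] converge to some [c], a priori only in the closed annulus. The
    two Schwarz-Pick bounds persist in the limit and give [Cmod c < 1] and [Cmod (r / c) < 1]. *)
Lemma ultralimit_surjective (U : (nat -> Prop) -> Prop) (r z M : R) (f : nat -> C -> C)
  (h : C -> C) : ultrafilter U -> 0 < r -> r < z < 1 ->
  (forall n, into_closed_disc (annulus r) (f n)) ->
  (forall n, injective_on (annulus r) (f n)) -> (forall n, f n z = 0) ->
  (forall w, annulus r w -> ulim U (fun n => f n w) (h w)) ->
  (forall s, s < M -> U (fun n => forall y, Cmod y < s -> image_of (annulus r) (f n) y)) ->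
  forall v, Cmod v < M -> image_of (annulus r) h v.
Proof.
  intros HU Hr Hz Hf Hinj fz Hh Hsurj v Hv. assert (Pv := Cmod_ge_0 v).
  assert (Az : annulus r z) by (unfold annulus; rewrite Cmod_R, Rabs_right; lra).
  (* Strict gaps between [Cmod v], [s'], [s] and [M] keep [q] below 1 uniformly in [n]. *)
  set (s' := (Cmod v + M) / 2). set (s := (s' + M) / 2).
  assert (Hs : Cmod v < s' < s) by (unfold s, s'; lra).
  (* Where [v] has no preimage the default is [z]; almost all indices do have one. *)
  assert (ch : forall n, exists w, annulus r w /\ (image_of (annulus r) (f n) v -> f n w = v)).
  { intros n. destruct (classic (image_of (annulus r) (f n) v)) as [[w Hw]|N].
    - exists w. easy.
    - now exists z. }
  destruct (choice _ ch) as [w Hw]. clear ch.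
  destruct (ulim_exists U HU w 1) as [c Hc].
  { apply ultra_all; [easy|]. intros n. destruct (Hw n) as [[_ X] _]. lra. }
  assert (c1 : Cmod c <= 1).
  { apply (ulim_mod_le U HU w); [easy|]. apply ultra_all; [easy|].
    intros n. destruct (Hw n) as [[_ X] _]. lra. }
  assert (cr : r <= Cmod c).
  { apply (ulim_mod_ge U HU w); [easy|]. apply ultra_all; [easy|].
    intros n. destruct (Hw n) as [[X _] _]. lra. }
  assert (Nc : c <> 0) by (apply Cmod_gt_0; lra).
  set (q := Cmod v / s').
  assert (Hq : 0 <= q < 1).
  { unfold q. split; [apply Rle_mult_inv_pos; lra|].
    apply Rmult_lt_reg_r with s'; [lra|]. unfold Rdiv. rewrite Rmult_assoc, Rinv_l; lra. }
  assert (Hsv : U (fun n => f n (w n) = v /\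
    Cmod (w n - z) <= q * Cmod (1 - Cconj z * w n) /\
    Cmod (r / w n - r / z) <= q * Cmod (1 - Cconj (r / z) * (r / w n)))).
  { apply (ultra_mono U HU) with (2 := Hsurj s ltac:(unfold s, s'; lra)).
    intros n Hn. destruct (Hw n) as [Aw Ew]. specialize (Ew (Hn v ltac:(lra))).
    split; [easy|].
    apply (preimage_schwarz_pick r z s s' (f n)); auto. intros x Hx. now apply (Hf n). }
  assert (lim : forall k, cdiff k c -> ulim U (fun n => k (w n)) (k c)).
  { intros k Hk. apply (ulim_cont U HU); [now apply cdiff_ccont|easy]. }
  assert (Dinv : cdiff (fun x => r / x)%C c).
  { apply cdiff_div; [apply cdiff_const|apply cdiff_id|easy]. }
  assert (Q1 : Cmod (c - z) <= q * Cmod (1 - Cconj z * c)).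
  { apply (ulim_mod_compare U (fun n => w n - z)%C (fun n => 1 - Cconj z * w n)%C); try easy.
    - apply (lim (fun x => x - z)%C). apply cdiff_minus; [apply cdiff_id|apply cdiff_const].
    - apply (lim (fun x => 1 - Cconj z * x)%C). apply cdiff_minus; [apply cdiff_const|].
      apply cdiff_mult; [apply cdiff_const|apply cdiff_id].
    - apply (ultra_mono U HU) with (2 := Hsv). easy. }
  assert (Q2 : Cmod (r / c - r / z) <= q * Cmod (1 - Cconj (r / z) * (r / c))).
  { apply (ulim_mod_compare U (fun n => r / w n - r / z)%C
      (fun n => 1 - Cconj (r / z) * (r / w n))%C); try easy.
    - apply (lim (fun x => r / x - r / z)%C). apply cdiff_minus; [easy|apply cdiff_const].
    - apply (lim (fun x => 1 - Cconj (r / z) * (r / x))%C). apply cdiff_minus; [apply cdiff_const|].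
      apply cdiff_mult; [apply cdiff_const|easy].
    - apply (ultra_mono U HU) with (2 := Hsv). easy. }
  apply pseudo_hyperbolic_strict in Q1; [|rewrite Cmod_R, Rabs_right; lra|easy|easy].
  assert (Mc : Cmod (r / c) = r / Cmod c).
  { rewrite Cmod_div by easy. rewrite Cmod_R, Rabs_right; lra. }
  apply pseudo_hyperbolic_strict in Q2; [| | |easy].
  2:{ rewrite <- RtoC_div by lra. rewrite Cmod_R, Rabs_right.
      - apply Rmult_lt_reg_r with z; [lra|]. unfold Rdiv. rewrite Rmult_assoc, Rinv_l; lra.
      - apply Rle_ge, Rle_mult_inv_pos; lra. }
  2:{ rewrite Mc. apply Rmult_le_reg_r with (Cmod c); [lra|].
      unfold Rdiv. rewrite Rmult_assoc, Rinv_l; lra. }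
  rewrite Mc in Q2.
  assert (Ac : annulus r c).
  { split; [|easy]. apply Rmult_lt_compat_r with (r := Cmod c) in Q2; [|lra].
    unfold Rdiv in Q2. rewrite Rmult_assoc, Rinv_l in Q2; lra. }
  exists c. split; [easy|].
  destruct (copen_closed_disc _ c 1 (annulus_open r) Ac Rlt_0_1) as [rc [Hrc Hbc]].
  apply (ulim_unique U HU (fun n => f n (w n))).
  - apply (ultralimit_eval U f w c (h c) rc 1); auto; [lra|]. intros n b Hb. now apply Hf, Hbc.
  - intros e He. apply (ultra_mono U HU) with (2 := Hsv). intros n [E _].
    rewrite E, Cmod_diag. easy.
Qed.

Lemma extend_to_annulus (r z p : R) (f : C -> C) : annulus r p -> z <> p -> annulus r z ->
  (forall w, annulus r w -> w <> p -> cdiff f w /\ Cmod (f w) <= 1) ->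
  injective_on (fun w => annulus r w /\ w <> p) f -> f z = 0 ->
  exists F, into_closed_disc (annulus r) F /\ injective_on (annulus r) F /\ F z = 0 /\
    forall s, (forall y, Cmod y < s -> image_of (fun w => annulus r w /\ w <> p) f y) ->
      s <= Cmod (F p) /\ forall y, Cmod y < s -> image_of (annulus r) F y.
Proof.
  intros Hp Nzp Hz Hf Hinj fz.
  destruct (copen_closed_disc _ p 1 (annulus_open r) Hp Rlt_0_1) as [rho [Hrho Hball]].
  destruct (riemann_removable f p rho 1) as [F [E D]]; [lra|auto|].
  assert (DF : forall w, annulus r w -> cdiff F w).
  { intros w Hw. destruct (classic (w = p)) as [->|N]; [easy|].
    apply (cdiff_local f F w (Cmod (w - p))); [now apply Cmod_minus_pos| |now apply Hf].
    intros v Hv. symmetry. apply E. intros ->. rewrite Cmod_minus_sym in Hv. lra. }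
  assert (IF : injective_on (annulus r) F).
  { apply (injective_on_puncture_filled _ F p (annulus_open r) Hp DF).
    intros u v [Hu Nu] [Hv Nv]. rewrite !E by easy. now apply Hinj. }
  exists F. split; [|split; [easy|split]].
  - intros w Hw. split; [now apply DF|]. destruct (classic (w = p)) as [->|N].
    + apply (max_principle F p rho 1); try lra.
      * intros b Hb. now apply cdiff_ccont, DF, Hball.
      * intros b Hb. right. exists (rho - Cmod (b - p)). split; [lra|]. intros w' Hw'.
        apply DF, Hball. assert (T := Cmod_minus_triangle w' b p). lra.
      * intros b Hb. rewrite E.
        -- apply Hf; [apply Hball; lra|]. intros ->. rewrite Cmod_diag in Hb. lra.
        -- intros ->. rewrite Cmod_diag in Hb. lra.
      * rewrite Cmod_diag. lra.
    + rewrite E by easy. now apply Hf.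
  - rewrite E; [easy|]. intros X. now apply RtoC_inj in X.
  - intros s Hs. split.
    + apply Rnot_lt_le. intros L. destruct (Hs _ L) as [w [[Hw Nw] Ew]].
      rewrite <- E in Ew by easy. apply Nw. now apply IF.
    + intros y Hy. destruct (Hs y Hy) as [w [[Hw Nw] Ew]]. exists w. now rewrite E.
Qed.

Lemma no_extremal_squeezing_sequence (r z p M : R) (f : nat -> C -> C) : 0 < r -> 0 < M ->
  r < z < 1 -> annulus r p -> p < 0 -> extremal_bound (annulus r) z p M ->
  (forall n w, annulus r w -> w <> p -> cdiff (f n) w /\ Cmod (f n w) <= 1) ->
  (forall n, injective_on (fun w => annulus r w /\ w <> p) (f n)) -> (forall n, f n z = 0) ->
  (forall n y, Cmod y < M - / INR (S n) -> image_of (fun w => annulus r w /\ w <> p) (f n) y) ->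
  False.
Proof.
  intros Hr PM Hz Hp Np Hext Hf Hinj fz Hsurj.
  assert (Az : annulus r z) by (unfold annulus; rewrite Cmod_R, Rabs_right; lra).
  assert (Nzp : z <> p) by lra.
  destruct (choice _ (fun n => extend_to_annulus r z p (f n) Hp Nzp Az (Hf n) (Hinj n) (fz n)))
    as [F HF].
  destruct free_ultrafilter as [U HU].
  assert (HF1 : forall n, into_closed_disc (annulus r) (F n)) by (intros n; apply HF).
  assert (HF2 : forall n, injective_on (annulus r) (F n)) by (intros n; apply HF).
  assert (HF3 : forall n, F n z = 0) by (intros n; apply HF).
  (* One ultrafilter serves all points, so these pointwise limits form a single function [h]. *)
  assert (ch : forall w, exists l, annulus r w -> ulim U (fun n => F n w) l).
  { intros w. destruct (classic (annulus r w)) as [A|A].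
    - destruct (ulim_exists U HU (fun n => F n w) 1) as [l Hl].
      + apply ultra_all; [easy|]. intros n. now apply HF1.
      + now exists l.
    - now exists 0%C. }
  destruct (choice _ ch) as [h Hh]. clear ch.
  assert (Dh : into_closed_disc (annulus r) h).
  { intros w Hw. split.
    - destruct (copen_closed_disc _ w 1 (annulus_open r) Hw Rlt_0_1) as [rho [Hrho Hball]].
      apply (ultralimit_cdiff U F h w rho 1); [easy|lra| |auto]. intros n b Hb. now apply HF1, Hball.
    - apply (ulim_mod_le U HU (fun n => F n w)); [auto|]. apply ultra_all; [easy|].
      intros n. now apply HF1. }
  assert (hz : h z = 0).
  { apply (ulim_unique U HU (fun n => F n z)); [auto|]. intros e He. apply ultra_all; [easy|].
    intros n. rewrite HF3, Cmod_diag. easy. }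
  assert (large : forall s, s < M -> U (fun n => s < M - / INR (S n))).
  { intros s Hs. apply (ultra_mono U HU) with (2 := inv_INR_eventually U (M - s) HU ltac:(lra)).
    intros n Hn. lra. }
  assert (hp : Cmod (h p) = M).
  { apply Rle_antisym; [now apply Hext|]. apply le_epsilon. intros e He.
    assert (X : M - e <= Cmod (h p)); [|lra].
    apply (ulim_mod_ge U HU (fun n => F n p)); [auto|].
    apply (ultra_mono U HU) with (2 := large (M - e) ltac:(lra)). intros n Hn.
    destruct (HF n) as [_ [_ [_ X]]]. destruct (X _ (Hsurj n)) as [Y _]. lra. }
  (* A locally constant [h] would be constant on the annulus, against [h z = 0] and
     [Cmod (h p) = M > 0]. *)
  assert (nlc : forall a, annulus r a -> ~ locally_constant_at h a).
  { intros a Ha Hloc.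
    assert (D : forall w, annulus r w -> cdiff (fun w => h w - h a)%C w).
    { intros w Hw. apply cdiff_minus; [now apply Dh|apply cdiff_const]. }
    assert (Z : forall w, annulus r w -> (h w - h a)%C = 0).
    { intros w. apply (annulus_identity r (fun w => h w - h a)%C a Hr D Ha).
      destruct Hloc as [d [Hd H]]. exists d. split; [easy|]. intros v Hv. rewrite (H v Hv). ring. }
    assert (E : h p = h z).
    { apply Cmod_minus_eq_0. replace (h p - h z)%C with ((h p - h a) - (h z - h a))%C by ring.
      rewrite (Z p Hp), (Z z Az). apply Cmod_diag. }
    rewrite E, hz, Cmod_0 in hp. lra. }
  assert (Ih : injective_on (annulus r) h).
  { apply (hurwitz_injective U F h (annulus r) 1); auto.
    - apply annulus_open.
    - intros w Hw. now apply Dh. }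
  assert (Sh : forall v, Cmod v < M -> image_of (annulus r) h v).
  { apply (ultralimit_surjective U r z M F h); auto. intros s Hs.
    apply (ultra_mono U HU) with (2 := large s Hs). intros n Hn y Hy.
    destruct (HF n) as [_ [_ [_ X]]]. destruct (X _ (Hsurj n)) as [_ Y]. apply Y. lra. }
  assert (NM : RtoC M <> 0) by (intros X; apply RtoC_inj in X; lra).
  set (tau := (Cconj (h p) / M)%C).
  assert (Mt : Cmod tau = 1).
  { unfold tau. rewrite Cmod_div by easy. rewrite Cmod_conj, hp, Cmod_R, Rabs_right by lra. field. lra. }
  assert (Nt : tau <> 0) by (apply Cmod_gt_0; lra).
  assert (Tp : (tau * h p)%C = RtoC M).
  { unfold tau. replace (Cconj (h p) / M * h p)%C with (h p * Cconj (h p) / M)%C by (field; easy).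
    rewrite <- Cmod2_conj, hp, RtoC_pow. field; easy. }
  assert (Dk : into_closed_disc (annulus r) (fun w => tau * h w)%C).
  { intros w Hw. split.
    - apply cdiff_mult; [apply cdiff_const|now apply Dh].
    - rewrite Cmod_mult, Mt, Rmult_1_l. now apply Dh. }
  assert (kz : (tau * h z)%C = 0) by (rewrite hz; ring).
  apply (symmetric_injective_absurd r M z p (fun w => tau * h w)%C); auto.
  - intros w Hw. now apply Dk.
  - intros u v Hu Hv E. apply Ih; auto.
    replace (h u) with (/ tau * (tau * h u))%C by (field; easy). rewrite E. field; easy.
  - apply (extremal_symmetric r M z p (fun w => tau * h w)%C); auto. lra.
  - intros v Hv. destruct (Sh (/ tau * v)%C) as [w [Hw Ew]].
    + rewrite Cmod_mult, Cmod_inv, Mt by easy. lra.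
    + exists w. split; [easy|]. rewrite Ew. field; easy.
Qed.

(** * The two suprema *)

Lemma real_Lub_Rbar (E : R -> Prop) (x0 B : R) : E x0 -> (forall x, E x -> x <= B) ->
  (forall x, E x -> x <= real (Lub_Rbar E)) /\
  (forall e, 0 < e -> exists x, E x /\ real (Lub_Rbar E) - e < x).
Proof.
  intros H0 HB. destruct (Lub_Rbar_correct E) as [L1 L2].
  assert (F : is_finite (Lub_Rbar E)).
  { assert (A := L1 x0 H0). assert (A' := L2 (Finite B) HB).
    destruct (Lub_Rbar E); simpl in *; easy. }
  rewrite <- F in L1, L2. set (m := real (Lub_Rbar E)) in *. split.
  - intros x Hx. exact (L1 x Hx).
  - intros e He. apply NNPP. intros N. assert (X : Rbar_le m (m - e)).
    + apply L2. intros x Hx. simpl. apply Rnot_lt_le. intros L. apply N. now exists x.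
    + simpl in X. lra.
Qed.

Lemma artanh_le_tanh (x c : R) : 0 <= x < 1 -> artanh x <= c -> x <= tanh c.
Proof.
  intros Hx H. unfold artanh in H.
  assert (P : 0 < (1 + x) / (1 - x)) by (apply Rdiv_lt_0_compat; lra).
  assert (L : (1 + x) / (1 - x) <= exp c * exp c).
  { rewrite <- (exp_ln _ P), <- exp_plus.
    destruct (Rle_lt_or_eq_dec (ln ((1 + x) / (1 - x))) (c + c)) as [L|L]; [lra| |].
    - left. now apply exp_increasing.
    - rewrite L. lra. }
  apply Rmult_le_compat_r with (r := 1 - x) in L; [|lra].
  unfold Rdiv in L. rewrite Rmult_assoc, Rinv_l in L by lra.
  unfold tanh, sinh, cosh. rewrite exp_Ropp.
  assert (Pe := exp_pos c). set (E := exp c) in *.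
  replace ((E - / E) / 2 / ((E + / E) / 2)) with ((E * E - 1) / (E * E + 1)) by (field; split; nra).
  apply Rmult_le_reg_r with (E * E + 1); [nra|].
  unfold Rdiv. rewrite Rmult_assoc, Rinv_l by nra. nra.
Qed.

Lemma squeezing_at_spec (G : C -> Prop) (f : C -> C) : holomorphic_into_disc G f ->
  squeezing_at G f <= 1 /\
  (forall s, 0 <= s -> (forall y, Cdisc s y -> image_of G f y) -> s <= squeezing_at G f) /\
  (forall e, 0 < e -> exists s, squeezing_at G f - e < s /\ forall y, Cdisc s y -> image_of G f y).
Proof.
  intros [_ Hf]. set (E := fun s => 0 <= s /\ forall y, Cdisc s y -> image_of G f y).
  assert (E0 : E 0).
  { split; [lra|]. intros y Hy. unfold Cdisc in Hy. assert (X := Cmod_ge_0 y). lra. }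
  assert (E1 : forall s, E s -> s <= 1).
  { intros s [_ Hs]. apply Rnot_lt_le. intros L. destruct (Hs 1%C) as [w [Hw Ew]].
    - unfold Cdisc. now rewrite Cmod_1.
    - specialize (Hf w Hw). rewrite Ew in Hf. unfold Cdisc in Hf. rewrite Cmod_1 in Hf. lra. }
  destruct (real_Lub_Rbar E 0 1 E0 E1) as [L1 L2]. change (real (Lub_Rbar E)) with (squeezing_at G f) in *.
  split; [|split].
  - apply le_epsilon. intros e He. destruct (L2 e He) as [s [Hs Hl]]. specialize (E1 s Hs). lra.
  - intros s H0 Hs. apply L1. now split.
  - intros e He. destruct (L2 e He) as [s [Hs Hl]]. exists s. split; [easy|apply Hs].
Qed.

(** Positivity rules out an infinite supremum, for which [real] returns 0 and [tanh 0 = 0]. Maps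
    into the closed disc are first scaled into the open one. *)
Lemma caratheodory_extremal_bound (G : C -> Prop) (z p : C) : G p ->
  0 < tanh (caratheodory G z p) -> extremal_bound G z p (tanh (caratheodory G z p)).
Proof.
  intros Hp Hpos f Hf fz. unfold caratheodory in *.
  set (E := fun t => _) in *.
  destruct (Lub_Rbar_correct E) as [L _].
  assert (t0 : tanh 0 = 0) by (unfold tanh; rewrite sinh_0; unfold Rdiv; ring).
  destruct (Lub_Rbar E) as [c| |] eqn:EL; simpl real in *; try lra.
  assert (Pf := Cmod_ge_0 (f p)). destruct (Hf p Hp) as [_ Bp].
  apply Rnot_lt_le. intros Lt. set (T := tanh c) in *.
  (* The scaled value [t * Cmod (f p)] is the midpoint of [T] and [Cmod (f p)], still above [T]. *)
  set (t := (T + Cmod (f p)) / 2 / Cmod (f p)).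
  assert (Et : t * Cmod (f p) = (T + Cmod (f p)) / 2) by (unfold t; field; lra).
  assert (Ht : 0 < t < 1).
  { split.
    - unfold t. repeat apply Rdiv_lt_0_compat; lra.
    - apply Rmult_lt_reg_r with (Cmod (f p)); lra. }
  assert (mt : forall w, Cmod (t * f w) = t * Cmod (f w)).
  { intros w. rewrite Cmod_mult, Cmod_R, Rabs_right; lra. }
  assert (X : artanh (t * Cmod (f p)) <= c).
  { apply (L (artanh (t * Cmod (f p)))). exists (fun w => t * f w)%C, (t * f p)%C.
    split; [split|split; [|split]].
    - intros w Hw. apply ex_derive_cdiff. apply cdiff_mult; [apply cdiff_const|now apply Hf].
    - intros w Hw. unfold Cdisc. rewrite mt. destruct (Hf w Hw) as [_ B].
      assert (Y := Cmod_ge_0 (f w)). nra.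
    - rewrite fz. ring.
    - easy.
    - now rewrite mt. }
  apply artanh_le_tanh in X; [|lra]. fold T in X. lra.
Qed.

Lemma squeezing_pos_approx (G : C -> Prop) (z : C) : copen G -> G z ->
  (forall w, G w -> Cmod w < 1) ->
  0 < squeezing G z /\
  forall e, 0 < e -> exists f, holomorphic_into_disc G f /\ injective_on G f /\ f z = 0 /\
    forall y, Cmod y < squeezing G z - e -> image_of G f y.
Proof.
  intros HG Hz HB.
  set (E := fun t => exists f, holomorphic_into_disc G f /\ injective_on G f /\ f z = 0 /\
    t = squeezing_at G f).
  (* An explicit competitor: it makes the set of radii nonempty and, [G] being open, the squeezing
     function positive. *)
  set (f0 := fun w => ((w - z) / 2)%C).
  assert (N2 : RtoC 2 <> 0) by (intros X; apply RtoC_inj in X; lra).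
  assert (m0 : forall w, Cmod (f0 w) = Cmod (w - z) / 2).
  { intros w. unfold f0. rewrite Cmod_div, Cmod_R, Rabs_right by (easy || lra). easy. }
  assert (H0 : holomorphic_into_disc G f0).
  { split.
    - intros w Hw. apply ex_derive_cdiff. apply cdiff_div; [|apply cdiff_const|easy].
      apply cdiff_minus; [apply cdiff_id|apply cdiff_const].
    - intros w Hw. unfold Cdisc. rewrite m0. assert (T := Cmod_minus_le w z).
      assert (B1 := HB w Hw). assert (B2 := HB z Hz). lra. }
  assert (E0 : E (squeezing_at G f0)).
  { exists f0. split; [easy|]. split; [|split; [|easy]].
    - intros u v _ _ X. unfold f0 in X.
      replace u with ((u - z) / 2 * 2 + z)%C by (field; easy). rewrite X. field; easy.
    - unfold f0. field; easy. }
  assert (E1 : forall t, E t -> t <= 1).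
  { intros t [f [Hf [_ [_ ->]]]]. now apply squeezing_at_spec. }
  destruct (real_Lub_Rbar E _ 1 E0 E1) as [L1 L2].
  change (real (Lub_Rbar E)) with (squeezing G z) in *. split.
  - destruct (HG z Hz) as [d [Hd H]].
    apply Rlt_le_trans with (d / 2); [lra|]. eapply Rle_trans; [|apply L1, E0].
    destruct (squeezing_at_spec G f0 H0) as [_ [S _]]. apply S; [lra|].
    intros y Hy. exists (2 * y + z)%C. split.
    + apply H. replace (2 * y + z - z)%C with (2 * y)%C by ring.
      rewrite Cmod_mult, Cmod_R, Rabs_right by lra. unfold Cdisc in Hy. lra.
    + unfold f0. field; easy.
  (* Half of [e] for the supremum over maps and half for the supremum over radii. *)
  - intros e He. destruct (L2 (e / 2) ltac:(lra)) as [t [[f [Hf [If [fz Et]]]] Lt]].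
    exists f. split; [easy|]. split; [easy|]. split; [easy|]. intros y Hy.
    destruct (squeezing_at_spec G f Hf) as [_ [_ S]].
    destruct (S (e / 2) ltac:(lra)) as [s [Hs Hs']]. apply Hs'. unfold Cdisc. lra.
Qed.

Theorem theorem1p11 :
  forall r : R, 0 < r < 1 ->
  forall z : R, r < z < sqrt r ->
    squeezing (punctured_annulus r) (RtoC z)
    <> tanh (caratheodory (annulus r) (RtoC z) (RtoC (- sqrt r))).
Proof.
  intros r Hr z Hz E.
  assert (Ps : r < sqrt r < 1).
  { split; [lra|]. rewrite <- sqrt_1. apply sqrt_lt_1; lra. }
  set (p := - sqrt r) in *.
  assert (Hp : annulus r p) by (unfold annulus, p; rewrite Cmod_R, Rabs_left; lra).
  assert (Az : annulus r z) by (unfold annulus; rewrite Cmod_R, Rabs_right; lra).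
  assert (HD : copen (punctured_annulus r)).
  { intros a [Ha Na]. destruct (annulus_open r a Ha) as [d [Hd H]].
    assert (P := Cmod_minus_pos _ _ Na).
    exists (Rmin d (Cmod (a - p))). split; [now apply Rmin_glb_lt|]. intros w Hw. split.
    - apply H. eapply Rlt_le_trans; [exact Hw|apply Rmin_l].
    - intros ->. assert (V := Rlt_le_trans _ _ _ Hw (Rmin_r _ _)).
      fold p in V. rewrite Cmod_minus_sym in V. lra. }
  destruct (squeezing_pos_approx (punctured_annulus r) z HD) as [Spos Sapp].
  { split; [easy|]. intros X. apply RtoC_inj in X. lra. }
  { intros w [[_ X] _]. easy. }
  set (M := squeezing (punctured_annulus r) z) in *.
  (* The assumed equality transfers positivity from the squeezing function to the Carathéodory
     side. *)
  assert (Hext : extremal_bound (annulus r) z p M).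
  { rewrite E in Spos |- *. now apply caratheodory_extremal_bound. }
  destruct (choice (fun n f => holomorphic_into_disc (punctured_annulus r) f /\
      injective_on (punctured_annulus r) f /\ f z = 0 /\
      forall y, Cmod y < M - / INR (S n) -> image_of (punctured_annulus r) f y)) as [f Hf].
  { intros n. apply Sapp. apply Rinv_0_lt_compat, lt_0_INR. lia. }
  apply (no_extremal_squeezing_sequence r z p M f); try easy; try (unfold p; lra).
  - intros n w Hw Nw. destruct (Hf n) as [[H1 H2] _]. split.
    + apply ex_derive_cdiff, H1. now split.
    + left. apply H2. now split.
  - intros n. apply (Hf n).
  - intros n. apply (Hf n).
  - intros n. apply (Hf n).
Qed.
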